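(* Let $1<q<p<\infty$ and assume (N1)–(N2). Then for every $\epsilon>0$ and $\bar u\in L^p(\Omega;\mathbb R^d)$ there exists $\delta>0$ such that for all $u,v\in B_{L^p}(\bar u,\delta)$ there exists $M\in\partial^\circ\mathfrak H[\bar u]$ satisfying $$\|\mathfrak H[u]-\mathfrak H[v]-M(u-v)\|_{L^q(\Omega;\mathbb R^n)}<\epsilon\|u-v\|_{L^p(\Omega;\mathbb R^d)}.$$
   Context: Let $(\Omega,\mathcal F,\mu)$ be a complete finite measure space and $H\colon\Omega\times\mathbb R^d\to\mathbb R^n$. For $x\in\Omega$ and $z\in\mathbb R^d$, $\partial^CH(x,z)$ denotes the Clarke generalized Jacobian of $H(x,\cdot)$ at $z$: the convex hull of all limits $\lim_k J_zH(x,z_k)$ with $z_k\to z$ and $z_k$ outside a Lebesgue-null set off which $H(x,\cdot)$ is differentiable ($J_z$ = Jacobian matrix in $z$); it is a subset of $\mathbb R^{n\times d}$. (N1): $H$ is $(\mathcal F\otimes\mathcal B(\mathbb R^d),\mathcal B(\mathbb R^n))$-measurable and $z\mapsto H(x,z)$ is locally Lipschitz for every $x\in\Omega$. (N2): there exist $C_H>0$ and $1<q\le p<\infty$ with $|H(x,z)|\le C_H(1+|z|^{p/q})$ for all $(x,z)$, and $|M|\le C_H(1+|z|^{p/q-1})$ for all $M\in\partial^CH(x,z)$ and all $(x,z)$. The Nemytskii operator $\mathfrak H\colon L^p(\Omega;\mathbb R^d)\to L^q(\Omega;\mathbb R^n)$ is $\mathfrak H[u](x)=H(x,u(x))$. For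 $u\in L^p(\Omega;\mathbb R^d)$, $\partial^\circ\mathfrak H[u]$ is the set of all $\mathcal F$-measurable $A\colon\Omega\to\mathbb R^{n\times d}$ with $A(x)\in\partial^CH(x,u(x))$ for $\mu$-a.e. $x$; such $A$ acts on $w\in L^p$ by $(Aw)(x)=A(x)w(x)$. $B_{L^p}(\bar u,\delta)$ is a closed ball.
   Formalization: The estimate is stated only for u, v in the ball with ‖u−v‖ in L^p positive, because for u = v almost everywhere the strict inequality would read 0 < 0. *)

(* Defs.v *)
From HB Require Import structures.
From mathcomp Require Import all_boot all_order all_algebra.
From mathcomp Require Import all_classical all_reals all_analysis.
Set Implicit Arguments. Unset Strict Implicit. Unset Printing Implicit Defensive.
Import Order.TTheory GRing.Theory Num.Theory.
Import numFieldNormedType.Exports.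
Local Open Scope classical_set_scope.
Local Open Scope ring_scope.

Definition vnorm {R : realType} {m k : nat} (A : 'M[R]_(m, k)) : R :=
  Num.sqrt (\sum_i \sum_j A i j ^+ 2).

Definition borel_mfun {d} {T : measurableType d} {V : topologicalType}
  (f : T -> V) : Prop := forall O : set V, open O -> measurable (f @^-1` O).

Definition borel_rV {R : realType} (k : nat) : set (set 'rV[R]_k) :=
  <<s [set O : set 'rV[R]_k | open O] >>.

Definition prod_sets {R : realType} {d} (T : measurableType d) (k : nat)
  : set (set (T * 'rV[R]_k)) :=
  <<s [set X | exists (A : set T) (B : set 'rV[R]_k),
         measurable A /\ borel_rV B /\ X = A `*` B] >>.

Definition conv_hull {R : realType} {V : lmodType R} (S : set V) : set V :=
  [set v | exists (m : nat) (c : 'I_m -> R) (a : 'I_m -> V),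
     (forall i, 0 <= c i) /\ \sum_i c i = 1 /\ (forall i, S (a i)) /\
     v = \sum_i c i *: a i].

(* Clarke generalized Jacobian of f : R^k -> R^l at z.
   Convention: vectors are rows, the Jacobian 'J f z : 'M_(k,l) is the matrix
   of the differential acting by h |-> h *m 'J f z. *)
Definition clarke_limits {R : realType} {k l : nat}
  (f : 'rV[R]_k -> 'rV[R]_l) (z : 'rV[R]_k) : set 'M[R]_(k, l) :=
  [set J | exists zs : nat -> 'rV[R]_k,
     (forall i, differentiable f (zs i)) /\
     zs @ \oo --> z /\ (fun i => 'J f (zs i)) @ \oo --> J].

Definition clarke_jac {R : realType} {k l : nat}
  (f : 'rV[R]_k -> 'rV[R]_l) (z : 'rV[R]_k) : set 'M[R]_(k, l) :=
  conv_hull (clarke_limits f z).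

Definition N1 {R : realType} {d} {T : measurableType d} {k l : nat}
  (H : T -> 'rV[R]_k -> 'rV[R]_l) : Prop :=
  (forall O : set 'rV[R]_l, open O ->
     @prod_sets R _ T k ((fun xz : T * 'rV[R]_k => H xz.1 xz.2) @^-1` O)) /\
  (forall x z, exists r : R, 0 < r /\ exists L : R,
     forall y1 y2, vnorm (y1 - z) < r -> vnorm (y2 - z) < r ->
       vnorm (H x y1 - H x y2) <= L * vnorm (y1 - y2)).

Definition N2 {R : realType} {d} {T : measurableType d} {k l : nat}
  (H : T -> 'rV[R]_k -> 'rV[R]_l) (p q : R) : Prop :=
  1 < q /\ q <= p /\
  exists CH : R, 0 < CH /\
   forall x z,
     vnorm (H x z) <= CH * (1 + vnorm z `^ (p / q)) /\
     forall M, clarke_jac (H x) z M ->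
       vnorm M <= CH * (1 + vnorm z `^ (p / q - 1)).

Definition Lpnorm {R : realType} {d} {T : measurableType d}
  (mu : {measure set T -> \bar R}) {m k : nat} (p : R)
  (u : T -> 'M[R]_(m, k)) : \bar R :=
  Lnorm mu p%:E (fun x => (vnorm (u x))%:E).

Definition in_Lp {R : realType} {d} {T : measurableType d}
  (mu : {measure set T -> \bar R}) {k : nat} (p : R)
  (u : T -> 'rV[R]_k) : Prop :=
  borel_mfun u /\ (Lpnorm mu p u < +oo)%E.

Definition nem_clarke {R : realType} {d} {T : measurableType d}
  (mu : {measure set T -> \bar R}) {k l : nat}
  (H : T -> 'rV[R]_k -> 'rV[R]_l) (u : T -> 'rV[R]_k)
  : set (T -> 'M[R]_(k, l)) :=
  [set A | borel_mfun A /\ {ae mu, forall x, clarke_jac (H x) (u x) (A x)}].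

(* Main.v *)
Require Import Defs.
From HB Require Import structures.
From mathcomp Require Import all_boot all_order all_algebra.
From mathcomp Require Import all_classical all_reals all_analysis.
From mathcomp Require Import lra ring.
From mathcomp Require Import measurable_realfun.
Set Implicit Arguments. Unset Strict Implicit. Unset Printing Implicit Defensive.
Import Order.TTheory GRing.Theory Num.Theory.
Import numFieldNormedType.Exports.
Local Open Scope classical_set_scope.
Local Open Scope ring_scope.

(* Proof idea.  The Jacobian of [H x] is averaged over a small cloud of random points
   that avoid the null set of Rademacher's theorem.  Averages of such matrices over
   finitely many points of a small ball around [ubar x] satisfy the mean value theorem up
   to any prescribed relative error, and, as the ball shrinks, they accumulate only in the
   convex hull of the limiting Jacobians.  Indexing them by a countable set (rational
   translates, binary trees of midpoints) gives measurable choices: for given [u], [v] the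
   first average that fits the increment [H u - H v], then its projection [M] on the limit
   set.  The quotient [a = |H u - H v - (u - v) M| / |u - v|] is small where [u], [v] are
   close to [ubar], outside a set of small measure, and has growth [|.| ^ (p/q - 1)]
   elsewhere, so it is small in [L^s] with [1/s = 1/q - 1/p]; Hoelder concludes. *)

(** * Differentiability of Lipschitz functions on the line *)

(** A mean value matrix for [u x] and [v x] comes from derivatives near [ubar x], whereas [M x] has
    to lie in the Clarke Jacobian at [ubar x] itself and to depend measurably on [x]. The countable
    families settle both demands: their members are measurable in [x], they decrease with the level,
    and limits of members taken from all levels are Clarke matrices. How fast they contract depends
    on [x], without uniformity; hence the sets [level_set], which exhaust the space, and the order
    of the choices: precision [e], then level [m], then [delta]. Only two properties of the random
    point matter: it almost surely avoids the non-differentiability set of a given Lipschitz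
    function, and its law changes by [O(|a|)] under a translation by [a]. The uniform law on a cube
    has both and is built one coordinate at a time, in step with the induction that proves
    Rademacher's theorem. The second property makes the averaged Jacobian at scale [r] Lipschitz
    with constant of order [1 / r], which is enough for a Taylor estimate. The strict inequality
    [q < p] makes [s] finite, and [(p/q - 1) * s = p] makes the growth of the quotient
    integrable. *)

Lemma lipschitz_continuous (R : realType) (V W : normedModType R) (g : V -> W) (K : R) :
  (forall x y, `|g x - g y| <= K * `|x - y|) -> continuous g.
Proof.
move=> gK x; apply/cvgrPdist_lt => e e0.
have K1 : 0 < `|K| + 1 by rewrite ltr_wpDl.
apply/nbhs_ballP; exists (e / (`|K| + 1)) => /=; first by rewrite divr_gt0.
move=> y; rewrite -ball_normE/= ltr_pdivlMr// => xy.
rewrite (le_lt_trans (gK _ _))// (le_lt_trans _ xy)// mulrC ler_wpM2l//.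
by rewrite (le_trans (ler_norm K))// lerDl.
Qed.

Lemma ae_sub d (T : measurableType d) (R : realType)
    (mu : {measure set T -> \bar R}) (P Q : T -> Prop) :
  (forall x, P x -> Q x) -> {ae mu, forall x, P x} -> {ae mu, forall x, Q x}.
Proof. by move=> PQ; apply: negligibleS => x /= nQ /PQ. Qed.

Section one_dimensional.
Context {R : realType}.
Local Notation mu := (@lebesgue_measure R).

Lemma symmetric_itv_cover (t : R) : exists k : nat, `]- k%:R, k%:R[%classic t.
Proof.
by exists (Num.bound `|t|); rewrite /= in_itv/= -ltr_norml archi_boundP.
Qed.

Lemma cumulative_itv (G : cumulative R R) (a b : R) : a <= b ->
  lebesgue_stieltjes_measure G `]a, b] = (G b - G a)%:E.
Proof.
move=> ab; rewrite /lebesgue_stieltjes_measure /measure_extension.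
by rewrite measurable_mu_extE/=; [rewrite wlength_itv_bnd|exact: is_ocitv].
Qed.

Lemma derivable_near_addc (F G : R -> R) (c t : R) : derivable F t 1 ->
  (\forall y \near t, G y = F y + c) -> derivable G t 1.
Proof.
move=> dF FG; have dFc := @derivableD R R R F (cst c) t 1 dF (derivable_cst _ _ _).
apply: near_eq_derivable dFc.
by apply: filterS FG => y /= ->.
Qed.

Lemma derivable_linear_part (h : R -> R) (c t : R) :
  derivable (fun x : R => x / c + h x) t 1 -> derivable h t 1.
Proof.
move=> dG.
have dl : derivable (fun x : R => c^-1 * x) t 1.
  change (derivable (c^-1 \*: (id : R -> R)) t 1).
  by apply: derivableZ; exact: derivable_id.
have -> : h = (fun x : R => x / c + h x) - (fun x : R => c^-1 * x).
  by apply/funext => x; rewrite !fctE (mulrC x) addrAC subrr add0r.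
exact: (@derivableB _ _ _ _ _ _ _ dG dl).
Qed.

(** With Lipschitz constant one half, [t / 2 + h t] and [t / 2 - h t] are both nondecreasing, and
    their Stieltjes measures add up to Lebesgue measure. The first is therefore absolutely
    continuous, and Lebesgue differentiation of its density gives the derivative. *)
Lemma half_lipschitz_derivable_ae (h : R -> R) :
  (forall x y, `|h x - h y| <= 2^-1 * `|x - y|) ->
  {ae mu, forall t, derivable h t 1}.
Proof.
move=> hK.
pose G1 t := t / 2 + h t; pose G2 t := t / 2 - h t.
have hc := lipschitz_continuous hK.
have nd1 : {homo G1 : x y / x <= y}.
  move=> x y xy; have := hK y x; rewrite (ger0_norm (_ : 0 <= y - x)) ?subr_ge0//.
  by rewrite ler_norml /G1 => /andP[]; lra.
have nd2 : {homo G2 : x y / x <= y}.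
  move=> x y xy; have := hK y x; rewrite (ger0_norm (_ : 0 <= y - x)) ?subr_ge0//.
  by rewrite ler_norml /G2 => /andP[]; lra.
have c1 : continuous G1.
  by move=> t; apply: cvgD; [apply: cvgM; [exact: cvg_id|exact: cvg_cst]|exact: hc].
have c2 : continuous G2.
  by move=> t; apply: cvgB; [apply: cvgM; [exact: cvg_id|exact: cvg_cst]|exact: hc].
pose C1 : cumulative R R := HB.pack G1
  (isCumulative.Build R _ R G1 nd1 (right_continuousW c1)).
pose C2 : cumulative R R := HB.pack G2
  (isCumulative.Build R _ R G2 nd2 (right_continuousW c2)).
pose l1 := lebesgue_stieltjes_measure C1.
pose l2 := lebesgue_stieltjes_measure C2.
have sumE A : measurable A -> mu A = (l1 A + l2 A)%E.
  move=> mA; rewrite -(measure_addE l1 l2).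
  apply: lebesgue_measure_unique mA => X [[a b] _ <-] /=.
  have [ab|ba] := leP a b; last first.
    by rewrite set_itv_ge ?measure0// -leNgt bnd_simp ltW.
  rewrite [RHS](measure_addE l1 l2) /lebesgue_measure /l1 /l2.
  transitivity ((G1 b - G1 a)%:E + (G2 b - G2 a)%:E)%E; last first.
    by congr (_ + _)%E; apply/esym; [exact: (cumulative_itv C1)|exact: (cumulative_itv C2)].
  rewrite -EFinD; transitivity (b - a)%:E; first exact: (cumulative_itv idfun).
  by congr EFin; rewrite /G1 /G2; lra.
have dom : l1 `<< mu.
  apply/null_content_dominatesP => A mA; rewrite [X in X = _](sumE A mA) => /eqP.
  by rewrite padde_eq0// => /andP[/eqP].
(* The Radon-Nikodym density is taken for a finite measure, hence the restriction to bounded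
   intervals. *)
suff H (k : nat) : {ae mu, forall t, `]- k%:R, k%:R[%classic t -> derivable h t 1}.
  have := @negligible_bigcup _ _ _ mu
    (fun k => ~` [set t | `]- k%:R, k%:R[%classic t -> derivable h t 1]) H.
  apply: negligibleS => t /= nt; have [k kt] := symmetric_itv_cover t; exists k => //=.
  by apply: contra_not nt; apply.
pose D : set R := `]- k%:R, k%:R]%classic.
have mD : @measurable _ (measurableTypeR R) D := @measurable_itv R _.
have fD : (l1 D < +oo)%E.
  have -> : l1 D = (G1 k%:R - G1 (- k%:R))%:E; last exact: ltry.
  by apply: (cumulative_itv C1); rewrite (@le_trans _ _ 0)// oppr_le0.
pose nu : {finite_measure set (measurableTypeR R) -> \bar R} := mfrestr mD fD.
have nudom : charge_of_finite_measure nu `<< mu.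
  apply/null_content_dominatesP => A mA A0.
  rewrite /charge_of_finite_measure /nu /mfrestr /mrestr.
  have /null_content_dominatesP/(_ _ _ A0) := dom.
  move=> /(_ mA) l10; apply/eqP; rewrite eq_le measure_ge0 andbT -l10.
  by apply: le_measure; rewrite ?inE//; exact: measurableI.
pose rho := Radon_Nikodym (charge_of_finite_measure nu) mu.
have rhoi : mu.-integrable setT rho by exact: Radon_Nikodym_integrable.
have rhof x : rho x \is a fin_num by exact: Radon_Nikodym_fin_num.
pose f t := fine (rho t).
have fE : EFin \o f = rho by apply/funext => t /=; rewrite fineK.
have fi : mu.-integrable setT (EFin \o f) by rewrite fE.
have fl : locally_integrable setT f by apply: open_integrable_locally => //; exact: openT.
apply: ae_sub (lebesgue_differentiation fl) => t ft.
rewrite /= in_itv/= => /andP[kt tk].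
have Fi : mu.-integrable [set` Interval (BRight (- k%:R)) (BRight (k%:R:R))] (EFin \o f).
  exact: integrableS fi.
have kt' : (BRight (- k%:R : R) < BRight (t : R))%O by rewrite bnd_simp.
have [] := FTC1_lebesgue_pt tk Fi kt' ft.
set F := (X in derivable X) => dF _.
have FE y : - k%:R < y -> y < k%:R -> F y = G1 y - G1 (- k%:R).
  move=> ky yk; rewrite /F.
  pose I : set R := `]- k%:R, y]%classic.
  have nuI : nu I = (G1 y - G1 (- k%:R))%:E.
    rewrite /nu /= /mfrestr /mrestr setIidl; last first.
      by apply: subset_itvl; rewrite bnd_simp ltW.
    by apply: (cumulative_itv C1); exact: ltW.
  have : charge_of_finite_measure nu I = (\int[mu]_(x in I) rho x)%E.
    by apply: Radon_Nikodym_integral => //; exact: (@measurable_itv R).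
  rewrite /charge_of_finite_measure nuI -fE => /(congr1 fine) /= E.
  by rewrite E.
have dG : derivable G1 t 1.
  apply: (derivable_near_addc dF (c := G1 (- k%:R))).
  near=> y; rewrite FE; first by rewrite subrK.
    by near: y; exact: lt_nbhsr.
  by near: y; exact: lt_nbhsl.
exact: (derivable_linear_part dG).
Unshelve. all: by end_near. Qed.

Lemma lipschitz_derivable_ae (g : R -> R) (K : R) :
  (forall x y, `|g x - g y| <= K * `|x - y|) ->
  {ae mu, forall t, derivable g t 1}.
Proof.
move=> gK; pose c := 2 * (`|K| + 1).
have c0 : 0 < c by rewrite mulr_gt0// ltr_wpDl.
have := @half_lipschitz_derivable_ae (fun t => c^-1 * g t).
have H x y : `|c^-1 * g x - c^-1 * g y| <= 2^-1 * `|x - y|.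
  rewrite -mulrBr normrM gtr0_norm ?invr_gt0// ler_pdivrMl//.
  rewrite (le_trans (gK _ _))// mulrA ler_wpM2r// /c.
  by have := ler_norm K; lra.
move=> /(_ H); apply: ae_sub => t /= dt.
have -> : g = (fun t => c * (c^-1 * g t)).
  by apply/funext => x; rewrite mulrA divff ?mul1r// gt_eqF.
exact: (@derivableZ _ _ _ (fun t => c^-1 * g t) c t 1 dt).
Qed.

(** If the ball of radius [eta * |s|] around [t + s] missed [A], then [A] would fill at most the
    fraction [1 - eta / 2] of the ball of radius [2 * |s|] around [t], which is impossible for small
    [s] at a density point. *)
Lemma density_nonporous (A : set R) : measurable A ->
  {ae mu, forall t, A t -> forall eta, 0 < eta -> exists2 delta, 0 < delta &
    forall s, `|s| < delta -> exists2 t', A t' & `|t' - (t + s)| <= eta * `|s|}.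
Proof.
move=> mA; apply: ae_sub (lebesgue_density mA) => t + At eta0.
wlog eta1 : eta0 / eta0 < 1.
  move=> W lt e0; have [|] := ltP eta0 1; first by move=> ?; exact: W.
  move=> e1; have [||d d0 H] := W 2^-1 _ lt.
  - by rewrite invf_lt1 ?ltr1n.
  - by rewrite invr_gt0.
  exists d => // s /H [t' At' tt']; exists t' => //.
  by rewrite (le_trans tt')// ler_wpM2r//; lra.
rewrite indicE mem_set//= => + e0.
move=> /fine_cvgP[_ /cvgrPdist_lt/(_ (eta0 / 4))].
have e4 : 0 < eta0 / 4 by rewrite divr_gt0.
move=> /(_ e4) [d /= d0 H]; exists (d / 2); first by rewrite divr_gt0.
move=> s sd; apply: contrapT => nex.
have [s0|s0] := eqVneq s 0.
  by apply: nex; exists t => //; rewrite s0 addr0 subrr normr0 mulr0.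
have s0' : 0 < `|s| by rewrite normr_gt0.
have := H (2 * `|s|); rewrite /= sub0r normrN gtr0_norm ?mulr_gt0//.
have sd2 : 2 * `|s| < d by rewrite mulrC -ltr_pdivlMr.
have s20 : 0 < 2 * `|s| by rewrite mulr_gt0.
move=> /(_ sd2 isT); apply/negP; rewrite -leNgt.
set m := mu _.
have mb : mu (ball t (2 * `|s|)) = (4 * `|s|)%:E.
  rewrite lebesgue_measure_ball ?mulr_ge0// -mulr_natl; congr EFin; lra.
have mb' : mu (ball (t + s) (eta0 * `|s|)) = (2 * eta0 * `|s|)%:E.
  rewrite lebesgue_measure_ball ?mulr_ge0 ?ltW// -mulr_natl; congr EFin; lra.
have sub : ball (t + s) (eta0 * `|s|) `<=` ball t (2 * `|s|).
  move=> x; rewrite /ball/= => xs.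
  have : `|t - x| <= `|t + s - x| + `|s|.
    by rewrite (_ : t - x = t + s - x - s) ?ler_normB//; lra.
  have : eta0 * `|s| < `|s| by rewrite gtr_pMl.
  lra.
have mbl (x r : R) : measurable (ball x r) by exact: measurable_ball.
have : (m + mu (ball (t + s)%R (eta0 * `|s|)) <= mu (ball t (2 * `|s|)))%E.
  have mI : measurable (A `&` ball t (2 * `|s|)) := measurableI _ _ mA (mbl _ _).
  have mU : measurable ((A `&` ball t (2 * `|s|)) `|` ball (t + s)%R (eta0 * `|s|)) :=
    measurableU _ _ mI (mbl _ _).
  have <- : mu ((A `&` ball t (2 * `|s|)) `|` ball (t + s)%R (eta0 * `|s|))
      = (m + mu (ball (t + s)%R (eta0 * `|s|)))%E.
    apply: measureU => //; first exact: mbl.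
    rewrite -subset0 => x [[Ax _]]; rewrite /ball/= => xs; apply: nex; exists x => //.
    by rewrite distrC ltW.
  apply: le_measure; rewrite ?inE//; first exact: mbl.
  by rewrite subUset; split => //; exact: subIsetr.
rewrite mb mb'.
have m4 : (m <= (4 * `|s|)%:E)%E.
  rewrite -mb; apply: le_measure; rewrite ?inE//; last exact: mbl.
  exact: (measurableI _ _ mA (mbl _ _)).
have mf : m \is a fin_num by rewrite ge0_fin_numE ?measure_ge0//; exact: le_lt_trans m4 (ltry _).
have m0 : (0 <= m)%E by exact: measure_ge0.
move: m0; rewrite -(fineK mf) -EFinD !lee_fin => m0 m1.
rewrite inver/= gt_eqF ?mulr_gt0//= distrC.
rewrite ler_normr; apply/orP; right.
rewrite opprB lerBrDr -lerBrDl ler_pdivrMr ?mulr_gt0//.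
have : 0 < eta0 * `|s| by rewrite mulr_gt0.
lra.
Qed.

End one_dimensional.

(** * Matrix norms and Borel maps *)

Section matrix_norm.
Context {R : realType}.

Lemma mx_norm_entry m n (A : 'M[R]_(m, n)) i j : `|A i j| <= `|A|.
Proof.
by rewrite [leRHS]mx_normrE (le_bigmax _ (fun ij => `|A ij.1 ij.2|) (i, j)).
Qed.

Lemma mx_norm_le m n (A : 'M[R]_(m, n)) c : 0 <= c ->
  (forall i j, `|A i j| <= c) -> `|A| <= c.
Proof.
move=> c0 Ac; rewrite [leLHS]mx_normrE.
by apply/bigmax_leP; split => // -[i j] _; exact: Ac.
Qed.

Lemma mx_norm_lt m n (A : 'M[R]_(m, n)) c : 0 < c ->
  (forall i j, `|A i j| < c) -> `|A| < c.
Proof.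
move=> c0 Ac; rewrite [ltLHS]mx_normrE.
by apply/bigmax_ltP; split => // -[i j] _; exact: Ac.
Qed.

Lemma mx_norm_mulmx m n k (A : 'M[R]_(m, n)) (B : 'M[R]_(n, k)) :
  `|A *m B| <= n%:R * `|A| * `|B|.
Proof.
apply: mx_norm_le => [|i j]; first by rewrite !mulr_ge0.
rewrite mxE (le_trans (ler_norm_sum _ _ _))//.
rewrite (@le_trans _ _ (\sum_(l < n) `|A| * `|B|))//.
  by apply: ler_sum => l _; rewrite normrM ler_pM// mx_norm_entry.
by rewrite sumr_const card_ord -[leLHS]mulr_natl mulrA.
Qed.

Lemma mx_norm_vnorm m n (A : 'M[R]_(m, n)) : `|A| <= vnorm A.
Proof.
apply: mx_norm_le => [|i j]; first exact: sqrtr_ge0.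
rewrite -sqrtr_sqr; apply: ler_wsqrtr.
rewrite (bigD1 i)//= (bigD1 j)//= -addrA lerDl addr_ge0//.
  by apply: sumr_ge0 => *; exact: sqr_ge0.
by apply: sumr_ge0 => *; apply: sumr_ge0 => *; exact: sqr_ge0.
Qed.

Lemma vnorm_mx_norm m n (A : 'M[R]_(m, n)) : vnorm A <= (m * n)%:R * `|A|.
Proof.
rewrite -[leRHS]ger0_norm ?mulr_ge0// -sqrtr_sqr; apply: ler_wsqrtr.
rewrite (@le_trans _ _ (\sum_(i < m) \sum_(j < n) `|A| ^+ 2))//.
  apply: ler_sum => i _; apply: ler_sum => j _.
  by rewrite -real_normK ?num_real// lerXn2r// ?nnegrE// mx_norm_entry.
rewrite !sumr_const !card_ord -mulrnA exprMn -[leLHS]mulr_natl ler_wpM2r ?sqr_ge0//.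
by rewrite -natrX ler_nat mulnC -mulnn; case: (m * n)%N => // k; rewrite leq_pmull.
Qed.

Lemma vnorm_ge0 m n (A : 'M[R]_(m, n)) : 0 <= vnorm A.
Proof. exact: sqrtr_ge0. Qed.

Lemma cvg_mx_entry (T : Type) (F : set_system T) (FF : Filter F) m n
    (f : T -> 'M[R]_(m, n)) (A : 'M[R]_(m, n)) :
  (forall i j, (fun x => f x i j) @ F --> A i j) -> f @ F --> A.
Proof.
move=> fA; apply/cvgrPdist_lt => e e0.
have : \forall x \near F, forall ij : 'I_m * 'I_n, `|A ij.1 ij.2 - f x ij.1 ij.2| < e.
  apply: filter_forall => -[i j] /=.
  by move/cvgrPdist_lt : (fA i j) => /(_ _ e0).
apply: filterS => x xA; apply: mx_norm_lt => // i j.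
by have := xA (i, j); rewrite !mxE.
Qed.

Lemma mx_cauchy_cvg m n (u : nat -> 'M[R]_(m, n)) :
  (forall e, 0 < e -> exists N, forall i j, (N <= i)%N -> (N <= j)%N -> `|u i - u j| <= e) ->
  exists A : 'M[R]_(m, n), u @ \oo --> A.
Proof.
move=> uC; have : cauchy (u @ \oo).
  apply/cauchy_exP => e e0; have e20 : 0 < e / 2 by rewrite divr_gt0.
  have [N HN] := uC _ e20; exists (u N); exists N => // i Ni /=.
  by rewrite -ball_normE/= (le_lt_trans (HN _ _ _ _))//; lra.
by move=> /cauchy_cvg/cvg_ex.
Qed.

Lemma rat_approx (x e : R) : 0 < e -> exists q : rat, `|x - ratr q| < e.
Proof.
move=> e0; have : x - e < x + e by rewrite ltrD2l gtrN.
move=> /rat_in_itvoo[q]; rewrite in_itv/= => /andP[q1 q2]; exists q.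
by rewrite ltr_norml; apply/andP; split; lra.
Qed.

Lemma mx_rat_approx m n (A : 'M[R]_(m, n)) e : 0 < e ->
  exists Q : 'M[rat]_(m, n), `|A - map_mx ratr Q| < e.
Proof.
move=> e0; pose q i j := xget 0 [set q : rat | `|A i j - ratr q| < e].
exists (\matrix_(i, j) q i j); apply: mx_norm_lt => // i j; rewrite !mxE.
have [r hr] := rat_approx (A i j) e0.
exact: (@xgetPex _ 0 [set q : rat | `|A i j - ratr q| < e]) (ex_intro _ r hr).
Qed.

End matrix_norm.

Section borel.
Context {R : realType}.

Lemma inv_nat_lt (e : R) : 0 < e -> exists n : nat, n.+1%:R^-1 < e.
Proof.
move=> e0; exists (Num.bound e^-1).
rewrite -[ltRHS]invrK ltf_pV2 ?posrE ?invr_gt0//.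
have := archi_boundP (ltW (_ : 0 < e^-1)); rewrite invr_gt0 => /(_ e0).
by move=> /lt_trans; apply; rewrite ltr_nat.
Qed.

Lemma countable_bigcap_measurable d (T : measurableType d) (I : countType)
    (F : I -> set T) :
  (forall i, measurable (F i)) -> measurable (\bigcap_i F i).
Proof.
move=> mF; rewrite -[X in measurable X]setCK setC_bigcap; apply: measurableC.
by apply: countable_bigcupT_measurable => // i; exact: measurableC.
Qed.

Lemma borel_entry_measurable d (T : measurableType d) m n (f : T -> 'M[R]_(m, n)) i j :
  borel_mfun f -> measurable_fun setT (fun x => f x i j).
Proof.
move=> mf; apply: (measurability _ (RGenOInfty.measurableE R)).
move=> /= _ [_ [a ->] <-]; rewrite setTI.
have oO : open [set A : 'M[R]_(m, n) | a < A i j].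
  exact: (open_comp (fun x _ => @coord_continuous _ _ _ i j x) (@open_gt R a)).
rewrite (_ : _ @^-1` _ = f @^-1` [set A : 'M[R]_(m, n) | a < A i j]); first exact: mf.
by apply/seteqP; split => x /=; rewrite in_itv/= andbT.
Qed.

(** An open set of matrices is a countable union of balls with rational centres and radii
    [1 / (k + 1)], and a ball of the sup norm is a finite intersection of conditions on entries. *)
Lemma entry_borel_mfun d (T : measurableType d) m n (f : T -> 'M[R]_(m, n)) :
  (forall i j, measurable_fun setT (fun x => f x i j)) -> borel_mfun f.
Proof.
move=> mf U oU.
pose B (k : 'M[rat]_(m, n) * nat) : set T :=
  [set x | ball (map_mx ratr k.1 : 'M[R]_(m, n)) k.2.+1%:R^-1 `<=` U /\
    `|f x - map_mx ratr k.1| < k.2.+1%:R^-1].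
have -> : f @^-1` U = \bigcup_k B k.
  apply/seteqP; split => [x /= Ux|x [[Q k] _ [/= sub fx]]]; last first.
    by apply: sub; rewrite -ball_normE/= distrC.
  have /nbhs_ballP[e /= e0 eU] : nbhs (f x) U by exact: open_nbhs_nbhs.
  have e20 : 0 < e / 2 by rewrite divr_gt0.
  have [k ke] := inv_nat_lt e20.
  have k0 : 0 < k.+1%:R^-1 :> R by rewrite invr_gt0.
  have [Q Qk] := mx_rat_approx (f x) k0.
  exists (Q, k) => //; split => //= A.
  rewrite -ball_normE/= => QA; apply: eU; rewrite -ball_normE/=.
  rewrite -[f x](subrK (map_mx ratr Q)) -addrA (le_lt_trans (ler_normD _ _))//.
  by rewrite (splitr e) ltrD// (lt_trans _ ke).
apply: countable_bigcupT_measurable => // -[Q k].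
have [sub|nsub] := pselect (ball (map_mx ratr Q : 'M[R]_(m, n)) k.+1%:R^-1 `<=` U);
  last first.
  by rewrite (_ : B _ = set0)// -subset0 => x [].
have -> : B (Q, k) =
    \bigcap_(ij : 'I_m * 'I_n) [set x | `|f x ij.1 ij.2 - ratr (Q ij.1 ij.2)| < k.+1%:R^-1].
  apply/seteqP; split => [x [_ /= fx] [i j] _ /=|x /= fx].
    by apply: le_lt_trans fx; rewrite (le_trans _ (mx_norm_entry _ i j))// !mxE.
  split => //=; apply: mx_norm_lt; rewrite ?invr_gt0// => i j.
  by have := fx (i, j) Logic.I; rewrite !mxE.
apply: countable_bigcap_measurable => -[i j] /=.
have : measurable_fun setT (fun x => `|f x i j - ratr (Q i j)|).
  by apply: measurableT_comp => //; apply: measurable_funB => //; exact: mf.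
move=> /(_ measurableT _ (measurable_itv `]-oo, (k.+1%:R^-1)[)).
by rewrite setTI; congr measurable; apply/seteqP; split => x /=; rewrite in_itv.
Qed.

Lemma borel_comp d (T : measurableType d) (V W : topologicalType) (f : T -> V) (g : V -> W) :
  borel_mfun f -> continuous g -> borel_mfun (g \o f).
Proof.
by move=> mf /continuousP cg U oU; rewrite comp_preimage; apply: mf; exact: cg.
Qed.

Lemma borel_measurable d (T : measurableType d) (f : T -> R) :
  borel_mfun f -> measurable_fun setT f.
Proof.
move=> mf; apply: (measurability _ (RGenOInfty.measurableE R)).
move=> /= _ [_ [a ->] <-]; rewrite setTI; apply: mf; exact: interval_open.
Qed.

Lemma borel_closed d (T : measurableType d) (V : topologicalType) (f : T -> V) (A : set V) :
  borel_mfun f -> closed A -> measurable (f @^-1` A).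
Proof.
move=> mf cA; rewrite -[A]setCK preimage_setC; apply: measurableC.
by apply: (mf (~` A)); exact: closed_openC.
Qed.

End borel.

(** * Rademacher's theorem *)

Section approximate_derivative.
Context {R : realType}.

(* [iota] is [id] for the full differential and the inclusion of a coordinate hyperplane
   for partial ones. *)
Definition affine_at k m n (f : 'rV[R]_m -> 'rV[R]_n) (iota : 'rV[R]_k -> 'rV[R]_m)
    (e : R) (a : 'M[R]_(k, n)) (dl : R) (y : 'rV[R]_m) :=
  forall h, `|h| < dl -> `|f (y + iota h) - f y - h *m a| <= e * `|h|.

(** The matrix may depend on [e]. Every quantifier except the one on [h] can then be made countable,
    and the one on [h] is a closed condition; so the set of such points is measurable before any
    derivative has been chosen. *)
Definition approx_diff k m n (f : 'rV[R]_m -> 'rV[R]_n) (iota : 'rV[R]_k -> 'rV[R]_m) y :=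
  forall e, 0 < e -> exists (a : 'M[R]_(k, n)) (dl : R), 0 < dl /\ affine_at f iota e a dl y.

Lemma closed_affine_at k m n (f : 'rV[R]_m -> 'rV[R]_n) (iota : 'rV[R]_k -> 'rV[R]_m) e a dl :
  continuous f -> closed [set y | affine_at f iota e a dl y].
Proof.
move=> cf; rewrite (_ : [set y | _] = \bigcap_(h in [set h | `|h| < dl])
    ((fun y => `|f (y + iota h) - f y - h *m a|) @^-1` [set x | x <= e * `|h|])).
  apply: closed_bigI => h _; apply: (closed_comp _ (@closed_le _ _)) => y _.
  have c1 : (fun z => f (z + iota h)) @ y --> f (y + iota h).
    apply: (cvg_comp (fun z => z + iota h) f _ (cf (y + iota h))).
    exact: (cvgD (@cvg_id _ (nbhs y)) (cvg_cst _)).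
  exact: (cvg_norm (cvgB (cvgB c1 (cf y)) (cvg_cst _))).
by apply/seteqP; split => y Hy h; exact: Hy.
Qed.

Lemma affine_atW k m n (f : 'rV[R]_m -> 'rV[R]_n) (iota : 'rV[R]_k -> 'rV[R]_m)
    e a dl e' a' dl' y :
  affine_at f iota e a dl y -> dl' <= dl -> e + k%:R * `|a - a'| <= e' ->
  affine_at f iota e' a' dl' y.
Proof.
move=> Ha dd ee h hd.
have -> : f (y + iota h) - f y - h *m a' = (f (y + iota h) - f y - h *m a) + h *m (a - a').
  by rewrite mulmxBr addrA subrK.
rewrite (le_trans (ler_normD _ _))// (@le_trans _ _ (e * `|h| + k%:R * `|h| * `|a - a'|))//.
  by apply: lerD; [apply: Ha; exact: lt_le_trans hd dd|exact: mx_norm_mulmx].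
by rewrite mulrAC -mulrDl ler_wpM2r.
Qed.

Lemma approx_diff_rat k m n (f : 'rV[R]_m -> 'rV[R]_n) (iota : 'rV[R]_k -> 'rV[R]_m) y :
  approx_diff f iota y <->
  forall N : nat, exists (a : 'M[rat]_(k, n)) (l : nat),
    affine_at f iota N.+1%:R^-1 (map_mx ratr a) l.+1%:R^-1 y.
Proof.
split=> [fy N|fy e e0]; last first.
  have [N Ne] := inv_nat_lt e0; have [a [l al]] := fy N.
  exists (map_mx ratr a), l.+1%:R^-1; split; first by rewrite invr_gt0.
  by apply: affine_atW al _ _ => //; rewrite subrr normr0 mulr0 addr0 ltW.
have N0 : 0 < (2 * N.+1%:R)^-1 :> R by rewrite invr_gt0 mulr_gt0.
have [a [dl [dl0 al]]] := fy _ N0.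
have [l ldl] := inv_nat_lt dl0.
(* Half of the allowed error is spent on the remainder, the other half on replacing [a] by a
   rational matrix, which costs [k] times their distance; [k.+1] covers [k = 0]. *)
have k0 : 0 < (2 * N.+1%:R * k.+1%:R)^-1 :> R by rewrite invr_gt0 !mulr_gt0.
have [Q aQ] := mx_rat_approx a k0.
exists Q, l; apply: affine_atW al (ltW ldl) _.
rewrite (@le_trans _ _ ((2 * N.+1%:R)^-1 + k.+1%:R * (2 * N.+1%:R * k.+1%:R)^-1))//.
  by rewrite lerD2l ler_pM// ?ler_nat// ltW.
have : N.+1%:R != 0 :> R by rewrite pnatr_eq0.
have : k.+1%:R != 0 :> R by rewrite pnatr_eq0.
move: (N.+1%:R) (k.+1%:R) => x z z0 x0.
by rewrite le_eqVlt; apply/orP; left; apply/eqP; field; rewrite x0 z0.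
Qed.

Lemma approx_diff_measurable d (T : measurableType d) k m n (f : 'rV[R]_m -> 'rV[R]_n)
    (iota : 'rV[R]_k -> 'rV[R]_m) (g : T -> 'rV[R]_m) :
  continuous f -> borel_mfun g -> measurable [set x | approx_diff f iota (g x)].
Proof.
move=> cf mg; rewrite (_ : [set x | _] = \bigcap_(N : nat) \bigcup_(al : 'M[rat]_(k, n) * nat)
    g @^-1` [set y | affine_at f iota N.+1%:R^-1 (map_mx ratr al.1) al.2.+1%:R^-1 y]).
  apply: countable_bigcap_measurable => N; apply: countable_bigcupT_measurable => // al.
  by apply: borel_closed mg _; exact: closed_affine_at.
apply/seteqP; split => x /=.
  by move=> /approx_diff_rat fx N _; have [a [l al]] := fx N; exists (a, l).
by move=> fx; apply/approx_diff_rat => N; have [[a l] _ al] := fx N Logic.I; exists a, l.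
Qed.

Definition frechet m n (f : 'rV[R]_m -> 'rV[R]_n) (y : 'rV[R]_m) (A : 'M[R]_(m, n)) :=
  forall e, 0 < e -> exists2 dl, 0 < dl & affine_at f id e A dl y.

(** Applying both approximations to a small multiple of a basis vector compares the matrices row by
    row. *)
Lemma affine_at_dist m n (f : 'rV[R]_m -> 'rV[R]_n) e a dl e' a' dl' y :
  0 < dl -> 0 < dl' -> 0 <= e -> 0 <= e' ->
  affine_at f id e a dl y -> affine_at f id e' a' dl' y -> `|a - a'| <= e + e'.
Proof.
move=> dl0 dl0' e0 e0' Ha Ha'; apply: mx_norm_le => [|i j]; first exact: addr_ge0.
pose t := Num.min dl dl' / 2.
have m0 : 0 < Num.min dl dl' by rewrite lt_min dl0.
have t0 : 0 < t by rewrite divr_gt0.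
have tm : t < Num.min dl dl' by rewrite /t; lra.
pose h : 'rV[R]_m := t *: delta_mx 0 i.
have hn : `|h| <= t.
  apply: mx_norm_le => [|i' j']; first exact: ltW.
  rewrite !mxE normrM gtr0_norm// ler_piMr ?(ltW t0)//.
  by case: (_ && _); rewrite ?normr1 ?normr0.
move: tm; rewrite lt_min => /andP[td td'].
have H1 := Ha h (le_lt_trans hn td).
have H2 := Ha' h (le_lt_trans hn td').
have : `|h *m (a - a')| <= (e + e') * t.
  have -> : h *m (a - a') = (f (y + id h) - f y - h *m a') - (f (y + id h) - f y - h *m a).
    by rewrite mulmxBr opprB [RHS]addrC addrA subrK.
  rewrite (le_trans (ler_normB _ _))// (le_trans (lerD H2 H1))// -mulrDl addrC.
  by rewrite ler_wpM2l// addr_ge0.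
move=> /(le_trans (mx_norm_entry _ 0 j)).
rewrite /h -scalemxAl mxE -rowE mxE normrM gtr0_norm//.
by rewrite mulrC ler_pM2r.
Qed.

(** By [affine_at_dist] the matrices for the errors [1 / (N + 1)] form a Cauchy sequence, and its
    limit is within [2 / (N + 1)] of the matrix of index [N]. *)
Lemma approx_diff_frechet m n (f : 'rV[R]_m -> 'rV[R]_n) y :
  approx_diff f id y -> exists A, frechet f y A.
Proof.
move=> fy.
have N0 N : 0 < N.+1%:R^-1 :> R by rewrite invr_gt0.
pose P N (ad : 'M[R]_(m, n) * R) := 0 < ad.2 /\ affine_at f id N.+1%:R^-1 ad.1 ad.2 y.
have Pex N : exists ad, P N ad by have [a [dl H]] := fy _ (N0 N); exists (a, dl).
have [ad adP] := choice Pex.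
have dist N M : `|(ad N).1 - (ad M).1| <= N.+1%:R^-1 + M.+1%:R^-1.
  have [a b] := adP N; have [a' b'] := adP M.
  by apply: affine_at_dist b b' => //; exact: ltW.
have [A uA] : exists A : 'M[R]_(m, n), (fun N => (ad N).1) @ \oo --> A.
  apply: mx_cauchy_cvg => e e0; have e20 : 0 < e / 2 by rewrite divr_gt0.
  have [K Ke] := inv_nat_lt e20; exists K => i j Ki Kj.
  have le_ (l : nat) : (K <= l)%N -> l.+1%:R^-1 <= e / 2.
    by move=> Kl; rewrite (le_trans _ (ltW Ke))// lef_pV2 ?posrE// ler_nat.
  by rewrite (le_trans (dist _ _))// (splitr e) lerD// le_.
have Ad N : `|(ad N).1 - A| <= 2 * N.+1%:R^-1.
  rewrite leNgt; apply/negP => lt.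
  have e0 : 0 < (`|(ad N).1 - A| - 2 * N.+1%:R^-1) by rewrite subr_gt0.
  move/cvgrPdist_lt : uA => /(_ _ e0) [M _ /(_ (maxn M N) (leq_maxl _ _))] /=.
  apply/negP; rewrite -leNgt.
  have le2 : (maxn M N).+1%:R^-1 <= N.+1%:R^-1 :> R.
    by rewrite lef_pV2 ?posrE// ler_nat ltnS leq_maxr.
  have := dist N (maxn M N).
  have : `|(ad N).1 - A| <= `|(ad N).1 - (ad (maxn M N)).1| + `|A - (ad (maxn M N)).1|.
    by rewrite [X in _ <= _ + X]distrC (le_trans _ (ler_normD _ _))// addrA subrK.
  move: le2 lt; move: (N.+1%:R^-1) ((maxn M N).+1%:R^-1) => x z; lra.
exists A => e e0.
have e20 : 0 < e / (1 + 2 * m%:R).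
  by rewrite divr_gt0// ltr_pwDl// mulr_ge0.
have [N Ne] := inv_nat_lt e20; have [dl0 H] := adP N.
exists (ad N).2 => //; apply: affine_atW H (lexx _) _.
rewrite (@le_trans _ _ (N.+1%:R^-1 * (1 + 2 * m%:R)))//; last first.
  by rewrite -ler_pdivlMr ?ltW// ltr_pwDl// mulr_ge0.
have := ler_wpM2l (ler0n R m) (Ad N).
by move: (N.+1%:R^-1) `|_| => v x; lra.
Qed.

Lemma frechet_approx_diff m n (f : 'rV[R]_m -> 'rV[R]_n) y A :
  frechet f y A -> approx_diff f id y.
Proof. by move=> fA e e0; have [dl d0 H] := fA _ e0; exists A, dl. Qed.

Lemma frechet_differentiable m n (f : 'rV[R]_m -> 'rV[R]_n) y A :
  frechet f y A -> differentiable f y /\ 'J f y = A.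
Proof.
move=> fA; pose g : {linear 'rV[R]_m -> 'rV[R]_n} := mulmxr A.
have cg : continuous g.
  apply: (@lipschitz_continuous _ _ _ _ (m%:R * `|A|)) => x z.
  by rewrite -linearB /= mulrAC; exact: mx_norm_mulmx.
have gE : (f : 'rV[R]_m -> 'rV[R]_n) \o shift y = cst (f y) + (g : 'rV[R]_m -> 'rV[R]_n) +o_ (0 : 'rV[R]_m) id.
  apply/eqaddoP => e e0; have [d d0 H] := fA _ e0.
  apply/nbhs_ballP; exists d => //= h; rewrite -ball_normE/= sub0r normrN => hd.
  rewrite !fctE/= (addrC h) opprD addrA; exact: H.
have dE := diff_unique cg gE.
split.
  by apply/diff_locallyP; rewrite dE.
rewrite /jacobian; apply/row_matrixP => i; apply/rowP => j.
by rewrite !rowE mul_rV_lin1 /= dE.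
Qed.

Lemma differentiable_frechet m n (f : 'rV[R]_m -> 'rV[R]_n) y :
  differentiable f y -> frechet f y ('J f y).
Proof.
move=> /diff_locallyP[_ /eqaddoP H] e e0.
have /nbhs_ballP[dl /= d0 Hd] := H e e0.
exists dl => // h hd; have := Hd h; rewrite -ball_normE/= sub0r normrN => /(_ hd).
by rewrite !fctE/= (addrC h) opprD addrA /jacobian mul_rV_lin1.
Qed.

End approximate_derivative.

(** * Adding one coordinate in Rademacher's theorem *)

Section rademacher_step.
Context {R : realType}.

Lemma derivable_increment (g : R -> R) t e : derivable g t 1 -> 0 < e ->
  exists dl, 0 < dl /\ forall s, `|s| < dl -> `|g (t + s) - g t - s * 'D_1 g t| <= e * `|s|.
Proof.
move=> dg e0; have /cvgrPdist_lt/(_ _ e0) := dg.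
rewrite /dnbhs => /nbhs_ballP[dl /= dl0 H]; exists dl; split => // s sd.
have [->|s0] := eqVneq s 0.
  by rewrite addr0 subrr mul0r subr0 !normr0 mulr0.
have := H s; rewrite -ball_normE/= sub0r normrN => /(_ sd s0) /ltW.
rewrite -[lim _]/('D_1 g t) [_%:A]mulr1 -[_ *: _]/(s^-1 * _) (addrC s) => Hs.
have -> : g (t + s) - g t - s * 'D_1 g t = - (s * ('D_1 g t - s^-1 * (g (t + s) - g t))).
  by rewrite mulrBr mulrA mulfV// mul1r opprB.
by rewrite normrN normrM mulrC ler_wpM2r.
Qed.

Definition consv d (t : R) (z : 'rV[R]_d) : 'rV[R]_d.+1 :=
  \row_i (if unlift ord0 i is Some j then z 0 j else t).

Lemma consvE0 d t (z : 'rV[R]_d) : consv t z 0 0 = t.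
Proof. by rewrite mxE unlift_none. Qed.

Lemma consvES d t (z : 'rV[R]_d) i : consv t z 0 (lift ord0 i) = z 0 i.
Proof. by rewrite mxE liftK. Qed.

Lemma consv_eta d (h : 'rV[R]_d.+1) : h = consv (h 0 0) (\row_i h 0 (lift ord0 i)).
Proof.
apply/rowP => i; case: (unliftP ord0 i) => [j ->|->].
  by rewrite consvES mxE.
by rewrite consvE0.
Qed.

Lemma consvD d (t s : R) (z w : 'rV[R]_d) : consv t z + consv s w = consv (t + s) (z + w).
Proof.
apply/rowP => i; case: (unliftP ord0 i) => [j ->|->].
  by rewrite mxE !consvES mxE.
by rewrite mxE !consvE0.
Qed.

Lemma consvB d (t s : R) (z w : 'rV[R]_d) : consv t z - consv s w = consv (t - s) (z - w).
Proof.
apply/rowP => i; case: (unliftP ord0 i) => [j ->|->].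
  by rewrite mxE [X in _ + X]mxE !consvES !mxE.
by rewrite mxE [X in _ + X]mxE !consvE0.
Qed.

Lemma normr_consv d (t : R) (z : 'rV[R]_d) : `|consv t z| = Num.max `|t| `|z|.
Proof.
apply/eqP; rewrite eq_le; apply/andP; split.
  apply: mx_norm_le => [|i j]; first by rewrite le_max normr_ge0.
  rewrite ord1; case: (unliftP ord0 j) => [l ->|->].
    by rewrite consvES le_max mx_norm_entry orbT.
  by rewrite consvE0 le_max lexx.
rewrite ge_max; apply/andP; split.
  by rewrite -{1}(consvE0 t z) mx_norm_entry.
apply: mx_norm_le => // i j; rewrite ord1 -(consvES t).
exact: mx_norm_entry.
Qed.

Definition consmx d n (D : 'rV[R]_n) (a : 'M[R]_(d, n)) : 'M[R]_(d.+1, n) :=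
  \matrix_(i, j) (if unlift ord0 i is Some l then a l j else D 0 j).

Lemma consv_mul d n (t : R) (z : 'rV[R]_d) (D : 'rV[R]_n) (a : 'M[R]_(d, n)) :
  consv t z *m consmx D a = t *: D + z *m a.
Proof.
apply/rowP => j; rewrite !mxE big_ord_recl !mxE unlift_none; congr (_ + _).
by apply: eq_bigr => i _; rewrite !mxE liftK.
Qed.

Definition tl_inj d (z : 'rV[R]_d) : 'rV[R]_d.+1 := consv 0 z.

Definition nonporous (E : set R) (t : R) := forall eta, 0 < eta -> exists2 delta, 0 < delta &
  forall s, `|s| < delta -> exists2 t', E t' & `|t' - (t + s)| <= eta * `|s|.

(* Near a point where the slice [f (t, .)] is approximately affine at all nearby
   parameters of a nonporous set, moving [t + s] to this set costs only [o(s)]. *)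
Lemma approx_diff_cons d n (f : 'rV[R]_d.+1 -> 'rV[R]_n) L t (z : 'rV[R]_d) :
  (forall x y, `|f x - f y| <= L * `|x - y|) ->
  approx_diff f (@tl_inj d) (consv t z) ->
  (forall j, derivable (fun s => f (consv s z) 0 j) t 1) ->
  (forall N (a : 'M[rat]_(d, n)) l,
    let E := [set s | affine_at f (@tl_inj d) N.+1%:R^-1 (map_mx ratr a) l.+1%:R^-1 (consv s z)] in
    E t -> nonporous E t) ->
  approx_diff f id (consv t z).
Proof.
move=> fL /approx_diff_rat slice dt por e e0.
wlog L0 : L fL / 0 < L.
  move=> W; apply: (W (`|L| + 1)); last by rewrite ltr_wpDl.
  by move=> x y; rewrite (le_trans (fL x y))// ler_wpM2r// (le_trans (ler_norm _))// lerDl.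
have e40 : 0 < e / 4 by rewrite divr_gt0.
have [N Ne] := inv_nat_lt e40; have [a [l Ha]] := slice N.
have eta0 : 0 < e / (4 * L) by rewrite divr_gt0// mulr_gt0.
have [d1 d10 H1] := por N a l Ha _ eta0.
pose D : 'rV[R]_n := \row_j 'D_1 (fun s => f (consv s z) 0 j) t.
have [d2 d20 H2] : exists2 d2, 0 < d2 & forall s, `|s| < d2 ->
    `|f (consv (t + s) z) - f (consv t z) - s *: D| <= e / 4 * `|s|.
  have [dl dlP] := choice (fun j => derivable_increment (dt j) e40).
  exists (\big[Num.min/1]_(j < n) dl j); first by apply/bigmin_gtP; split => // j _; case: (dlP j).
  move=> s sd; apply: mx_norm_le => [|i j]; first by rewrite mulr_ge0// ltW.
  have [_ Hj] := dlP j; rewrite ord1 !mxE; apply: Hj.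
  by rewrite (lt_le_trans sd)// bigmin_le_cond.
exists (consmx D (map_mx ratr a)), (Num.min (Num.min d1 d2) l.+1%:R^-1).
split; first by rewrite !lt_min d10 d20/= invr_gt0.
move=> h; rewrite [h]consv_eta; set s := h 0 0; set w := \row_i _.
rewrite normr_consv gt_max !lt_min -!andbA => /and4P[s1 s2 _ /and3P[w1 w2 w3]].
set m := Num.max _ _.
have sm : `|s| <= m by rewrite le_max lexx.
have wm : `|w| <= m by rewrite le_max lexx orbT.
have [t' Et' tt'] := H1 _ s1.
rewrite consvD consv_mul.
have b1 (x : 'rV[R]_d) : `|f (consv (t + s) x) - f (consv t' x)| <= e / 4 * m.
  rewrite (le_trans (fL _ _))// consvB subrr normr_consv normr0 max_l//.
  rewrite distrC (@le_trans _ _ (L * (e / (4 * L) * `|s|)))// ?ler_pM2l//.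
  rewrite (_ : L * _ = e / 4 * `|s|); first by rewrite ler_pM2l.
  by field; rewrite gt_eqF.
have b2 : `|f (consv t' (z + w)) - f (consv t' z) - w *m map_mx ratr a| <= e / 4 * m.
  have := Et' w w3; rewrite /tl_inj consvD addr0 => /le_trans; apply.
  by rewrite ler_pM// ?invr_ge0// ltW.
have b3 := le_trans (H2 s s2) (ler_wpM2l (ltW e40) sm).
(* Two moves between [t + s] and [t'], the slice increment at [t'], and the increment in the first
   coordinate: four errors of size [e / 4 * m]. *)
rewrite (_ : _ - _ - _ = (f (consv (t + s) (z + w)) - f (consv t' (z + w)))
   + (f (consv t' (z + w)) - f (consv t' z) - w *m map_mx ratr a)
   - (f (consv (t + s) z) - f (consv t' z))
   + (f (consv (t + s) z) - f (consv t z) - s *: D)); last first.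
  by apply/rowP => j; rewrite !mxE; ring.
rewrite (le_trans (ler_normD _ _))// (_ : e * m = e / 4 * m * 3 + e / 4 * m); last by lra.
apply: lerD => //; rewrite (le_trans (ler_normB _ _))//.
rewrite (_ : _ * 3 = e / 4 * m + e / 4 * m + e / 4 * m); last by lra.
by apply: lerD => //; rewrite (le_trans (ler_normD _ _))// lerD.
Qed.

End rademacher_step.

(** * Null sets in product spaces *)

Section product_null_sets.
Context {R : realType} d1 (T1 : measurableType d1) d2 (T2 : measurableType d2).
Variables (P1 : probability T1 R) (P2 : probability T2 R).

Lemma null_xsections (A : set (T1 * T2)) : measurable A ->
  (forall x, P2 (xsection A x) = 0%E) -> (P1 \x P2)%E A = 0%E.
Proof. by move=> mA A0; rewrite /product_measure1 integral0_eq//= => x _; exact: A0. Qed.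

Lemma null_ysections (A : set (T1 * T2)) : measurable A ->
  (forall y, P1 (ysection A y) = 0%E) -> (P1 \x P2)%E A = 0%E.
Proof.
move=> mA A0; rewrite (@product_measure_unique _ _ _ _ _ P1 P2 (P1 \x^ P2)%E)//.
  by apply: integral0_eq => x _; exact: A0.
by move=> B C mB mC; exact: product_measure2E.
Qed.

Lemma ae_measure0 d (T : measurableType d) (P : {measure set T -> \bar R}) (A : set T) :
  measurable A -> {ae P, forall x, ~ A x} -> P A = 0%E.
Proof.
move=> mA [B [mB B0 AB]]; apply/eqP; rewrite eq_le measure_ge0 andbT -B0.
apply: le_measure; rewrite ?inE// => x Ax; apply: AB => /=; exact.
Qed.

Lemma ae_and d (T : measurableType d) (P : {measure set T -> \bar R}) (A B : T -> Prop) :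
  {ae P, forall x, A x} -> {ae P, forall x, B x} -> {ae P, forall x, A x /\ B x}.
Proof.
move=> hA hB; have := negligibleU hA hB; apply: negligibleS => x /= nAB.
have [Ax|nA] := pselect (A x); [right|by left].
by move=> Bx; exact: nAB.
Qed.

Lemma ae_forall_countable d (T : measurableType d) (P : {measure set T -> \bar R})
    (I : countType) (A : I -> T -> Prop) :
  (forall i, {ae P, forall x, A i x}) -> {ae P, forall x, forall i, A i x}.
Proof.
move=> hA.
pose F (n : nat) := [set x | forall i, unpickle n = Some i -> A i x].
have : P.-negligible (\bigcup_n ~` F n).
  apply: negligible_bigcup => n; case E : (unpickle n) => [i|]; last first.
    have -> : ~` F n = set0 by rewrite -subset0 => x /=; apply => i; rewrite E.
    exact: negligible_set0.
  by apply: negligibleS (hA i) => x /= nF Aix; apply: nF => j; rewrite E => -[<-].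
apply: negligibleS => x /= nA; apply: contrapT => nF; apply: nA => i.
have : F (pickle i) x by apply: contrapT => nFx; apply: nF; exists (pickle i).
by move/(_ i); apply; rewrite pickleK.
Qed.

End product_null_sets.

(** * The uniform law on the unit interval *)

Section unit_interval.
Context {R : realType}.
Local Notation mu := (@lebesgue_measure R).
Definition unifP : probability (measurableTypeR R) R := uniform_prob (@ltr01 R).

(** Truncating the sample point makes the bounds on the random vector hold everywhere and not just
    almost surely; the same map later extends functions from a ball. *)
Definition clamp (a b t : R) : R := Num.min (Num.max t a) b.

Lemma clamp_itv a b t : a <= b -> a <= clamp a b t <= b.
Proof.
by move=> ab; rewrite /clamp ge_min lexx orbT andbT le_min le_max lexx orbT.
Qed.

Lemma clamp_id a b t : a <= t <= b -> clamp a b t = t.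
Proof. by move=> /andP[t0 t1]; rewrite /clamp max_l// min_l. Qed.

Lemma max_lipschitz (a s t : R) : `|Num.max s a - Num.max t a| <= `|s - t|.
Proof.
have h1 := ler_norm (s - t); have := ler_norm (t - s); rewrite (distrC t) => h2.
rewrite ler_norml; case: (leP s a) => sa; case: (leP t a) => ta; apply/andP; split; lra.
Qed.

Lemma min_lipschitz (a s t : R) : `|Num.min s a - Num.min t a| <= `|s - t|.
Proof.
have h1 := ler_norm (s - t); have := ler_norm (t - s); rewrite (distrC t) => h2.
rewrite ler_norml; case: (leP s a) => sa; case: (leP t a) => ta; apply/andP; split; lra.
Qed.

Lemma clamp_lipschitz a b s t : `|clamp a b s - clamp a b t| <= `|s - t|.
Proof. exact: le_trans (min_lipschitz _ _ _) (max_lipschitz _ _ _). Qed.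

Lemma clamp_continuous a b : continuous (clamp a b).
Proof.
apply: (@lipschitz_continuous _ _ _ _ 1) => s t.
by rewrite mul1r clamp_lipschitz.
Qed.

Local Notation clamp01 := (clamp 0 1).

Lemma unifP_itv : {ae unifP, forall t : R, 0 <= t <= 1}.
Proof.
exists (~` `[0, 1]%classic); split.
- by apply: measurableC; exact: (@measurable_itv R).
- by rewrite /unifP/= /uniform_prob integral_uniform_pdf setICl integral_set0.
- by move=> t /= nt; rewrite in_itv.
Qed.

Lemma unifP_ae (Q : R -> Prop) : {ae mu, forall t, Q t} -> {ae unifP, forall t, Q t}.
Proof.
move=> [B [mB B0 QB]]; exists B; split => //.
by have /null_content_dominatesP/(_ _ mB B0) := dominates_uniform_prob (@ltr01 R).
Qed.

Lemma Rintegral_prob_cst d (T : measurableType d) (P : probability T R) (B : R) :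
  \int[P]_x B = B.
Proof.
rewrite Rintegral_cst// -[RHS]mulr1; congr (_ * _).
exact: (congr1 fine (probability_setT P)).
Qed.

Lemma bounded_integrable d (T : measurableType d) (P : probability T R) (f : T -> R) B :
  measurable_fun setT f -> (forall x, `|f x| <= B) -> P.-integrable setT (EFin \o f).
Proof.
move=> mf fB; apply: measurable_bounded_integrable => //.
  exact: le_lt_trans (probability_le1 P measurableT) (ltry 1).
exists B; split; rewrite ?num_real// => M BM x _ /=.
by rewrite (le_trans (fB x))// ltW.
Qed.

Lemma norm_Rintegral_le d (T : measurableType d) (P : probability T R) (f : T -> R) B :
  measurable_fun setT f -> (forall x, `|f x| <= B) -> `|\int[P]_x f x| <= B.
Proof.
move=> mf fB; have fi := bounded_integrable P mf fB.
rewrite (le_trans (le_normr_Rintegral _ fi))//.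
rewrite -[leRHS](Rintegral_prob_cst P).
apply: le_Rintegral => //.
  by apply: (@bounded_integrable _ _ _ _ B) => [|x]; [exact: measurableT_comp|rewrite normr_id].
by apply: (@bounded_integrable _ _ _ _ `|B|).
Qed.

Lemma Rintegral_unifP (F : R -> R) B : continuous F -> (forall x, `|F x| <= B) ->
  \int[unifP]_t F (clamp01 t) = \int[mu]_(t in `[0, 1]) F t.
Proof.
move=> cF FB.
have mF : measurable_fun setT F by exact: continuous_measurable_fun.
have mFc : measurable_fun setT (fun t => F (clamp01 t)).
  apply: continuous_measurable_fun => t.
  exact: (cvg_comp _ F (clamp_continuous (x := t)) (cF _)).
have F0 x : 0 <= F x + B by rewrite -lerBlDr sub0r; have := FB x; rewrite ler_norml => /andP[].
have FiU : unifP.-integrable setT (EFin \o (fun t => F (clamp01 t))).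
  exact: (@bounded_integrable _ (measurableTypeR R) unifP _ B mFc (fun x => FB _)).
have Bi : unifP.-integrable setT (EFin \o (fun=> B)).
  by apply: (@bounded_integrable _ _ _ _ `|B|).
have m01 : (mu `[0%R, 1%R] < +oo)%E by rewrite lebesgue_measure_itv/= lte01 ltry.
have Fi : mu.-integrable `[0, 1] (EFin \o F).
  apply: measurable_bounded_integrable => //; first exact: measurable_funTS.
  by exists B; split; rewrite ?num_real// => M BM x _ /=; rewrite (le_trans (FB x))// ltW.
have Bi' : mu.-integrable `[0, 1] (EFin \o (fun=> B)).
  apply: measurable_bounded_integrable => //.
  by exists `|B|; split; rewrite ?num_real// => M BM x _ /=; rewrite ltW.
apply: (addIr B).
have -> : \int[unifP]_t F (clamp01 t) + B = \int[unifP]_t (F (clamp01 t) + B).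
  by rewrite RintegralD// Rintegral_prob_cst.
have -> : \int[mu]_(t in `[0, 1]) F t + B = \int[mu]_(t in `[0, 1]) (F t + B).
  rewrite RintegralD//; congr (_ + _); rewrite Rintegral_cst// -[LHS]mulr1; congr (_ * _).
  have m1 : mu `[0%R, 1%R] = 1%:E by rewrite lebesgue_measure_itv/= lte01/= oppr0 adde0.
  exact: esym (congr1 fine m1).
rewrite /Rintegral /unifP integral_uniform//.
  rewrite subr0 invr1 mul1e; congr fine; apply: eq_integral => t.
  by rewrite inE/= in_itv/= => t01; rewrite clamp_id.
- by apply/measurable_EFinP/measurable_funD.
- by move=> x; rewrite lee_fin.
Qed.

(** For a primitive [Phi] of [F] the difference equals [(Phi (1 + a) - Phi 1) - (Phi a - Phi 0)],
    and [Phi] is [B]-Lipschitz. *)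
Lemma Rintegral_unit_translation (F : R -> R) B a : continuous F -> (forall x, `|F x| <= B) ->
  `|\int[unifP]_t F (clamp01 t + a) - \int[unifP]_t F (clamp01 t)| <= 2 * B * `|a|.
Proof.
(* The primitive starts at [- N], strictly to the left of [0], [1], [a] and [1 + a]. *)
move=> cF FB; pose N := `|a| + 1; have N0 : 0 < N by rewrite ltr_wpDl.
pose F' t := F (t + a).
have cF' : continuous F'.
  by move=> t; apply: (cvg_comp (fun t => t + a) F _ (cF _)); exact: (cvgD cvg_id (cvg_cst _)).
have -> : \int[unifP]_t F (clamp01 t + a) = \int[mu]_(t in `[0, 1]) F' t.
  by apply: (@Rintegral_unifP F' B) => // x; exact: FB.
rewrite (Rintegral_unifP cF FB).
pose Phi x := \int[mu]_(t in `[- N, x]) F t.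
have cFw A : {within A, continuous F} by apply: continuous_subspaceT.
have Fi u : mu.-integrable `[- N, u] (EFin \o F).
  by apply: continuous_compact_integrable => //; exact: segment_compact.
have dPhi x : - N < x -> is_derive x 1 Phi (F x).
  move=> Nx; have xx1 : x < x + 1 by rewrite ltrDl.
  have [d1 d2] := continuous_FTC1_closed xx1 (Fi _) Nx (cF x).
  by apply: (DeriveDef d1); rewrite -derive1E; exact: d2.
have Phi_lip x y : - N < x -> x <= y -> `|Phi y - Phi x| <= B * (y - x).
  move=> Nx xy.
  have H1 z : z \in `]x, y[ -> is_derive z 1 Phi (F z).
    by rewrite in_itv/= => /andP[xz _]; apply: dPhi; exact: lt_trans xz.
  have H2 : {within `[x, y], continuous Phi}.
    apply: continuous_in_subspaceT => z; rewrite inE/= in_itv/= => /andP[xz _].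
    have [dz _] := dPhi z (lt_le_trans Nx xz).
    by apply/differentiable_continuous/derivable1_diffP.
  have [w _ ->] := MVT_segment xy H1 H2.
  by rewrite normrM (ger0_norm (_ : 0 <= y - x)) ?subr_ge0// ler_wpM2r ?subr_ge0.
have cPhi x : - N < x -> {for x, continuous Phi}.
  by move=> /dPhi[dx _]; apply/differentiable_continuous/derivable1_diffP.
have int01 c : - N < c -> \int[mu]_(t in `[0, 1]) F (t + c) = Phi (1 + c) - Phi c.
  move=> Nc.
  have cPc x : 0 <= x -> {for x, continuous (fun t => Phi (t + c))}.
    move=> x0; apply: (cvg_comp (fun t => t + c) Phi _ (cPhi _ _)).
      exact: (cvgD cvg_id (cvg_cst _)).
    by rewrite (lt_le_trans Nc)// lerDr.
  have dPc x : 0 <= x -> derivable (fun t : R => Phi (t + c)) x 1 /\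
      derive1 (fun t : R => Phi (t + c)) x = F (x + c).
    move=> x0; have Nxc : - N < x + c by rewrite (lt_le_trans Nc)// lerDr.
    have [d1 d2] := dPhi _ Nxc.
    have E : (fun h : R => h^-1 *: (((fun t : R => Phi (t + c)) \o shift x) (h *: 1) - Phi (x + c))) =
        (fun h : R => h^-1 *: ((Phi \o shift (x + c)) (h *: 1) - Phi (x + c))).
      by apply/funext => h /=; rewrite addrA.
    by rewrite derive1E /derive /derivable E.
  rewrite /Rintegral (@continuous_FTC2 _ _ (fun t => Phi (t + c)) 0 1)//=.
  - by rewrite add0r.
  - apply: continuous_subspaceT => t.
    by apply: (cvg_comp (fun t => t + c) F _ (cF _)); exact: (cvgD cvg_id (cvg_cst _)).
  - split.
    + by move=> x; rewrite in_itv/= => /andP[x0 _]; have [] := dPc x (ltW x0).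
    + by apply: cvg_at_right_filter; exact: cPc.
    + by apply: cvg_at_left_filter; exact: cPc.
  - by move=> x; rewrite in_itv/= => /andP[x0 _]; have [] := dPc x (ltW x0).
have Na : - N < a by rewrite /N ltrNl (le_lt_trans (ler_norm _))// normrN ltrDl.
have N0' : - N < 0 by rewrite oppr_lt0.
have -> : \int[mu]_(t in `[0, 1]) F t = Phi 1 - Phi 0.
  rewrite -[X in Phi X - _]addr0 -(int01 0 N0').
  by apply: eq_Rintegral => t _; rewrite addr0.
rewrite (int01 a Na).
have PhiB x y : - N < x -> - N < y -> `|Phi y - Phi x| <= B * `|y - x|.
  move=> Nx Ny; have [xy|/ltW yx] := leP x y.
    by rewrite (ger0_norm (_ : 0 <= y - x)) ?subr_ge0// Phi_lip.
  by rewrite distrC (distrC y) (ger0_norm (_ : 0 <= x - y)) ?subr_ge0// Phi_lip.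
have -> : Phi (1 + a) - Phi a - (Phi 1 - Phi 0) = (Phi (1 + a) - Phi 1) - (Phi a - Phi 0).
  by ring.
rewrite (le_trans (ler_normB _ _))// (_ : 2 * B * `|a| = B * `|a| + B * `|a|); last by ring.
apply: lerD.
  have N1 : - N < 1 by rewrite (lt_trans N0').
  have N1a : - N < 1 + a by rewrite (lt_le_trans Na)// lerDr.
  by have := PhiB _ _ N1 N1a; rewrite addrAC subrr add0r.
by rewrite (le_trans (PhiB _ _ _ _))// subr0.
Qed.

End unit_interval.

(** * Random points of the cube *)

Section averaging.
Context {R : realType}.
Local Notation mu := (@lebesgue_measure R).

Section product_bounds.
Context d1 (T1 : measurableType d1) d2 (T2 : measurableType d2).
Variables (P1 : probability T1 R) (P2 : probability T2 R).
Variables (G : T1 * T2 -> R) (B c : R).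
Hypothesis mG : measurable_fun setT G.
Hypothesis GB : forall z, `|G z| <= B.

Lemma Rintegral_prod_le_x : (forall x, `|\int[P2]_y G (x, y)| <= c) ->
  `|\int[(P1 \x P2)%E]_z G z| <= c.
Proof.
move=> Gc.
have Gi := @bounded_integrable _ _ _ (P1 \x P2)%E G B mG GB.
have inner x : (\int[P2]_y (G (x, y))%:E = (\int[P2]_y G (x, y))%:E)%E.
  rewrite fineK//; apply: integrable_fin_num => //.
  apply: (@bounded_integrable _ _ _ P2 (fun y => G (x, y)) B) => //.
  exact: measurableT_comp.
have mF := measurable_fubini_F Gi.
rewrite /Rintegral -integral12_prod_meas1// /fubini_F.
under eq_integral do rewrite /= inner.
apply: (@norm_Rintegral_le _ _ _ P1 (fun x => \int[P2]_y G (x, y))) => //.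
apply/measurable_EFinP; move: mF; congr measurable_fun.
by apply/funext => x; rewrite /fubini_F/= inner.
Qed.

Lemma Rintegral_prod_le_y : (forall y, `|\int[P1]_x G (x, y)| <= c) ->
  `|\int[(P1 \x P2)%E]_z G z| <= c.
Proof.
move=> Gc.
have Gi := @bounded_integrable _ _ _ (P1 \x P2)%E G B mG GB.
have inner y : (\int[P1]_x (G (x, y))%:E = (\int[P1]_x G (x, y))%:E)%E.
  rewrite fineK//; apply: integrable_fin_num => //.
  apply: (@bounded_integrable _ _ _ P1 (fun x => G (x, y)) B) => //.
  exact: measurableT_comp.
have mF := measurable_fubini_G Gi.
rewrite /Rintegral -integral21_prod_meas1// /fubini_G.
under eq_integral do rewrite /= inner.
apply: (@norm_Rintegral_le _ _ _ P2 (fun y => \int[P1]_x G (x, y))) => //.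
apply/measurable_EFinP; move: mF; congr measurable_fun.
by apply/funext => y; rewrite /fubini_G/= inner.
Qed.

End product_bounds.

(* A random point [phi] of the unit ball of ['rV_d] avoiding the exceptional set of
   Rademacher's theorem, whose law depends on translations in a Lipschitz way. *)
Definition averaging d disp (S : measurableType disp) (P : probability S R)
    (phi : S -> 'rV[R]_d) : Prop :=
  [/\ borel_mfun phi, (forall s, `|phi s| <= 1),
   (forall n (f : 'rV[R]_d -> 'rV[R]_n) L, (forall x y, `|f x - f y| <= L * `|x - y|) ->
      {ae P, forall s, approx_diff f id (phi s)}) &
   (exists2 C, 0 <= C & forall (F : 'rV[R]_d -> R) B, continuous F -> (forall x, `|F x| <= B) ->
      forall a, `|\int[P]_s F (phi s + a) - \int[P]_s F (phi s)| <= C * B * `|a|)].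

Lemma averaging0 : averaging unifP (fun=> 0 : 'rV[R]_0).
Proof.
split.
- by apply: entry_borel_mfun => i [].
- by move=> s; rewrite normr0.
- move=> n f L fL; apply: aeW => s e e0; exists 0, 1; split => // h _.
  have -> : h = 0 by apply/rowP => -[].
  by rewrite /= addr0 subrr mul0mx subr0 !normr0 mulr0.
- exists 0 => // F B _ _ a; have -> : a = 0 by apply/rowP => -[].
  by rewrite normr0 mulr0 addr0 subrr normr0.
Qed.

Lemma affine_at_cons d n (f : 'rV[R]_d.+1 -> 'rV[R]_n) e a dl t z :
  affine_at f (@tl_inj R d) e a dl (consv t z) <-> affine_at (f \o consv t) id e a dl z.
Proof.
by split => H h hd; have := H h hd; rewrite /= /tl_inj consvD addr0.
Qed.

Lemma consv_entry_borel disp (S : measurableType disp) d (g : S -> R) (w : S -> 'rV[R]_d) :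
  measurable_fun setT g -> borel_mfun w -> borel_mfun (fun s => consv (g s) (w s)).
Proof.
move=> mg mw; apply: entry_borel_mfun => i j; rewrite ord1.
case: (unliftP ord0 j) => [l ->|->].
  rewrite (_ : (fun _ => _) = (fun s => w s 0 l)); first exact: borel_entry_measurable.
  by apply/funext => s; rewrite consvES.
by rewrite (_ : (fun _ => _) = g)//; apply/funext => s; rewrite consvE0.
Qed.

(** Tonelli is used in both orders. With the new coordinate fixed, the slice is almost surely
    differentiable by the induction hypothesis. With the old coordinates fixed, almost every [t] is
    a derivability point of each component and a density point of each of the countably many sets
    [E] containing it, which is what [approx_diff_cons] asks for. *)
Lemma averagingS d disp (S : measurableType disp) (P : probability S R)
    (phi : S -> 'rV[R]_d) : averaging P phi ->
  averaging (unifP \x P)%E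
    (fun ts : measurableTypeR R * S => consv (clamp 0 1 ts.1) (phi ts.2)).
Proof.
move=> [mphi phi1 diffphi [C C0 transphi]].
have mclamp : measurable_fun setT (clamp 0 1 : measurableTypeR R -> R).
  by apply: continuous_measurable_fun; exact: clamp_continuous.
have mclamp1 : measurable_fun setT (fun ts : measurableTypeR R * S => clamp 0 1 ts.1).
  exact: measurableT_comp mclamp measurable_fst.
have mphi2 : borel_mfun (fun ts : measurableTypeR R * S => phi ts.2).
  apply: entry_borel_mfun => i j.
  exact: measurableT_comp (borel_entry_measurable i j mphi) measurable_snd.
set phi' := (X in averaging _ X).
have mphi' : borel_mfun phi' by exact: consv_entry_borel.
split => //.
- move=> [t s]; rewrite normr_consv ge_max phi1 andbT /= ger0_norm.
    by have /andP[] := clamp_itv t (@ler01 R).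
  by have /andP[] := clamp_itv t (@ler01 R).
- move=> n f L fL.
  have cf : continuous f := lipschitz_continuous fL.
  pose N' := ~` [set x | approx_diff f id (phi' x)].
  pose D1 := [set x | approx_diff f (@tl_inj R d) (phi' x)].
  have mN' : measurable N' by apply: measurableC; exact: approx_diff_measurable.
  have mD1 : measurable D1 by exact: approx_diff_measurable.
  have D10 : (unifP \x P)%E (~` D1) = 0%E.
    apply: null_xsections; first exact: measurableC.
    move=> t; apply: ae_measure0; first by apply: measurable_xsection; exact: measurableC.
    have gL (x y : 'rV[R]_d) : `|(f \o consv (clamp 0 1 t)) x - (f \o consv (clamp 0 1 t)) y| <= L * `|x - y|.
      by rewrite /= (le_trans (fL _ _))// consvB subrr normr_consv normr0 max_r.
    apply: ae_sub (diffphi _ _ _ gL) => s Hs.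
    rewrite /xsection/= inE; apply; rewrite /D1/= => e e0.
    by have [a [dl [dl0 H]]] := Hs e e0; exists a, dl; split => //; apply/affine_at_cons.
  have N'0 : (unifP \x P)%E (N' `&` D1) = 0%E.
    apply: null_ysections; first exact: measurableI.
    move=> s; apply: ae_measure0; first by apply: measurable_ysection; exact: measurableI.
    have gL j (x y : R) : `|f (consv x (phi s)) 0 j - f (consv y (phi s)) 0 j| <= L * `|x - y|.
      have := fL (consv x (phi s)) (consv y (phi s)).
      rewrite consvB subrr normr_consv normr0 max_l//; apply: le_trans.
      by rewrite (le_trans _ (mx_norm_entry _ 0 j))// !mxE.
    have A1 := ae_forall_countable (fun j : 'I_n => lipschitz_derivable_ae (gL j)).
    pose E (Nal : nat * 'M[rat]_(d, n) * nat) := [set t : R |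
      affine_at f (@tl_inj R d) Nal.1.1.+1%:R^-1 (map_mx ratr Nal.1.2) Nal.2.+1%:R^-1 (consv t (phi s))].
    have mE Nal : measurable (E Nal).
      have bc : borel_mfun (fun t : R => consv t (phi s)).
        by apply: consv_entry_borel => // U oU; rewrite preimage_cst; case: ifP.
      by apply: (borel_closed bc); exact: closed_affine_at.
    have A2 := ae_forall_countable (fun Nal => density_nonporous (mE Nal)).
    apply: ae_sub (ae_and unifP_itv (ae_and (unifP_ae A1) (unifP_ae A2))) => t [t01 [A1t A2t]].
    rewrite /ysection/= inE /N' /D1 /phi'/= (clamp_id t01) => -[+ H]; apply.
    apply: (approx_diff_cons fL H A1t) => N a l Et Et0.
    exact: (A2t (N, a, l) Et0).
  exists N'; split => //.
  apply/eqP; rewrite eq_le measure_ge0 andbT.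
  rewrite (@le_trans _ _ ((unifP \x P)%E (~` D1 `|` (N' `&` D1))))//.
    apply: le_measure; rewrite ?inE//.
      by apply: measurableU; [exact: measurableC|exact: measurableI].
    move=> x N'x; have [D1x|] := pselect (D1 x); first by right.
    by left.
  rewrite (le_trans (measureU2 _ _ _))//; [exact: measurableC|exact: measurableI|].
  by rewrite [X in (X + _ <= _)%E]D10 [X in (_ + X <= _)%E]N'0 adde0.
(* [C] pays for shifting the old coordinates, and 2 is the constant of [Rintegral_unit_translation]
   for the new one. *)
- exists (C + 2) => [|F B cF FB a]; first by rewrite addr_ge0.
  have B0 : 0 <= B := le_trans (normr_ge0 _) (FB 0).
  rewrite [a]consv_eta; set a0 := a 0 0; set a' := \row_i _.
  pose G1 (ts : measurableTypeR R * S) := F (consv (clamp 0 1 ts.1 + a0) (phi ts.2 + a')).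
  pose G2 (ts : measurableTypeR R * S) := F (consv (clamp 0 1 ts.1 + a0) (phi ts.2)).
  pose G3 (ts : measurableTypeR R * S) := F (consv (clamp 0 1 ts.1) (phi ts.2)).
  have mc : measurable_fun setT (fun ts : measurableTypeR R * S => clamp 0 1 ts.1 + a0).
    exact: measurable_funD.
  have mp : borel_mfun (fun ts : measurableTypeR R * S => phi ts.2 + a').
    apply: entry_borel_mfun => i j.
    rewrite (_ : (fun _ => _) = (fun ts => phi ts.2 i j + a' i j)); last first.
      by apply/funext => ts; rewrite mxE.
    by apply: measurable_funD => //; exact: borel_entry_measurable.
  have mG1 : measurable_fun setT G1.
    by apply: borel_measurable; apply: (borel_comp _ cF); exact: consv_entry_borel.
  have mG2 : measurable_fun setT G2.
    by apply: borel_measurable; apply: (borel_comp _ cF); exact: consv_entry_borel.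
  have mG3 : measurable_fun setT G3.
    by apply: borel_measurable; apply: (borel_comp _ cF); exact: consv_entry_borel.
  have i1 := @bounded_integrable _ _ _ (unifP \x P)%E G1 B mG1 (fun _ => FB _).
  have i2 := @bounded_integrable _ _ _ (unifP \x P)%E G2 B mG2 (fun _ => FB _).
  have i3 := @bounded_integrable _ _ _ (unifP \x P)%E G3 B mG3 (fun _ => FB _).
  have -> : \int[(unifP \x P)%E]_s F (phi' s + consv a0 a') = \int[(unifP \x P)%E]_s G1 s.
    by apply: eq_Rintegral => s _; rewrite /phi' consvD.
  rewrite -[X in _ - X]/(\int[(unifP \x P)%E]_s G3 s).
  have GB2 (G G' : measurableTypeR R * S -> R) : (forall z, `|G z| <= B) -> (forall z, `|G' z| <= B) ->
     forall z, `|G z - G' z| <= B + B.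
    by move=> HG HG' z; rewrite (le_trans (ler_normB _ _))// lerD.
  have H12 : `|\int[(unifP \x P)%E]_s (G1 s - G2 s)| <= C * B * `|a'|.
    apply: (@Rintegral_prod_le_x _ _ _ _ _ _ (fun s => G1 s - G2 s) (B + B)).
    - exact: measurable_funB.
    - by apply: GB2 => z; exact: FB.
    move=> t /=; rewrite RintegralB//.
    + pose Ft (z : 'rV[R]_d) := F (consv (clamp 0 1 t + a0) z).
      rewrite /G1 /G2/=; apply: (transphi Ft B) => [z|z]; last exact: FB.
      apply: (cvg_comp (fun z => consv (clamp 0 1 t + a0) z) F _ (cF _)).
      apply: (@lipschitz_continuous _ _ _ (consv (clamp 0 1 t + a0)) 1) => x y.
      by rewrite consvB subrr normr_consv normr0 max_r// mul1r.
    + apply: (@bounded_integrable _ _ _ P (fun y => G1 (t, y)) B) => [|y]; last exact: FB.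
      exact: measurableT_comp.
    + apply: (@bounded_integrable _ _ _ P (fun y => G2 (t, y)) B) => [|y]; last exact: FB.
      exact: measurableT_comp.
  have H23 : `|\int[(unifP \x P)%E]_s (G2 s - G3 s)| <= 2 * B * `|a0|.
    apply: (@Rintegral_prod_le_y _ _ _ _ _ _ (fun s => G2 s - G3 s) (B + B)).
    - exact: measurable_funB.
    - by apply: GB2 => z; exact: FB.
    move=> s /=; rewrite RintegralB//.
    + pose Fs (t : R) := F (consv t (phi s)).
      rewrite /G2 /G3/=; apply: (@Rintegral_unit_translation _ Fs B) => [t|t]; last exact: FB.
      apply: (cvg_comp (fun t => consv t (phi s)) F _ (cF _)).
      apply: (@lipschitz_continuous _ R^o _ (fun t => consv t (phi s)) 1) => x y.
      by rewrite consvB subrr normr_consv normr0 max_l// mul1r.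
    + apply: (@bounded_integrable _ _ _ unifP (fun t => G2 (t, s)) B) => [|y]; last exact: FB.
      exact: measurableT_comp.
    + apply: (@bounded_integrable _ _ _ unifP (fun t => G3 (t, s)) B) => [|y]; last exact: FB.
      exact: measurableT_comp.
  have -> : \int[(unifP \x P)%E]_s G1 s - \int[(unifP \x P)%E]_s G3 s =
     \int[(unifP \x P)%E]_s (G1 s - G2 s) + \int[(unifP \x P)%E]_s (G2 s - G3 s).
    by rewrite !RintegralB// addrA subrK.
  rewrite (le_trans (ler_normD _ _))// normr_consv.
  set M := Num.max _ _.
  have h1 : C * B * `|a'| <= C * B * M by rewrite ler_wpM2l ?mulr_ge0// le_max lexx orbT.
  have h2 : 2 * B * `|a0| <= 2 * B * M by rewrite ler_wpM2l ?mulr_ge0// le_max lexx.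
  apply: (le_trans (lerD (le_trans H12 h1) (le_trans H23 h2))).
  by rewrite -!mulrDl.
Qed.

Lemma averaging_exists d : exists disp (S : measurableType disp) (P : probability S R)
  (phi : S -> 'rV[R]_d), averaging P phi.
Proof.
elim: d => [|d [disp [S [P [phi H]]]]].
  by do 4!eexists; exact: averaging0.
by do 4!eexists; exact: averagingS H.
Qed.

End averaging.

(** * Mollification *)

Section mollification.
Context {R : realType}.

Definition mdot m n (Q A : 'M[R]_(m, n)) : R := \sum_i \sum_j Q i j * A i j.

Lemma Rintegral_sum disp (S : measurableType disp) (P : probability S R) (I : Type)
    (r : seq I) (c : I -> R) (F : I -> S -> R) :
  (forall i, P.-integrable setT (EFin \o F i)) ->
  \int[P]_s (\sum_(i <- r) c i * F i s) = \sum_(i <- r) c i * \int[P]_s F i s.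
Proof.
move=> Fi.
have cFi i : P.-integrable setT (EFin \o (fun s => c i * F i s)).
  have := integrableZl measurableT (c i) (Fi i).
  by apply: eq_integrable => // s _.
have si : forall r : seq I, P.-integrable setT (EFin \o (fun s => \sum_(i <- r) c i * F i s)).
  elim=> [|i l IH].
    apply: (@bounded_integrable _ _ _ P _ 0) => [|s].
      by rewrite (_ : (fun _ => _) = cst 0)//; apply/funext => s; rewrite big_nil.
    by rewrite big_nil normr0.
  have := integrableD measurableT (cFi i) IH.
  by apply: eq_integrable => // s _; rewrite /= big_cons EFinD.
elim: r => [|i l IH].
  rewrite big_nil -[RHS](Rintegral_prob_cst P 0).
  by apply: eq_Rintegral => s _; rewrite big_nil.
rewrite big_cons -IH -RintegralZl// -RintegralD//.
by apply: eq_Rintegral => s _; rewrite big_cons.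
Qed.

Lemma mdot_Rintegral disp (S : measurableType disp) (P : probability S R) m n
    (Q : 'M[R]_(m, n)) (G : S -> 'M[R]_(m, n)) B :
  (forall i j, measurable_fun setT (fun s => G s i j)) -> (forall s, `|G s| <= B) ->
  mdot Q (\matrix_(i, j) \int[P]_s G s i j) = \int[P]_s mdot Q (G s).
Proof.
move=> mG GB.
have Gi i j : P.-integrable setT (EFin \o (fun s => G s i j)).
  by apply: (bounded_integrable P (mG i j)) => s; exact: le_trans (mx_norm_entry _ _ _) (GB s).
rewrite /mdot pair_big.
under eq_Rintegral do rewrite pair_big.
rewrite (Rintegral_sum _ (fun ij => Q ij.1 ij.2) (fun ij => Gi ij.1 ij.2)).
by apply: eq_bigr => -[i j] _; rewrite mxE.
Qed.

Lemma Rintegral_le_ae disp (S : measurableType disp) (P : probability S R) (g : S -> R) B q :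
  measurable_fun setT g -> (forall s, `|g s| <= B) -> {ae P, forall s, g s <= q} ->
  \int[P]_s g s <= q.
Proof.
move=> mg gB gq; pose g' s := Num.min (g s) q.
have mg' : measurable_fun setT g' by exact: measurable_minr.
have -> : \int[P]_s g s = \int[P]_s g' s.
  congr fine; apply: ae_eq_integral => //; [exact/measurable_EFinP..|].
  by apply: ae_sub gq => s gs _; rewrite /g' min_l.
rewrite -[leRHS](Rintegral_prob_cst P); apply: le_Rintegral => //.
- apply: (@bounded_integrable _ _ _ P _ (B + `|q|) mg') => s.
  have := gB s; rewrite /g'; case: (leP (g s) q) => _ gs.
    by rewrite (le_trans gs)// lerDl.
  by rewrite lerDr (le_trans _ gs).
- by apply: (@bounded_integrable _ _ _ P _ `|q|).
- by move=> s _; rewrite /g' ge_min lexx orbT.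
Qed.

Lemma mx_subE m n (A B : 'M[R]_(m, n)) i j : (A - B) i j = A i j - B i j.
Proof. by rewrite !mxE. Qed.

Lemma delta_mul_entry m n (A : 'M[R]_(m, n)) i j :
  ((delta_mx 0 i : 'rV[R]_m) *m A) 0 j = A i j.
Proof. by rewrite -rowE mxE. Qed.

Lemma sub_delta_entry m n (A B : 'M[R]_(m, n)) i j :
  (A - B) i j = ((delta_mx 0 i : 'rV[R]_m) *m A - (delta_mx 0 i : 'rV[R]_m) *m B) 0 j.
Proof. by rewrite -!rowE !mxE. Qed.

Lemma delta_mx_norm m i : `|delta_mx 0 i : 'rV[R]_m| <= 1.
Proof.
apply: mx_norm_le => // i' j'; rewrite !mxE.
by case: (_ && _); rewrite ?normr1 ?normr0.
Qed.

Variables (d : nat) (disp : measure_display) (S : measurableType disp).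
Variables (P : probability S R) (phi : S -> 'rV[R]_d).
Hypothesis av : averaging P phi.

Definition moll n (f : 'rV[R]_d -> 'rV[R]_n) (r : R) (y : 'rV[R]_d) : 'rV[R]_n :=
  \row_j \int[P]_s f (y + r *: phi s) 0 j.

(** With the default 0 at points without derivative, the bound by the Lipschitz constant holds
    everywhere. *)
Definition jac n (f : 'rV[R]_d -> 'rV[R]_n) (z : 'rV[R]_d) : 'M[R]_(d, n) :=
  xget 0 [set A | frechet f z A].

Lemma jacP n (f : 'rV[R]_d -> 'rV[R]_n) z : approx_diff f id z -> frechet f z (jac f z).
Proof.
move=> /approx_diff_frechet[A fA].
exact: (@xgetPex _ 0 [set A | frechet f z A]) (ex_intro _ A fA).
Qed.

Lemma jac0 n (f : 'rV[R]_d -> 'rV[R]_n) z : ~ approx_diff f id z -> jac f z = 0.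
Proof. by move=> nf; apply: xgetPN => A /= fA; apply: nf; exact: frechet_approx_diff fA. Qed.

(** A sequence of steps [1 / (k + 1)] suits dominated convergence and measurable limits; moreover
    [k + 1] such steps add up exactly to [w], which [moll_taylor] exploits. *)
Definition quot n (f : 'rV[R]_d -> 'rV[R]_n) (w : 'rV[R]_d) (k : nat) (z : 'rV[R]_d) : 'rV[R]_n :=
  k.+1%:R *: (f (z + k.+1%:R^-1 *: w) - f z).

Lemma frechet_quot n (f : 'rV[R]_d -> 'rV[R]_n) z A w : frechet f z A ->
  (fun k => quot f w k z) @ \oo --> w *m A.
Proof.
move=> fA; apply/cvgrPdist_le => e e0.
have w1 : 0 < `|w| + 1 by rewrite ltr_wpDl.
have ew : 0 < e / (`|w| + 1) by rewrite divr_gt0.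
have [dl dl0 H] := fA _ ew.
have dw : 0 < dl / (`|w| + 1) by rewrite divr_gt0.
have [K Kd] := inv_nat_lt dw; exists K => // k /= Kk.
have k0 : 0 < k.+1%:R^-1 :> R by rewrite invr_gt0.
have kd : k.+1%:R^-1 < dl / (`|w| + 1).
  by apply: le_lt_trans Kd; rewrite lef_pV2 ?posrE// ler_nat.
have hd : `|k.+1%:R^-1 *: w| < dl.
  rewrite normrZ gtr0_norm//; move: kd; rewrite ltr_pdivlMr//; apply: le_lt_trans.
  by rewrite ler_wpM2l// ?lerDl// ltW.
have := H _ hd; rewrite /= -scalemxAl => Hk.
have -> : w *m A - quot f w k z =
    - (k.+1%:R *: (f (z + k.+1%:R^-1 *: w) - f z - k.+1%:R^-1 *: (w *m A))).
  rewrite /quot [in RHS]scalerBr scalerA mulfV ?pnatr_eq0// scale1r.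
  by rewrite opprB.
rewrite normrN normrZ gtr0_norm// -ler_pdivlMl// (le_trans Hk)//.
rewrite normrZ gtr0_norm// mulrCA ler_wpM2l// ?(ltW k0)//.
rewrite -mulrA ler_piMr ?(ltW e0)// mulrC ler_pdivrMr// mul1r lerDl.
exact: ler01.
Qed.
Arguments frechet_quot {n f z A} w _.

Section lipschitz_function.
Variables (n : nat) (f : 'rV[R]_d -> 'rV[R]_n) (L : R).
Hypothesis fL : forall x y, `|f x - f y| <= L * `|x - y|.

Let cf : continuous f. Proof. exact: lipschitz_continuous fL. Qed.

Lemma quot_bound w k z : `|quot f w k z| <= L * `|w|.
Proof.
rewrite /quot normrZ gtr0_norm// -ler_pdivlMl// (le_trans (fL _ _))//.
by rewrite addrAC subrr add0r normrZ gtr0_norm ?invr_gt0// mulrCA.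
Qed.

Lemma moll_point_borel r y : borel_mfun (fun s => y + r *: phi s).
Proof.
have [mphi _ _ _] := av; apply: entry_borel_mfun => i j.
rewrite (_ : (fun _ => _) = (fun s => y i j + r * phi s i j)); last first.
  by apply/funext => s; rewrite !mxE.
apply: measurable_funD => //; apply: measurable_funM => //.
exact: borel_entry_measurable.
Qed.

Lemma moll_entry_measurable n' (F : 'rV[R]_d -> 'rV[R]_n') r y j : continuous F ->
  measurable_fun setT (fun s => F (y + r *: phi s) 0 j).
Proof.
by move=> cF; apply: borel_entry_measurable; exact: borel_comp (moll_point_borel _ _) cF.
Qed.

Lemma ae_approx_diff r y : 0 < r -> {ae P, forall s, approx_diff f id (y + r *: phi s)}.
Proof.
move=> r0; have [_ _ dphi _] := av.
have gL x x' : `|f (y + r *: x) - f (y + r *: x')| <= (L * r) * `|x - x'|.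
  rewrite (le_trans (fL _ _))// opprD addrACA subrr add0r -scalerBr normrZ.
  by rewrite gtr0_norm// mulrA.
apply: ae_sub (dphi n (fun x => f (y + r *: x)) _ gL) => s H e e0.
have er : 0 < e * r by rewrite mulr_gt0.
have [a [dl [dl0 Ha]]] := H _ er; exists (r^-1 *: a), (r * dl); split; first by rewrite mulr_gt0.
move=> h hd; have rh : `|r^-1 *: h| < dl.
  by rewrite normrZ gtr0_norm ?invr_gt0// ltr_pdivrMl.
have := Ha _ rh; rewrite /= scalerDr scalerA mulfV ?gt_eqF// scale1r addrA.
rewrite -scalemxAl -scalemxAr normrZ gtr0_norm ?invr_gt0//.
by rewrite -mulrA (mulrA r) mulfV ?gt_eqF// mul1r.
Qed.

Lemma jac_bound z : `|jac f z| <= `|L|.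
Proof.
have [fz|nf] := pselect (approx_diff f id z); last by rewrite jac0// normr0.
have := jacP fz => fA; apply: mx_norm_le => // i j.
have H := frechet_quot (delta_mx 0 i) fA; rewrite -rowE in H.
have : (fun k => quot f (delta_mx 0 i) k z 0 j) @ \oo --> (jac f z) i j.
  have -> : jac f z i j = (row i (jac f z)) 0 j by rewrite mxE.
  exact: (cvg_comp _ (fun M : 'rV[R]_n => M 0 j) H (@coord_continuous _ _ _ _ _ _)).
move=> /cvg_norm Hn; apply: (cvgr_to_le Hn); apply: nearW => k.
rewrite (le_trans (mx_norm_entry _ _ _))// (le_trans (quot_bound _ _ _))//.
rewrite (le_trans (ler_wpM2r _ (ler_norm L)))// ler_piMr//.
exact: delta_mx_norm.
Qed.

Definition mjac r y : 'M[R]_(d, n) := \matrix_(i, j) \int[P]_s jac f (y + r *: phi s) i j.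

Lemma quot_continuous w k : continuous (quot f w k).
Proof.
apply: (@lipschitz_continuous _ _ _ _ (k.+1%:R * (L + L))) => x y.
rewrite /quot -scalerBr normrZ gtr0_norm// -mulrA ler_pM2l// opprD addrACA -opprD.
rewrite (le_trans (ler_normB _ _))// mulrDl lerD//.
by rewrite (le_trans (fL _ _))// opprD addrACA subrr addr0.
Qed.

(** The difference quotients, multiplied by the indicator of the measurable set of
    differentiability, converge at every sample point, to 0 off that set. *)
Lemma jac_measurable r y i j : measurable_fun setT (fun s => jac f (y + r *: phi s) i j).
Proof.
pose D := [set s | approx_diff f id (y + r *: phi s)].
have mD : measurable D by apply: approx_diff_measurable => //; exact: moll_point_borel.
pose u k s : R := \1_D s * quot f (delta_mx 0 i) k (y + r *: phi s) 0 j.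
apply: (@measurable_fun_cvg _ _ _ _ u) => [k|s _].
  apply: measurable_funM; first exact: measurable_indic.
  by apply: (@moll_entry_measurable _ (quot f (delta_mx 0 i) k)); exact: quot_continuous.
rewrite /u indicE; have [fz|nf] := pselect (approx_diff f id (y + r *: phi s)); last first.
  by rewrite memNset// jac0//= !mxE; under eq_fun do rewrite mul0r; exact: cvg_cst.
rewrite mem_set//; under eq_fun do rewrite mul1r.
have H := frechet_quot (delta_mx 0 i) (jacP fz); rewrite -rowE in H.
have -> : jac f (y + r *: phi s) i j = (row i (jac f (y + r *: phi s))) 0 j by rewrite mxE.
exact: (cvg_comp _ (fun M : 'rV[R]_n => M 0 j) H (@coord_continuous _ _ _ _ _ _)).
Qed.

Lemma moll_integrable r y j : P.-integrable setT (EFin \o (fun s => f (y + r *: phi s) 0 j)).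
Proof.
have [_ phi1 _ _] := av.
apply: (@bounded_integrable _ _ _ P _ (`|f y| + `|L| * `|r|)).
  exact: moll_entry_measurable.
move=> s; rewrite (le_trans (mx_norm_entry _ _ _))// -[X in `|X|](subrK (f y)).
rewrite (le_trans (ler_normD _ _))// addrC lerD2l (le_trans (fL _ _))//.
rewrite addrAC subrr add0r (le_trans (ler_wpM2r _ (ler_norm L)))// ler_wpM2l//.
by rewrite normrZ ler_piMr.
Qed.

Lemma moll_quot w k r y :
  quot (moll f r) w k y = \row_j \int[P]_s quot f w k (y + r *: phi s) 0 j.
Proof.
apply/rowP => j; rewrite /quot !mxE -RintegralB//; [|exact: moll_integrable..].
rewrite -RintegralZl//; last first.
  by have := integrableB measurableT (moll_integrable r (y + k.+1%:R^-1 *: w) j) (moll_integrable r y j).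
by apply: eq_Rintegral => s _; rewrite !mxE (addrAC y).
Qed.

(** Dominated convergence: the quotients of [f] are bounded by [L * |w|] and converge almost surely
    because the random point avoids the exceptional set. *)
Lemma moll_quot_cvg w r y : 0 < r -> (fun k => quot (moll f r) w k y) @ \oo --> w *m mjac r y.
Proof.
move=> r0; apply: cvg_mx_entry => i j; rewrite ord1 {i}.
pose u k s := quot f w k (y + r *: phi s) 0 j.
pose g s := (w *m jac f (y + r *: phi s)) 0 j.
have mu_ k : measurable_fun setT (u k) by apply: moll_entry_measurable; exact: quot_continuous.
have ub k s : `|u k s| <= L * `|w|.
  by rewrite (le_trans (mx_norm_entry _ _ _))// quot_bound.
have jacI i : P.-integrable setT (EFin \o (fun s => jac f (y + r *: phi s) i j)).
  apply: (bounded_integrable P (jac_measurable r y i j)) => s.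
  exact: le_trans (mx_norm_entry _ _ _) (jac_bound _).
have gE : g = fun s => \sum_i w 0 i * jac f (y + r *: phi s) i j.
  by apply/funext => s; rewrite /g mxE.
have mg : measurable_fun setT g.
  rewrite gE; apply: measurable_sum => i; apply: measurable_funM => //.
  exact: jac_measurable.
have -> : (w *m mjac r y) 0 j = \int[P]_s g s.
  rewrite gE (Rintegral_sum _ _ jacI) mxE.
  by apply: eq_bigr => i _; rewrite mxE.
have -> : (fun k => quot (moll f r) w k y 0 j) = (fun k => \int[P]_s u k s).
  by apply/funext => k; rewrite moll_quot mxE.
have ucvg : {ae P, forall s, setT s -> (fun k => (u k s)%:E) @ \oo --> (g s)%:E}.
  apply: ae_sub (ae_approx_diff y r0) => s fz _; apply/cvg_EFin; first exact: nearW.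
  have H := frechet_quot w (jacP fz).
  exact: (cvg_comp _ (fun M : 'rV[R]_n => M 0 j) H (@coord_continuous _ _ _ _ _ _)).
have [gi _ H] := @dominated_convergence _ _ _ P setT measurableT (fun k => EFin \o u k) (EFin \o g)
  (fun=> (L * `|w|)%:E) (fun k => (measurable_EFinP _ _).2 (mu_ k)) ((measurable_EFinP _ _).2 mg)
  ucvg (@bounded_integrable _ _ _ P (fun=> L * `|w|) `|L * `|w| | (measurable_cst _) (fun=> lexx _))
  (aeW P (fun s k _ => ub k s)).
have : (fun k => \int[P]_s (EFin \o u k) s)%E @ \oo --> (\int[P]_s g s)%:E.
  by rewrite /Rintegral fineK ?(integrable_fin_num measurableT gi).
by move=> /fine_cvgP[_].
Qed.

(** Linear inequalities survive averaging. They are the form in which averaged Jacobians are tied to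
    the derivatives nearby, and in the end to their convex hull. *)
Lemma mjac_dot_le (Q : 'M[R]_(d, n)) q r y : 0 < r ->
  (forall z A, `|z - y| <= r -> frechet f z A -> mdot Q A <= q) ->
  mdot Q (mjac r y) <= q.
Proof.
move=> r0 Hq; have [_ phi1 _ _] := av.
pose G s := jac f (y + r *: phi s).
have mG i j : measurable_fun setT (fun s => G s i j) by exact: jac_measurable.
rewrite /mjac (mdot_Rintegral P Q mG (fun s => jac_bound _)).
have mD : measurable_fun setT (fun s => mdot Q (G s)).
  apply: measurable_sum => i; apply: measurable_sum => j.
  by apply: measurable_funM => //; exact: mG.
apply: (Rintegral_le_ae mD (B := \sum_i \sum_j `|Q i j| * `|L|)) => [s|].
  rewrite (le_trans (ler_norm_sum _ _ _))//; apply: ler_sum => i _.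
  rewrite (le_trans (ler_norm_sum _ _ _))//; apply: ler_sum => j _.
  by rewrite normrM ler_wpM2l// (le_trans (mx_norm_entry _ _ _))// jac_bound.
apply: ae_sub (ae_approx_diff y r0) => s fz.
apply: (Hq (y + r *: phi s)); last exact: jacP.
by rewrite addrAC subrr add0r normrZ gtr0_norm// ler_piMr// ltW.
Qed.

Lemma moll_dist r y : 0 <= r -> `|moll f r y - f y| <= `|L| * r.
Proof.
move=> r0; have [_ phi1 _ _] := av; apply: mx_norm_le => [|i j]; first by rewrite mulr_ge0.
rewrite ord1 !mxE -[X in _ - X](Rintegral_prob_cst P).
rewrite -RintegralB//; last 2 first.
- exact: moll_integrable.
- by apply: (@bounded_integrable _ _ _ P _ `|f y 0 j|).
apply: norm_Rintegral_le => [|s].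
  by apply: measurable_funB => //; exact: moll_entry_measurable.
have -> : f (y + r *: phi s) 0 j - f y 0 j = (f (y + r *: phi s) - f y) 0 j by rewrite !mxE.
rewrite (le_trans (mx_norm_entry _ _ _))// (le_trans (fL _ _))//.
rewrite addrAC subrr add0r (le_trans (ler_wpM2r _ (ler_norm L)))// ler_wpM2l//.
by rewrite normrZ ger0_norm// ler_piMr.
Qed.

(** At scale [r], moving the base point from [y'] to [y] translates the random point by
    [(y - y') / r], and the quotient is bounded by [L * |w|]. The estimate does not depend on [k],
    so it passes to the averaged Jacobian. *)
Lemma moll_translation : exists2 C, 0 <= C & forall w k r y y', 0 < r ->
  `|quot (moll f r) w k y - quot (moll f r) w k y'| <= C * (L * `|w|) * (`|y - y'| / r).
Proof.
have [_ _ _ [C C0 HC]] := av; exists C => // w k r y y' r0.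
have Lw : 0 <= L * `|w| by exact: le_trans (normr_ge0 _) (quot_bound w k y).
have ri : 0 <= r^-1 by rewrite invr_ge0 ltW.
apply: mx_norm_le => [|i j]; first exact: mulr_ge0 (mulr_ge0 C0 Lw) (mulr_ge0 (normr_ge0 _) ri).
rewrite ord1 !moll_quot !mxE.
pose F z := quot f w k (y' + r *: z) 0 j.
have cF : continuous F.
  move=> z; apply: (cvg_comp (fun z => quot f w k (y' + r *: z)) (fun M : 'rV[R]_n => M 0 j)); last first.
    exact: coord_continuous.
  apply: (cvg_comp (fun z => y' + r *: z) (quot f w k) _ (@quot_continuous w k _)).
  apply: (@lipschitz_continuous _ _ _ (fun z => y' + r *: z) r) => a b.
  by rewrite opprD addrACA subrr add0r -scalerBr normrZ gtr0_norm.
have FB z : `|F z| <= L * `|w| by rewrite (le_trans (mx_norm_entry _ _ _))// quot_bound.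
have := HC F _ cF FB (r^-1 *: (y - y')).
have -> : `|r^-1 *: (y - y')| = `|y - y'| / r.
  by rewrite normrZ (gtr0_norm (_ : 0 < r^-1)) ?invr_gt0// mulrC.
suff -> : \int[P]_s F (phi s + r^-1 *: (y - y')) = \int[P]_s quot f w k (y + r *: phi s) 0 j by [].
apply: eq_Rintegral => s _; rewrite /F; congr (quot f w k _ 0 j).
rewrite scalerDr scalerA mulfV ?gt_eqF// scale1r addrCA (addrC y').
by rewrite subrK addrC.
Qed.

Lemma norm_cvg_le (u : nat -> 'rV[R]_n) (a l : 'rV[R]_n) b :
  u @ \oo --> l -> (forall k, `|a - u k| <= b) -> `|a - l| <= b.
Proof.
move=> ul H; apply: (cvgr_to_le (cvg_norm (cvgB (cvg_cst a) ul))).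
exact: nearW.
Qed.

Lemma mjac_lipschitz C : 0 <= L ->
  (forall w k r y y', 0 < r ->
    `|quot (moll f r) w k y - quot (moll f r) w k y'| <= C * (L * `|w|) * (`|y - y'| / r)) ->
  0 <= C -> forall r y y', 0 < r -> `|mjac r y - mjac r y'| <= C * L * (`|y - y'| / r).
Proof.
move=> L0 HC C0 r y y' r0.
have b0 : 0 <= C * L * (`|y - y'| / r) by rewrite !mulr_ge0// invr_ge0 ltW.
apply: mx_norm_le => // i j.
pose ei : 'rV[R]_d := delta_mx 0 i.
rewrite (sub_delta_entry (mjac r y) (mjac r y')) -/ei.
rewrite (le_trans (mx_norm_entry _ _ _))//.
have H1 := @moll_quot_cvg ei r y r0.
have H2 := @moll_quot_cvg ei r y' r0.
apply: (cvgr_to_le (cvg_norm (cvgB H1 H2))); apply: nearW => k.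
rewrite (le_trans (HC _ _ _ _ _ r0))// ler_wpM2r ?mulr_ge0 ?invr_ge0 ?(ltW r0)//.
by rewrite ler_wpM2l// ler_piMr// delta_mx_norm.
Qed.

(** The increment telescopes into [k + 1] quotients taken along the segment. By the translation
    estimate each differs from the quotient at [y] by at most [C * L * |w| ^ 2 / r]; then [k] tends
    to infinity. *)
Lemma moll_taylor C : 0 <= L ->
  (forall w k r y y', 0 < r ->
    `|quot (moll f r) w k y - quot (moll f r) w k y'| <= C * (L * `|w|) * (`|y - y'| / r)) ->
  0 <= C -> forall r y w, 0 < r ->
  `|moll f r (y + w) - moll f r y - w *m mjac r y| <= C * L * (`|w| ^+ 2 / r).
Proof.
move=> L0 HC C0 r y w r0; have H := @moll_quot_cvg w r y r0.
apply: (@norm_cvg_le (fun k => quot (moll f r) w k y) (moll f r (y + w) - moll f r y)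
  (w *m mjac r y) (C * L * (`|w| ^+ 2 / r)) H) => k.
pose t : R := k.+1%:R^-1; have t0 : 0 < t by rewrite invr_gt0.
have kt : k.+1%:R * t = 1 by rewrite mulfV.
pose G l := moll f r (y + (l%:R * t) *: w).
have GS (l : nat) : G l.+1 - G l = t *: quot (moll f r) w k (y + (l%:R * t) *: w).
  rewrite /quot scalerA mulVf// scale1r /G -addrA -scalerDl.
  by rewrite -[in l.+1%:R]natr1 mulrDl mul1r.
have -> : moll f r (y + w) - moll f r y = \sum_(0 <= l < k.+1) (G l.+1 - G l).
  by rewrite telescope_sumr// /G kt scale1r mul0r scale0r addr0.
have -> : quot (moll f r) w k y = \sum_(0 <= l < k.+1) t *: quot (moll f r) w k y.
  by rewrite sumr_const_nat subn0 -scaler_nat scalerA kt scale1r.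
rewrite -sumrB (le_trans (ler_norm_sum _ _ _))//.
rewrite (@le_trans _ _ (\sum_(0 <= l < k.+1) t * (C * L * (`|w| ^+ 2 / r))))//; last first.
  by rewrite sumr_const_nat subn0 -mulr_natl mulrA kt mul1r.
rewrite big_nat [leRHS]big_nat; apply: ler_sum => l /andP[_ lk].
rewrite GS -scalerBr normrZ gtr0_norm// ler_pM2l//.
rewrite (le_trans (HC _ _ _ _ _ r0))// addrAC subrr add0r normrZ.
have lt1 : `|l%:R * t| <= 1.
  rewrite ger0_norm; last by rewrite mulr_ge0// ltW.
  have lk' : l%:R <= k.+1%:R :> R by rewrite ler_nat ltnW.
  by have := ler_wpM2r (ltW t0) lk'; rewrite kt.
have -> : C * L * (`|w| ^+ 2 / r) = C * (L * `|w|) * (`|w| / r) by ring.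
rewrite ler_wpM2l ?mulr_ge0// ler_wpM2r ?invr_ge0 ?(ltW r0)//.
by rewrite ler_piMl.
Qed.

End lipschitz_function.
End mollification.

(** * Mollification of functions that are Lipschitz on bounded sets *)

Section locally_lipschitz.
Context {R : realType}.

Definition lip_bounded d n (f : 'rV[R]_d -> 'rV[R]_n) := forall c, exists L, forall x y,
  `|x| <= c -> `|y| <= c -> `|f x - f y| <= L * `|x - y|.

(** For [c >= 0] this is the retraction onto the ball of radius [c]; acting entrywise, it is
    1-Lipschitz for the sup norm. *)
Definition clampV d (c : R) (z : 'rV[R]_d) : 'rV[R]_d := \row_i clamp (- c) c (z 0 i).

Lemma clampV_id d c (z : 'rV[R]_d) : `|z| <= c -> clampV c z = z.
Proof.
move=> zc; apply/rowP => i; rewrite mxE clamp_id// -ler_norml.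
exact: le_trans (mx_norm_entry _ _ _) zc.
Qed.

Lemma clampV_norm d c (z : 'rV[R]_d) : 0 <= c -> `|clampV c z| <= c.
Proof.
move=> c0; apply: mx_norm_le => // i j; rewrite mxE ler_norml.
by apply: clamp_itv; rewrite ge0_cp.
Qed.

Lemma clampV_lipschitz d c (x y : 'rV[R]_d) : `|clampV c x - clampV c y| <= `|x - y|.
Proof.
apply: mx_norm_le => // i j; rewrite ord1 mx_subE !mxE.
rewrite (le_trans (clamp_lipschitz _ _ _ _))// -mx_subE.
exact: mx_norm_entry.
Qed.

Lemma lip_bounded_extension d n (f : 'rV[R]_d -> 'rV[R]_n) c : lip_bounded f -> 0 <= c ->
  exists g L, [/\ 0 <= L, forall x y, `|g x - g y| <= L * `|x - y| &
    forall z, `|z| <= c -> g z = f z].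
Proof.
move=> lf c0; have [L fL] := lf c.
exists (f \o clampV c), `|L|; split => // [x y|z zc]; last by rewrite /= clampV_id.
rewrite /= (le_trans (fL _ _ _ _)) ?clampV_norm//.
rewrite (le_trans (ler_wpM2r _ (ler_norm L)))// ler_wpM2l//.
exact: clampV_lipschitz.
Qed.

Lemma frechet_local d n (f g : 'rV[R]_d -> 'rV[R]_n) c z A :
  (forall x, `|x| <= c -> g x = f x) -> `|z| < c -> frechet g z A -> frechet f z A.
Proof.
move=> gf zc gA e e0; have [dl dl0 H] := gA e e0.
exists (Num.min dl (c - `|z|)) => [|h]; first by rewrite lt_min dl0 subr_gt0.
rewrite lt_min => /andP[hd hc]; have := H h hd.
rewrite !gf// ?(ltW zc)//= (le_trans (ler_normD _ _))//.
by rewrite -lerBrDl ltW.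
Qed.

Variables (d : nat) (disp : measure_display) (S : measurableType disp).
Variables (P : probability S R) (phi : S -> 'rV[R]_d).
Hypothesis av : averaging P phi.
Local Notation moll := (moll P phi).

(** Being a limit of quotients of [moll] and not an average of [jac], it inherits measurability in a
    parameter of [f] directly from [moll]; see [mollJ_borel]. *)
Definition mollJ n (f : 'rV[R]_d -> 'rV[R]_n) (r : R) (y : 'rV[R]_d) : 'M[R]_(d, n) :=
  \matrix_(i, j) limn (fun k => quot (moll f r) (delta_mx 0 i) k y 0 j).

Lemma moll_local n (f g : 'rV[R]_d -> 'rV[R]_n) c r y :
  (forall x, `|x| <= c -> g x = f x) -> 0 <= r -> `|y| + r <= c -> moll g r y = moll f r y.
Proof.
have [_ phi1 _ _] := av.
move=> gf r0 yr; apply/rowP => j; rewrite !mxE; apply: eq_Rintegral => s _.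
rewrite gf// (le_trans (ler_normD _ _))// (le_trans _ yr)// lerD2l.
by rewrite normrZ ger0_norm// ler_piMr.
Qed.

Lemma mollifier n (f : 'rV[R]_d -> 'rV[R]_n) c : lip_bounded f -> 0 <= c ->
  exists2 K, 0 <= K & forall r, 0 < r -> r <= 1 ->
  [/\ forall y, `|y| <= c -> `|moll f r y - f y| <= K * r,
      forall y i j, `|y| <= c ->
        (fun k => quot (moll f r) (delta_mx 0 i) k y 0 j) @ \oo --> mollJ f r y i j,
      forall y y', `|y| <= c -> `|y'| <= c ->
        `|mollJ f r y - mollJ f r y'| <= K * (`|y - y'| / r),
      forall y w, `|y| <= c -> `|w| <= 1 ->
        `|moll f r (y + w) - moll f r y - w *m mollJ f r y| <= K * (`|w| ^+ 2 / r) &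
      forall Q q y, `|y| <= c ->
        (forall z A, `|z - y| <= r -> frechet f z A -> mdot Q A <= q) ->
        mdot Q (mollJ f r y) <= q].
Proof.
(* The radius [c + 3] leaves room for a displacement of norm at most 1 and for an averaging radius
   at most 1, so that [f] may be replaced by a globally Lipschitz extension. *)
move=> lf c0; have c30 : 0 <= c + 3 by rewrite addr_ge0.
have [g [L [L0 gL gf]]] := lip_bounded_extension lf c30.
have [C C0 HC] := moll_translation av gL.
have mE y r : `|y| <= c + 1 -> 0 < r -> r <= 1 -> moll g r y = moll f r y.
  by move=> yc r0 r1; apply: (moll_local gf); [exact: ltW|lra].
have qE y r w k : `|y| <= c -> `|w| <= 1 -> 0 < r -> r <= 1 ->
    quot (moll g r) w k y = quot (moll f r) w k y.
  move=> yc w1 r0 r1; rewrite /quot !mE//; first lra.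
  rewrite (le_trans (ler_normD _ _))// lerD// normrZ gtr0_norm ?invr_gt0//.
  by rewrite mulr_ile1// ?invr_ge0// invf_le1// ler1n.
have JE y r : `|y| <= c -> 0 < r -> r <= 1 ->
   (forall i j, (fun k => quot (moll f r) (delta_mx 0 i) k y 0 j) @ \oo --> mjac P phi g r y i j)
   /\ mollJ f r y = mjac P phi g r y.
  move=> yc r0 r1.
  have H i j : (fun k => quot (moll f r) (delta_mx 0 i) k y 0 j) @ \oo --> mjac P phi g r y i j.
    have H := @moll_quot_cvg _ _ _ _ _ _ av _ _ _ gL (delta_mx 0 i) r y r0.
    have -> : (fun k => quot (moll f r) (delta_mx 0 i) k y 0 j) =
        (fun k => quot (moll g r) (delta_mx 0 i) k y 0 j).
      by apply/funext => k; rewrite qE// delta_mx_norm.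
    rewrite -(delta_mul_entry (mjac P phi g r y)).
    exact: (cvg_comp _ (fun M : 'rV[R]_n => M 0 j) H (@coord_continuous _ _ _ _ _ _)).
  split => //; apply/matrixP => i j; rewrite mxE.
  by apply/cvg_lim; [exact: Rhausdorff|exact: H].
exists (L + C * L) => [|r r0 r1]; first by rewrite addr_ge0// mulr_ge0.
have LK : L <= L + C * L by rewrite lerDl mulr_ge0.
have CK : C * L <= L + C * L by rewrite lerDr.
split.
- move=> y yc; rewrite -mE//; last by rewrite ler_wpDr.
  rewrite -gf; last lra.
  by rewrite (le_trans (moll_dist av gL y (ltW r0)))// ger0_norm// ler_wpM2r// ltW.
- move=> y i j yc; have HE := JE y r yc r0 r1; rewrite (proj2 HE); exact: (proj1 HE i j).
- move=> y y' yc yc'; have [_ ->] := JE y r yc r0 r1; have [_ ->] := JE y' r yc' r0 r1.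
  rewrite (le_trans (mjac_lipschitz av gL L0 HC C0 y y' r0))//.
  by rewrite ler_wpM2r// divr_ge0// ltW.
- move=> y w yc w1; have [_ ->] := JE y r yc r0 r1.
  rewrite -!mE//; [|by rewrite ler_wpDr|by rewrite (le_trans (ler_normD _ _))// lerD].
  rewrite (le_trans (moll_taylor av gL L0 HC C0 y w r0))//.
  by rewrite ler_wpM2r// divr_ge0 ?sqr_ge0// ltW.
- move=> Q q y yc Hq; have [_ ->] := JE y r yc r0 r1.
  apply: (mjac_dot_le av gL r0) => z A zy gA; apply: (Hq z A zy).
  apply: (frechet_local gf) gA.
  have : `|z| <= `|z - y| + `|y| by rewrite (le_trans _ (ler_normD _ _))// subrK.
  lra.
Qed.

End locally_lipschitz.

(** * From local Lipschitz constants to constants on balls *)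

Section lipschitz_on_bounded_sets.
Context {R : realType}.

Lemma closed_ball_compact d (c : R) : compact [set x : 'rV[R]_d | `|x| <= c].
Proof.
apply: bounded_closed_compact.
  exists c; split; rewrite ?num_real// => M cM x /= xc.
  exact: le_trans xc (ltW cM).
rewrite (_ : [set x | _] = (fun x : 'rV[R]_d => `|x|) @^-1` [set x | x <= c])//.
by apply: (closed_comp _ (@closed_le _ _)) => x _; exact: norm_continuous.
Qed.

Definition locally_lipschitz d n (f : 'rV[R]_d -> 'rV[R]_n) := forall z, exists r, 0 < r /\
  exists L, forall y1 y2, `|y1 - z| < r -> `|y2 - z| < r -> `|f y1 - f y2| <= L * `|y1 - y2|.

Lemma locally_lipschitz_continuous d n (f : 'rV[R]_d -> 'rV[R]_n) :
  locally_lipschitz f -> continuous f.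
Proof.
move=> lf z; apply: (proj2 (@cvgrPdist_le _ _ _ (nbhs z) _ f (f z))) => e e0.
have [r [r0 [L fL]]] := lf z.
have L0 : 0 < `|L| + 1 by rewrite ltr_wpDl.
have r'0 : 0 < Num.min r (e / (`|L| + 1)) by rewrite lt_min r0 divr_gt0.
apply/nbhs_ballP; exists (Num.min r (e / (`|L| + 1))) => //= y.
rewrite -ball_normE/= lt_min => /andP[zr ze].
rewrite (le_trans (fL _ _ _ _)) ?subrr ?normr0//; first by rewrite distrC.
rewrite (@le_trans _ _ ((`|L| + 1) * `|z - y|))//.
  by rewrite ler_wpM2r// (le_trans (ler_norm _))// lerDl.
by rewrite -ler_pdivlMl// mulrC ltW.
Qed.

(** Compactness is applied to pairs of points: near a diagonal pair the local constant serves, and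
    near any other pair the increments of [f] are bounded while the distances stay away from 0. *)
Lemma locally_lipschitz_bounded d n (f : 'rV[R]_d -> 'rV[R]_n) :
  locally_lipschitz f -> lip_bounded f.
Proof.
move=> lf c; have cf := locally_lipschitz_continuous lf.
pose K := [set x : 'rV[R]_d | `|x| <= c].
have /compact_near_coveringP KK : compact (K `*` K).
  by apply: compact_setX; exact: closed_ball_compact.
have := KK R +oo%R (fun L (xy : 'rV[R]_d * 'rV[R]_d) =>
  `|f xy.1 - f xy.2| <= L * `|xy.1 - xy.2|) _.
case => [[a b] [/= Ka Kb]|L [Lr HL]]; last first.
  exists (L + 1) => x y xc yc.
  by apply: (HL (L + 1) _ (x, y)); rewrite ?ltrDl.
have [<-|ab] := eqVneq a b.
  have [r [r0 [L fL]]] := lf a.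
  exists ([set xy : 'rV[R]_d * 'rV[R]_d | `|xy.1 - a| < r /\ `|xy.2 - a| < r], [set M | L < M]).
    split => /=; last by exists L; rewrite num_real.
    exists (ball a r, ball a r) => /=; first by split; exact: nbhsx_ballx.
    by move=> [x y] [/=]; rewrite -!ball_normE/= !(distrC a).
  move=> [[x y] M] [/= [xr yr] LM]; rewrite (le_trans (fL _ _ _ _))//.
  by rewrite ler_wpM2r// ltW.
pose e := `|a - b| / 4; have e0 : 0 < e by rewrite divr_gt0// normr_gt0 subr_eq0.
have [/cvgrPdist_lt/(_ _ ltr01) fa /cvgrPdist_lt/(_ _ ltr01) fb] := (cf a, cf b).
pose L := (`|f a - f b| + 2) / e.
exists ([set xy : 'rV[R]_d * 'rV[R]_d | (`|a - xy.1| < e /\ `|f a - f xy.1| < 1) /\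
  (`|b - xy.2| < e /\ `|f b - f xy.2| < 1)], [set M | L < M]).
  split => /=; last by exists L; rewrite num_real.
  exists ([set x | `|a - x| < e /\ `|f a - f x| < 1], [set x | `|b - x| < e /\ `|f b - f x| < 1]) => //=.
  split; apply: filterI => //.
    by have := nbhsx_ballx a e e0; rewrite -ball_normE.
  by have := nbhsx_ballx b e e0; rewrite -ball_normE.
move=> [[x y] M] [/= [[xa fxa] [yb fyb]] LM].
have M0 : 0 <= M by rewrite (le_trans _ (ltW LM))// /L divr_ge0 ?addr_ge0// ltW.
have xy : e <= `|x - y|.
  have : `|a - b| <= `|a - x| + `|x - y| + `|b - y|.
    have -> : a - b = (a - x) + (x - y) - (b - y).
      by rewrite opprB !addrA subrK subrK.
    by rewrite (le_trans (ler_normB _ _))// lerD2r ler_normD.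
  have -> : `|a - b| = 4 * e by rewrite /e mulrC divfK.
  move=> ab4; rewrite -(lerD2l (e + e + e)).
  have -> : e + e + e + e = 4 * e by ring.
  rewrite (le_trans ab4)// addrAC lerD2r (le_trans (lerD (ltW xa) (ltW yb)))//.
  by rewrite lerDl ltW.
rewrite (@le_trans _ _ (M * e))// ?ler_wpM2l//.
have : `|f x - f y| <= `|f a - f b| + 2.
  have -> : f x - f y = (f a - f b) - (f a - f x) + (f b - f y).
    by apply/rowP => j; rewrite !mxE; ring.
  rewrite (le_trans (ler_normD _ _))//.
  have := ler_normB (f a - f b) (f a - f x); lra.
by move=> /le_trans; apply; rewrite -ler_pdivrMr// ltW.
Qed.

Lemma locally_lipschitz_vnorm d n (f : 'rV[R]_d -> 'rV[R]_n) :
  (forall z, exists r : R, 0 < r /\ exists L : R, forall y1 y2,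
     vnorm (y1 - z) < r -> vnorm (y2 - z) < r -> vnorm (f y1 - f y2) <= L * vnorm (y1 - y2)) ->
  locally_lipschitz f.
Proof.
move=> lf z; have [r [r0 [L fL]]] := lf z.
have d0 : 0 < (1 * d)%N%:R + 1 :> R by rewrite ltr_wpDl.
have vd (y : 'rV[R]_d) : `|y - z| < r / ((1 * d)%N%:R + 1) -> vnorm (y - z) < r.
  rewrite ltr_pdivlMr// mulrC; apply: le_lt_trans.
  by rewrite (le_trans (vnorm_mx_norm _))// ler_wpM2r// lerDl.
exists (r / ((1 * d)%N%:R + 1)); split; first by rewrite divr_gt0.
exists (`|L| * (1 * d)%N%:R) => y1 y2 /vd h1 /vd h2.
rewrite (le_trans (mx_norm_vnorm _))// (le_trans (fL _ _ h1 h2))//.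
rewrite (le_trans (ler_wpM2r (vnorm_ge0 _) (ler_norm L)))// -mulrA ler_wpM2l//.
exact: vnorm_mx_norm.
Qed.

End lipschitz_on_bounded_sets.

(** * Convexity and the Clarke Jacobian *)

Section inner_product.
Context {R : realType}.
Implicit Types m n : nat.

Lemma mdotC m n (A B : 'M[R]_(m, n)) : mdot A B = mdot B A.
Proof. by apply: eq_bigr => i _; apply: eq_bigr => j _; rewrite mulrC. Qed.

Lemma mdotDr m n (Q A B : 'M[R]_(m, n)) : mdot Q (A + B) = mdot Q A + mdot Q B.
Proof.
rewrite /mdot -big_split; apply: eq_bigr => i _; rewrite -big_split.
by apply: eq_bigr => j _; rewrite mxE mulrDr.
Qed.

Lemma mdotZr m n (Q A : 'M[R]_(m, n)) c : mdot Q (c *: A) = c * mdot Q A.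
Proof.
rewrite /mdot mulr_sumr; apply: eq_bigr => i _; rewrite mulr_sumr.
by apply: eq_bigr => j _; rewrite mxE mulrCA.
Qed.

Lemma mdotNr m n (Q A : 'M[R]_(m, n)) : mdot Q (- A) = - mdot Q A.
Proof. by rewrite -scaleN1r mdotZr mulN1r. Qed.

Lemma mdotBr m n (Q A B : 'M[R]_(m, n)) : mdot Q (A - B) = mdot Q A - mdot Q B.
Proof. by rewrite mdotDr mdotNr. Qed.

Lemma mdotDl m n (Q A B : 'M[R]_(m, n)) : mdot (A + B) Q = mdot A Q + mdot B Q.
Proof. by rewrite mdotC mdotDr !(mdotC Q). Qed.

Lemma mdotBl m n (Q A B : 'M[R]_(m, n)) : mdot (A - B) Q = mdot A Q - mdot B Q.
Proof. by rewrite mdotC mdotBr !(mdotC Q). Qed.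

Lemma mdotZl m n (Q A : 'M[R]_(m, n)) c : mdot (c *: A) Q = c * mdot A Q.
Proof. by rewrite mdotC mdotZr mdotC. Qed.

Definition msq m n (A : 'M[R]_(m, n)) : R := mdot A A.

Lemma msq_ge0 m n (A : 'M[R]_(m, n)) : 0 <= msq A.
Proof. by apply: sumr_ge0 => i _; apply: sumr_ge0 => j _; rewrite -expr2 sqr_ge0. Qed.

Lemma norm_msq m n (A : 'M[R]_(m, n)) : `|A| ^+ 2 <= msq A.
Proof.
rewrite -[leRHS]sqr_sqrtr ?msq_ge0// lerXn2r// ?nnegrE ?sqrtr_ge0//.
apply: mx_norm_le => [|i j]; first exact: sqrtr_ge0.
rewrite -sqrtr_sqr; apply: ler_wsqrtr.
rewrite /msq /mdot (bigD1 i)//= (bigD1 j)//= -expr2 -addrA lerDl addr_ge0//.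
  by apply: sumr_ge0 => *; rewrite -expr2 sqr_ge0.
by apply: sumr_ge0 => *; apply: sumr_ge0 => *; rewrite -expr2 sqr_ge0.
Qed.

Lemma mdot_le_norm m n (A B : 'M[R]_(m, n)) : `|mdot A B| <= (m * n)%:R * (`|A| * `|B|).
Proof.
rewrite (le_trans (ler_norm_sum _ _ _))//.
rewrite (@le_trans _ _ (\sum_(i < m) \sum_(j < n) `|A| * `|B|))//.
  apply: ler_sum => i _; rewrite (le_trans (ler_norm_sum _ _ _))//.
  by apply: ler_sum => j _; rewrite normrM ler_pM// mx_norm_entry.
by rewrite !sumr_const !card_ord -mulrnA -[leLHS]mulr_natl mulnC.
Qed.

Lemma msq_le_norm m n (A : 'M[R]_(m, n)) : msq A <= (m * n)%:R * `|A| ^+ 2.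
Proof. by rewrite (le_trans (ler_norm _))// (le_trans (mdot_le_norm _ _)). Qed.

Lemma msq_eq0 m n (A : 'M[R]_(m, n)) : msq A <= 0 -> A = 0.
Proof.
move=> A0; apply/eqP; rewrite -normr_eq0 -sqrf_eq0 eq_le sqr_ge0 andbT.
exact: le_trans (norm_msq A) A0.
Qed.

Lemma cvg_finite_sum (I : Type) (r : seq I) (f : I -> nat -> R) (l : I -> R) :
  (forall i, f i @ \oo --> l i) -> (fun k => \sum_(i <- r) f i k) @ \oo --> \sum_(i <- r) l i.
Proof.
move=> fl; elim: r => [|i r IH].
  by rewrite big_nil; under eq_fun do rewrite big_nil; exact: cvg_cst.
rewrite big_cons; under eq_fun do rewrite big_cons.
exact: (cvgD (fl i) IH).
Qed.

Lemma mdot_cvg m n (Q A : 'M[R]_(m, n)) (u : nat -> 'M[R]_(m, n)) :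
  u @ \oo --> A -> (fun k => mdot Q (u k)) @ \oo --> mdot Q A.
Proof.
move=> uA; apply: cvg_finite_sum => i; apply: cvg_finite_sum => j.
apply: cvgM; first exact: cvg_cst.
exact: (cvg_comp _ (fun M : 'M[R]_(m, n) => M i j) uA (@coord_continuous _ _ _ _ _ _)).
Qed.

Lemma msq_cvg m n (A G : 'M[R]_(m, n)) (u : nat -> 'M[R]_(m, n)) :
  u @ \oo --> A -> (fun k => msq (u k - G)) @ \oo --> msq (A - G).
Proof.
move=> uA; apply: cvg_finite_sum => i; apply: cvg_finite_sum => j.
have H : (fun k => (u k - G) i j) @ \oo --> (A - G) i j.
  apply: (cvg_comp _ (fun M : 'M[R]_(m, n) => M i j) _ (@coord_continuous _ _ _ _ _ _)).
  exact: (cvgB uA (cvg_cst _)).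
exact: cvgM.
Qed.

Lemma parallelogram m n (A B : 'M[R]_(m, n)) :
  msq (A - B) = 2 * msq A + 2 * msq B - 4 * msq (2^-1 *: (A + B)).
Proof.
rewrite /msq !(mdotBl, mdotBr, mdotDl, mdotDr, mdotZl, mdotZr) (mdotC B A).
by lra.
Qed.

End inner_product.

Section compactness.
Context {R : realType}.

Lemma mx_ball_compact m n (c : R) : compact [set A : 'M[R]_(m, n) | `|A| <= c].
Proof.
have vE (v : 'rV[R]_(m * n)) i j : (vec_mx v : 'M[R]_(m, n)) i j = v 0 (mxvec_index i j).
  by rewrite mxE.
have [c0|c0] := ltP c 0.
  rewrite (_ : [set A | _] = set0); first exact: compact0.
  by apply/seteqP; split => // A /= /(le_trans (normr_ge0 _)); rewrite leNgt c0.
rewrite (_ : [set A | _] = vec_mx @` [set v : 'rV[R]_(m * n) | `|v| <= c]).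
  apply: continuous_compact (@closed_ball_compact _ _ _).
  apply: continuous_subspaceT; apply: (@lipschitz_continuous _ _ _ _ 1) => v w.
  rewrite mul1r; apply: mx_norm_le => // i j.
  by rewrite mx_subE !vE -mx_subE mx_norm_entry.
apply/seteqP; split => [A /= Ac|_ [v /= vc <-]].
  exists (mxvec A); rewrite ?mxvecK//=; apply: mx_norm_le => // i j.
  case/mxvec_indexP: j => k l; rewrite ord1 mxvecE.
  exact: le_trans (mx_norm_entry _ _ _) Ac.
apply: mx_norm_le => // i j; rewrite vE.
exact: le_trans (mx_norm_entry _ _ _) vc.
Qed.

Lemma bounded_cluster_point m n (u : nat -> 'M[R]_(m, n)) c : (forall k, `|u k| <= c) ->
  exists A, forall e N, 0 < e -> exists2 k, (N <= k)%N & `|u k - A| < e.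
Proof.
move=> uc.
have uF : (u @ \oo) [set A | `|A| <= c] by exists 0%N => // k _; exact: uc.
have [A [_ clA]] := @mx_ball_compact m n c (u @ \oo) _ uF.
exists A => e N e0.
have uN : (u @ \oo) (u @` [set k | (N <= k)%N]) by exists N => // k /= Nk; exists k.
have [B [[k /= Nk <-]]] := clA _ _ uN (nbhsx_ballx A e e0).
by rewrite -ball_normE/= distrC; exists k.
Qed.

Lemma cluster_subsequence m n (u : nat -> 'M[R]_(m, n)) A :
  (forall e N, 0 < e -> exists2 k, (N <= k)%N & `|u k - A| < e) ->
  exists s : nat -> nat, (forall k, (k <= s k)%N) /\ (fun k => u (s k)) @ \oo --> A.
Proof.
move=> H; have H' k : exists l, (k <= l)%N /\ `|u l - A| < k.+1%:R^-1.
  by have [|l] := H k.+1%:R^-1 k; [rewrite invr_gt0|exists l].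
have [s Hs] := choice H'; exists s; split; first by move=> k; have [] := Hs k.
apply/cvgrPdist_lt => e e0; have [N Ne] := inv_nat_lt e0.
exists N => // k /= Nk; have [_] := Hs k; rewrite distrC => /lt_trans; apply.
by rewrite (le_lt_trans _ Ne)// lef_pV2 ?posrE// ler_nat.
Qed.

Lemma inv_nat_cvg0 (a : R) : (fun k : nat => a * k.+1%:R^-1) @ \oo --> (0 : R).
Proof.
rewrite -[X in _ --> X](mulr0 a); apply: cvgM; first exact: cvg_cst.
exact: cvg_harmonic.
Qed.

End compactness.

(** * Compactness of convex hulls *)

Section convex_hull.
Context {R : realType}.
Variables (m n : nat).
Local Notation V := 'M[R]_(m, n).
Implicit Types (L : set V) (A B M Q : V).

(** Convex combinations of [k + 1] points, formed one point at a time: each level is the continuous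
    image of a product of compact sets whenever [L] is compact. Caratheodory's theorem says that
    level [m * n] is the whole hull. *)
Fixpoint hull_of L k : set V := if k is k'.+1 then
  [set v | exists t a b, [/\ 0 <= t <= 1, L a, hull_of L k' b & v = t *: a + (1 - t) *: b]]
  else L.

Lemma hull_of_comb L k (c : 'I_k.+1 -> R) (a : 'I_k.+1 -> V) :
  (forall i, 0 <= c i) -> \sum_i c i = 1 -> (forall i, L (a i)) ->
  hull_of L k (\sum_i c i *: a i).
Proof.
elim: k c a => [|k IH] c a c0 c1 La.
  by move: c1; rewrite !big_ord1 => ->; rewrite scale1r.
rewrite big_ord_recl; set s := \sum_(i < k.+1) c (lift ord0 i).
have {}c1 : c ord0 + s = 1 by rewrite -c1 big_ord_recl.
have s0 : 0 <= s by exact: sumr_ge0.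
have sE : s = 1 - c ord0 by rewrite -c1 addrAC subrr add0r.
have c01 : 0 <= c ord0 <= 1 by rewrite c0/= -c1 lerDl.
have [se|sn] := eqVneq s 0.
  exists (c ord0), (a ord0), (\sum_i (i == ord0)%:R *: a (lift ord0 i)); split => //.
    apply: IH => //.
    by rewrite (bigD1 ord0)//= big1 ?addr0// => i /negbTE ->.
  rewrite -sE se scale0r big1// => i _.
  by move/psumr_eq0P : se => -> //; rewrite scale0r.
exists (c ord0), (a ord0), (\sum_i (s^-1 * c (lift ord0 i)) *: a (lift ord0 i)); split => //.
  apply: IH => // [i|]; first by rewrite mulr_ge0// invr_ge0.
  by rewrite -mulr_sumr mulVf.
rewrite -sE scaler_sumr; congr (_ + _); apply: eq_bigr => i _.
by rewrite scalerA mulrA mulfV// mul1r.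
Qed.

Lemma conv_hull_convex L A B t : 0 <= t <= 1 -> L A -> conv_hull L B ->
  conv_hull L (t *: A + (1 - t) *: B).
Proof.
move=> /andP[t0 t1] LA [k [c [a [c0 [c1 [La ->]]]]]].
exists k.+1, (fun i => if unlift ord0 i is Some j then (1 - t) * c j else t),
  (fun i => if unlift ord0 i is Some j then a j else A); split => [i|].
  by case: unlift => // j; rewrite mulr_ge0// subr_ge0.
rewrite !big_ord_recl !unlift_none; split.
  under eq_bigr do rewrite liftK.
  by rewrite -mulr_sumr c1 mulr1 addrC subrK.
split; first by move=> i; case: unlift.
under [in RHS]eq_bigr do rewrite liftK.
by rewrite scaler_sumr; congr (_ + _); apply: eq_bigr => i _; rewrite scalerA.
Qed.

Lemma sub_conv_hull L A : L A -> conv_hull L A.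
Proof.
move=> LA; exists 1%N, (fun=> 1), (fun=> A); split => //.
by rewrite !big_ord1 scale1r.
Qed.

Lemma hull_of_conv L k : hull_of L k `<=` conv_hull L.
Proof.
elim: k => [|k IH] A; first exact: sub_conv_hull.
by move=> [t [a [b [t01 La /IH Hb ->]]]]; exact: conv_hull_convex.
Qed.

Lemma hull_of_le L k l : (k <= l)%N -> hull_of L k `<=` hull_of L l.
Proof.
have L0 j A : hull_of L j A -> exists a, L a.
  by case: j => [|j]; [exists A|move=> [t [a [b [_ La _ _]]]]; exists a].
move=> /subnKC <-; elim: (l - k)%N => [|j IH]; first by rewrite addn0.
rewrite addnS => A /IH kA; have [a La] := L0 _ _ kA.
exists 0, a, A; split => //; first by rewrite lexx ler01.
by rewrite scale0r subr0 scale1r add0r.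
Qed.

(* Caratheodory: an affine dependence among more than [m * n + 1] points lets one
   coefficient of a convex combination vanish. *)
Lemma caratheodory_step L k (c : 'I_k.+1 -> R) (a : 'I_k.+1 -> V) :
  (m * n + 1 < k.+1)%N ->
  (forall i, 0 <= c i) -> \sum_i c i = 1 -> (forall i, L (a i)) ->
  exists (c' : 'I_k -> R) (a' : 'I_k -> V), [/\ (forall i, 0 <= c' i), \sum_i c' i = 1,
    (forall i, L (a' i)) & \sum_i c i *: a i = \sum_i c' i *: a' i].
Proof.
move=> kmn c0 c1 La.
(* Appending a 1 to each point turns a left kernel vector [u] into an affine dependence: [u] has sum
   0 and so has the combination of the points. *)
pose B : 'M[R]_(k.+1, m * n + 1) := \matrix_i row_mx (mxvec (a i)) 1.
have : kermx B != 0.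
  rewrite kermx_eq0 /row_free neq_ltn; apply/orP; left.
  exact: leq_ltn_trans (rank_leq_col _) kmn.
move=> /rowV0Pn[u /sub_kermxP uB u0].
have uE : row_mx (\sum_i u 0 i *: mxvec (a i)) (\sum_i u 0 i *: 1) = 0 :> 'rV[R]_(m * n + 1).
  rewrite -uB mulmx_sum_row; under [RHS]eq_bigr do rewrite rowK scale_row_mx.
  elim/big_rec3: _ => [|i y1 y2 y3 _ <-]; first by rewrite row_mx0.
  by rewrite add_row_mx.
have {uE} [ua us] : \sum_i u 0 i *: a i = 0 /\ \sum_i u 0 i = 0.
  move: uE; rewrite -row_mx0 => /eq_row_mx[ua us]; split.
    apply: (can_inj mxvecK); rewrite linear_sum linear0 -[RHS]ua.
    by apply: eq_bigr => i _; rewrite linearZ.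
  move/rowP : us => /(_ 0); rewrite summxE mxE => us; rewrite -[RHS]us.
  by apply: eq_bigr => i _; rewrite !mxE mulr1.
have [i0 ui0] : exists i, 0 < u 0 i.
  apply: contrapT => nu; move/negP : u0; apply; apply/eqP/rowP => i; rewrite mxE.
  have un j : 0 <= - u 0 j by rewrite oppr_ge0 leNgt; apply/negP => uj; apply: nu; exists j.
  have : \sum_j - u 0 j = 0 by rewrite sumrN us oppr0.
  by move/psumr_eq0P => /(_ (fun j _ => un j) i isT) /eqP; rewrite oppr_eq0 => /eqP.
(* The least ratio [c i / u i] over positive [u i] is the largest multiple of [u] that can be
   subtracted from [c] while all coefficients stay nonnegative; the coefficient at [l] vanishes. *)
case: (@arg_minP _ _ _ i0 (fun i => 0 < u 0 i) (fun i => c i / u 0 i) ui0) => l ul lmin.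
pose c' i := c i - (c l / u 0 l) * u 0 i.
have c'l : c' l = 0 by rewrite /c' divfK ?subrr// gt_eqF.
have c'0 i : 0 <= c' i.
  rewrite subr_ge0; have [ui|ui] := ltP 0 (u 0 i).
    by rewrite -ler_pdivlMr//; exact: lmin.
  by rewrite (le_trans _ (c0 i))// mulr_ge0_le0// divr_ge0// ltW.
have c'1 : \sum_i c' i = 1 by rewrite sumrB c1 -mulr_sumr us mulr0 subr0.
exists (fun i => c' (lift l i)), (fun i => a (lift l i)); split => //.
  by move: c'1; rewrite (bigD1_ord l)//= c'l add0r.
have -> : \sum_i c i *: a i = \sum_i c' i *: a i.
  under [RHS]eq_bigr do rewrite /c' scalerBl -scalerA.
  by rewrite sumrB -scaler_sumr ua scaler0 subr0.
by rewrite (bigD1_ord l)//= c'l scale0r add0r.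
Qed.

Lemma conv_hull_hull_of L : conv_hull L = hull_of L (m * n).
Proof.
apply/seteqP; split; last exact: hull_of_conv.
move=> _ [k [c [a [c0 [c1 [La ->]]]]]].
elim: k c a c0 c1 La => [|k IH] c a c0 c1 La.
  by move: c1; rewrite big_ord0 => /eqP; rewrite eq_sym oner_eq0.
have [kmn|kmn] := ltnP (m * n + 1) k.+1.
  by have [c' [a' [c'0 c'1 La' ->]]] := caratheodory_step kmn c0 c1 La; exact: IH.
apply: (@hull_of_le _ k); first by rewrite addn1 in kmn.
exact: hull_of_comb.
Qed.

Lemma hull_of_compact L k : compact L -> compact (hull_of L k).
Proof.
move=> cL; elim: k => [//|k IH].
pose F (x : R * (V * V)) : V := x.1 *: x.2.1 + (1 - x.1) *: x.2.2.
have -> : hull_of L k.+1 = F @` (`[0, 1]%classic `*` (L `*` hull_of L k)).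
  apply/seteqP; split => [v [t [a [b [t01 La Hb ->]]]]|_ [[t [a b]] [/= t01 [/= La Hb]] <-]].
    by exists (t, (a, b)) => //=; rewrite in_itv.
  by exists t, a, b; split => //; move: t01; rewrite /= in_itv.
apply: continuous_compact; last first.
  by apply: compact_setX; [exact: segment_compact|exact: compact_setX].
apply: continuous_subspaceT => -[t [a b]].
have c1 : (fun x : R * (V * V) => x.1) @ nbhs (t, (a, b)) --> t by exact: cvg_fst.
have c2 : (fun x : R * (V * V) => x.2) @ nbhs (t, (a, b)) --> (a, b) by exact: cvg_snd.
have c3 : (fun x : R * (V * V) => x.2.1) @ nbhs (t, (a, b)) --> a.
  by apply: (cvg_comp _ (fun y : V * V => y.1) c2); exact: cvg_fst.
have c4 : (fun x : R * (V * V) => x.2.2) @ nbhs (t, (a, b)) --> b.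
  by apply: (cvg_comp _ (fun y : V * V => y.2) c2); exact: cvg_snd.
have H := cvgD (cvgZ c1 c3) (cvgZ (cvgB (cvg_cst (1 : R)) c1) c4).
exact: H.
Qed.

Lemma conv_hull_compact L : compact L -> compact (conv_hull L).
Proof. by rewrite conv_hull_hull_of; exact: hull_of_compact. Qed.

End convex_hull.

(** * Projection onto convex sets *)

Section projection.
Context {R : realType}.
Variables (m n : nat).
Local Notation V := 'M[R]_(m, n).

Lemma near_minimizer (S : set V) (G : V) e : S !=set0 -> 0 < e ->
  exists2 A, S A & forall B, S B -> msq (A - G) <= msq (B - G) + e.
Proof.
move=> [A0 SA0] e0; pose E := [set msq (B - G) | B in S].
have iE : has_inf E.
  by split; [exists (msq (A0 - G)), A0|exists 0 => _ [B _ <-]; exact: msq_ge0].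
have [_ [A SA <-] Ae] := inf_adherent e0 iE.
exists A => // B SB; rewrite (le_trans (ltW Ae))// lerD2r.
by apply: ge_inf; [exact: iE.2|exists B].
Qed.

(* Almost minimizers over decreasing midpoint-convex sets form a Cauchy sequence, by the
   parallelogram identity. *)
Lemma near_minimizers_cvg (S : nat -> set V) (A : nat -> V) (G : V) b :
  (forall i j, (i <= j)%N -> S j `<=` S i) ->
  (forall i B C, S i B -> S i C -> S i (2^-1 *: (B + C))) ->
  (forall i, S i (A i)) ->
  (forall i B, S i B -> msq (A i - G) <= msq (B - G) + i.+1%:R^-1) ->
  (forall i, msq (A i - G) <= b) ->
  exists M : V, A @ \oo --> M.
Proof.
move=> Sd Sm SA Amin Ab; pose a i := msq (A i - G).
have Sij i j : (i <= j)%N -> S i (A j) by move=> ij; exact: Sd (SA j).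
pose E := range (fun i => a i - i.+1%:R^-1).
have sE : has_sup E.
  split; first by exists (a 0%N - 1%:R^-1), 0%N.
  exists b => _ [i _ <-]; rewrite (le_trans _ (Ab i))// gerBl invr_ge0.
  by [].
have aub i : a i <= sup E + i.+1%:R^-1.
  by rewrite -lerBlDr; apply: ub_le_sup; [exact: sE.2|exists i].
apply: mx_cauchy_cvg => e e0.
have e80 : 0 < e ^+ 2 / 16 by rewrite divr_gt0// exprn_gt0.
have [_ [i0 _ <-] Hi0] := sup_adherent e80 sE.
have [N Ne] := inv_nat_lt e80.
have main i j : (maxn i0 N <= i)%N -> (i <= j)%N -> `|A i - A j| <= e.
  rewrite geq_max => /andP[ii0 iN] ij.
  rewrite -(@ler_pXn2r _ 2)// ?nnegrE//; last exact: ltW.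
  rewrite (le_trans (norm_msq _))//.
  have iinv : i.+1%:R^-1 < e ^+ 2 / 16.
    by rewrite (le_lt_trans _ Ne)// lef_pV2 ?posrE// ler_nat.
  have jinv : j.+1%:R^-1 < e ^+ 2 / 16.
    by rewrite (le_lt_trans _ Ne)// lef_pV2 ?posrE// ler_nat ltnS (leq_trans iN).
  have -> : A i - A j = (A i - G) - (A j - G) by rewrite opprB addrA subrK.
  rewrite parallelogram.
  have -> : 2^-1 *: (A i - G + (A j - G)) = 2^-1 *: (A i + A j) - G.
    by apply/matrixP => k l; rewrite !mxE; lra.
  have := Amin i _ (Sm i _ _ (SA i) (Sij _ _ ij)).
  have H0 := Amin i0 _ (Sij _ _ ii0).
  have := aub j; move: e80 jinv iinv Hi0 H0; rewrite /a.
  move: (i.+1%:R^-1) (j.+1%:R^-1) (i0.+1%:R^-1) (e ^+ 2) (sup E) => x1 x2 x3 x4 x5.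
  move: (msq (A i - G)) (msq (A j - G)) (msq (A i0 - G)) (msq _) => y1 y2 y3 y4.
  lra.
exists (maxn i0 N) => i j iN jN; have [ij|/ltnW ji] := leqP i j; first exact: main.
by rewrite distrC; exact: main.
Qed.

Lemma convex_projection (C : set V) M : C !=set0 -> closed C ->
  (forall A B t, 0 <= t <= 1 -> C A -> C B -> C (t *: A + (1 - t) *: B)) ->
  exists2 P, C P & forall A, C A -> mdot (M - P) A <= mdot (M - P) P.
Proof.
move=> C0 cC conv.
have i0 i : 0 < i.+1%:R^-1 :> R by rewrite invr_gt0.
have near i : exists A, C A /\ forall B, C B -> msq (A - M) <= msq (B - M) + i.+1%:R^-1.
  by have [A ? ?] := near_minimizer M C0 (i0 i); exists A.
have [A HA] := choice near; have [B0 CB0] := C0.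
have [P AP] : exists P : V, A @ \oo --> P.
  apply: (@near_minimizers_cvg (fun=> C) A M (msq (B0 - M) + 1)).
  - by move=> i j _ B.
  - move=> i B B' CB CB'; have -> : 2^-1 *: (B + B') = 2^-1 *: B + (1 - 2^-1) *: B'.
      by apply/matrixP => k l; rewrite !mxE; lra.
    by apply: conv => //; apply/andP; split; lra.
  - by move=> i; have [] := HA i.
  - by move=> i; have [_] := HA i.
  - move=> i; have [_ /(_ _ CB0)/le_trans] := HA i; apply.
    by rewrite lerD2l invf_le1// ler1n.
have CP : C P by apply: (closed_cvg _ cC _ _ AP); apply: nearW => i; have [] := HA i.
have Pmin B : C B -> msq (P - M) <= msq (B - M).
  move=> CB; have H1 := msq_cvg (G := M) AP.
  have H2 : (fun i : nat => msq (B - M) + 1 * i.+1%:R^-1) @ \oo --> msq (B - M) + 0.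
    exact: (cvgD (cvg_cst _) (inv_nat_cvg0 1)).
  rewrite addr0 in H2; apply: (ler_cvg_to H1 H2); apply: nearW => i.
  by have [_ /(_ _ CB)] := HA i; rewrite mul1r.
exists P => // B CB; rewrite leNgt; apply/negP => lt.
set x := mdot (M - P) B - mdot (M - P) P; have x0 : 0 < x by rewrite subr_gt0.
set y := msq (B - P); have y0 : 0 <= y by exact: msq_ge0.
have yx : 0 < y + x by rewrite ltr_wpDl.
(* This step lies in [[0, 1]] and satisfies [t * y <= x], also when [y = 0]; hence
   [t ^ 2 * y - 2 * t * x] is negative and the move from [P] towards [B] would decrease the distance
   to [M]. *)
pose t := x / (y + x).
have t01 : 0 <= t <= 1.
  by rewrite /t divr_ge0 ?(ltW x0) ?(ltW yx)//= ler_pdivrMr// mul1r lerDr.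
have := Pmin _ (conv B P t t01 CB CP).
have -> : t *: B + (1 - t) *: P - M = t *: (B - P) - (M - P).
  by apply/matrixP => k l; rewrite !mxE; ring.
have -> : P - M = - (M - P) by rewrite opprB.
have -> : msq (t *: (B - P) - (M - P)) = t ^+ 2 * y - 2 * t * x + msq (M - P).
  rewrite /msq !(mdotBl, mdotBr, mdotZl, mdotZr) /x /y /msq !(mdotBl, mdotBr, mdotDl, mdotDr).
  by rewrite (mdotC B P) (mdotC B M) (mdotC P M); ring.
have -> : msq (- (M - P)) = msq (M - P) by rewrite /msq -scaleN1r mdotZl mdotZr; lra.
have : t * y <= x.
  by rewrite /t mulrAC ler_pdivrMr// ler_wpM2l ?(ltW x0)// lerDl ltW.
have t0 : 0 < t by rewrite divr_gt0.
move=> ty le0; have : t ^+ 2 * y <= t * x by rewrite expr2 -mulrA ler_pM2l.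
have : 0 < t * x by rewrite mulr_gt0.
move: le0; rewrite -mulrA; move: (t ^+ 2 * y) (t * x) (msq _) => z1 z2 z3; lra.
Qed.

End projection.

(** * The Clarke Jacobian through its support function *)

Section clarke.
Context {R : realType}.
Variables (d n : nat) (f : 'rV[R]_d -> 'rV[R]_n).
Hypothesis lf : lip_bounded f.

Lemma frechet_bound c L z A : 0 <= L ->
  (forall x y, `|x| <= c -> `|y| <= c -> `|f x - f y| <= L * `|x - y|) ->
  `|z| < c -> frechet f z A -> `|A| <= L.
Proof.
move=> L0 fL zc fA; apply: mx_norm_le => // i j.
have H := @frechet_quot R d n f z A (delta_mx 0 i) fA; rewrite -rowE in H.
have : (fun k => quot f (delta_mx 0 i) k z 0 j) @ \oo --> A i j.
  have -> : A i j = (row i A) 0 j by rewrite mxE.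
  exact: (cvg_comp _ (fun M : 'rV[R]_n => M 0 j) H (@coord_continuous _ _ _ _ _ _)).
move=> /cvg_norm Hn; apply: (cvgr_to_le Hn).
have : 0 < c - `|z| by rewrite subr_gt0.
move=> /inv_nat_lt[N HN]; exists N => // k /= Nk.
rewrite (le_trans (mx_norm_entry _ _ _))// /quot normrZ gtr0_norm// -ler_pdivlMl//.
have k0 : 0 < k.+1%:R^-1 :> R by rewrite invr_gt0.
have kn : `|k.+1%:R^-1 *: (delta_mx 0 i : 'rV[R]_d)| <= k.+1%:R^-1.
  by rewrite normrZ gtr0_norm// ler_piMr ?(ltW k0)// delta_mx_norm.
have kc : k.+1%:R^-1 < c - `|z|.
  by apply: le_lt_trans HN; rewrite lef_pV2 ?posrE// ler_nat.
have zk : `|z + k.+1%:R^-1 *: (delta_mx 0 i : 'rV[R]_d)| <= c.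
  by rewrite (le_trans (ler_normD _ _))// -lerBrDl (le_trans kn)// ltW.
rewrite (le_trans (fL _ _ zk (ltW zc)))//.
by rewrite addrAC subrr add0r mulrC ler_wpM2r.
Qed.

Lemma clarke_limitsP y J : clarke_limits f y J <->
  forall e, 0 < e -> exists z A, [/\ `|z - y| < e, frechet f z A & `|A - J| < e].
Proof.
split=> [[zs [dz [zy zJ]]] e e0|H].
  have /cvgrPdist_lt/(_ e e0)[N1 _ H1] := zy.
  have /cvgrPdist_lt/(_ e e0)[N2 _ H2] := zJ.
  exists (zs (maxn N1 N2)), ('J f (zs (maxn N1 N2))); split.
  - by rewrite distrC; apply: H1; exact: leq_maxl.
  - exact: differentiable_frechet.
  - by rewrite distrC; apply: H2; exact: leq_maxr.
have H' k : exists zA : 'rV[R]_d * 'M[R]_(d, n),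
    [/\ `|zA.1 - y| < k.+1%:R^-1, frechet f zA.1 zA.2 & `|zA.2 - J| < k.+1%:R^-1].
  by have [|z [A HA]] := H k.+1%:R^-1; [rewrite invr_gt0|exists (z, A)].
have [s Hs] := choice H'; exists (fun k => (s k).1); split => [k|].
  by have [_ /frechet_differentiable[]] := Hs k.
have JE : (fun k => 'J f (s k).1) = (fun k => (s k).2).
  by apply/funext => k; have [_ /frechet_differentiable[]] := Hs k.
rewrite JE; split; apply/cvgrPdist_lt => e e0; have [N Ne] := inv_nat_lt e0.
  exists N => // k /= Nk; have [+ _ _] := Hs k; rewrite distrC => /lt_trans; apply.
  by rewrite (le_lt_trans _ Ne)// lef_pV2 ?posrE// ler_nat.
exists N => // k /= Nk; have [_ _] := Hs k; rewrite distrC => /lt_trans; apply.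
by rewrite (le_lt_trans _ Ne)// lef_pV2 ?posrE// ler_nat.
Qed.

Lemma frechet_clarke z A : frechet f z A -> clarke_jac f z A.
Proof.
move=> fA; apply: sub_conv_hull; apply/clarke_limitsP => e e0; exists z, A.
by rewrite !subrr !normr0.
Qed.

Lemma clarke_limits_compact y : compact (clarke_limits f y).
Proof.
have [L fL] := lf (`|y| + 2).
apply: (subclosed_compact _ (@mx_ball_compact R d n (`|L| + 1))); last first.
  move=> J /clarke_limitsP/(_ 1 ltr01)[z [A [zy fA AJ]]].
  have zc : `|z| < `|y| + 2.
    rewrite -(subrK y z) addrC (le_lt_trans (ler_normD _ _))// ltrD2l.
    by rewrite (lt_trans zy)// ltr1n.
  have AL : `|A| <= `|L|.
    apply: (frechet_bound _ _ zc fA) => // x x' xc xc'.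
    by rewrite (le_trans (fL _ _ xc xc'))// ler_wpM2r// ler_norm.
  rewrite /= -(subrK A J) (le_trans (ler_normD _ _))// addrC lerD// distrC.
  exact: ltW.
move=> J clJ; apply/clarke_limitsP => e e0; have e20 : 0 < e / 2 by rewrite divr_gt0.
have [J' []] := clJ _ (nbhsx_ballx J _ e20); rewrite -ball_normE/=.
move=> /clarke_limitsP/(_ _ e20)[z [A [zy fA AJ']]] JJ'.
exists z, A; split => //; first by rewrite (lt_trans zy)//; lra.
rewrite -(subrK J' A) -addrA (le_lt_trans (ler_normD _ _))// (splitr e) ltrD//.
by rewrite distrC.
Qed.

Lemma clarke_jac_convex y A B t : 0 <= t <= 1 -> clarke_jac f y A -> clarke_jac f y B ->
  clarke_jac f y (t *: A + (1 - t) *: B).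
Proof.
move=> /andP[t0 t1] [k [c [a [c0 [c1 [La ->]]]]]] [l [c' [a' [c'0 [c'1 [La' ->]]]]]].
exists (k + l)%N, (fun i => match fintype.split i with inl j => t * c j | inr j => (1 - t) * c' j end),
  (fun i => match fintype.split i with inl j => a j | inr j => a' j end).
split=> [i|]; first by case: fintype.split => j; rewrite mulr_ge0// subr_ge0.
rewrite !big_split_ord/=.
split.
  under eq_bigr do rewrite (unsplitK (inl _)).
  under [X in _ + X]eq_bigr do rewrite (unsplitK (inr _)).
  by rewrite -!mulr_sumr c1 c'1 !mulr1 addrC subrK.
split; first by move=> i; case: fintype.split.
under [in RHS]eq_bigr do rewrite (unsplitK (inl _)) -scalerA.
under [X in _ = _ + X]eq_bigr do rewrite (unsplitK (inr _)) -scalerA.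
by rewrite -!scaler_sumr.
Qed.

(** Separation by projection: let [P] be the point of the compact convex Clarke Jacobian nearest to
    [M], and [Q = M - P]. By compactness some limiting Jacobian [A] has [mdot Q M <= mdot Q A],
    while [mdot Q A <= mdot Q P] by the choice of [P]; so [msq Q <= 0]. *)
Lemma clarke_jac_support y M :
  (forall Q q e, 0 < e -> (forall z A, `|z - y| <= e -> frechet f z A -> mdot Q A <= q) ->
     mdot Q M <= q) ->
  clarke_jac f y M.
Proof.
move=> H.
have supp Q : exists2 A, clarke_limits f y A & mdot Q M <= mdot Q A.
  have Hk k : exists zA : 'rV[R]_d * 'M[R]_(d, n), [/\ `|zA.1 - y| <= k.+1%:R^-1,
      frechet f zA.1 zA.2 & mdot Q M - k.+1%:R^-1 <= mdot Q zA.2].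
    have k0 : 0 < k.+1%:R^-1 :> R by rewrite invr_gt0.
    (* Otherwise all derivatives within [1 / (k + 1)] of [y] would satisfy the inequality with bound
       [mdot Q M - 1 / (k + 1)], and the hypothesis would impose it on [M]. *)
    apply: contrapT => nH; have := H Q (mdot Q M - k.+1%:R^-1) _ k0.
    rewrite lerBrDr gerDl leNgt k0 => /(_ _)/negP; apply => // z A zk fA.
    by rewrite leNgt; apply/negP => lt; apply: nH; exists (z, A); split => //; exact: ltW.
  have [s Hs] := choice Hk.
  have [L fL] := lf (`|y| + 2).
  have sb k : `|(s k).2| <= `|L|.
    have [zk fk _] := Hs k; apply: (@frechet_bound (`|y| + 2) _ _ _ _ _ _ fk) => //.
    - by move=> x x' xc xc'; rewrite (le_trans (fL _ _ xc xc'))// ler_wpM2r// ler_norm.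
    - rewrite -(subrK y (s k).1) addrC (le_lt_trans (ler_normD _ _))// ltrD2l.
      by rewrite (le_lt_trans zk)// (@le_lt_trans _ _ 1)// ?ltr1n// invf_le1// ler1n.
  have [A clA] := bounded_cluster_point sb.
  exists A.
    apply/clarke_limitsP => e e0; have [N Ne] := inv_nat_lt e0.
    have [k Nk kA] := clA e N e0; have [zk fk _] := Hs k.
    exists (s k).1, (s k).2; split => //; apply: le_lt_trans zk _.
    by rewrite (le_lt_trans _ Ne)// lef_pV2 ?posrE// ler_nat.
  have [sub [subk subA]] := cluster_subsequence clA.
  have H1 := mdot_cvg (Q := Q) subA.
  have H2 : (fun k : nat => mdot Q M - 1 * k.+1%:R^-1) @ \oo --> mdot Q M - 0.
    exact: (cvgB (cvg_cst _) (inv_nat_cvg0 1)).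
  rewrite subr0 in H2; apply: (ler_cvg_to H2 H1); apply: nearW => k.
  have [_ _] := Hs (sub k); rewrite mul1r; apply: le_trans.
  by rewrite lerD2l lerN2 lef_pV2 ?posrE// ler_nat ltnS subk.
have C0 : clarke_jac f y !=set0 by have [A LA _] := supp 0; exists A; exact: sub_conv_hull.
have cC : closed (clarke_jac f y).
  apply: compact_closed; first exact: norm_hausdorff.
  by apply: conv_hull_compact; exact: clarke_limits_compact.
have [P CP HP] := convex_projection M C0 cC (fun A B t => @clarke_jac_convex y A B t).
have [A LA MA] := supp (M - P).
have := HP A (sub_conv_hull LA) => AP.
suff -> : M = P by [].
apply/eqP; rewrite -subr_eq0; apply/eqP/msq_eq0.
by rewrite /msq mdotBr subr_le0 (le_trans MA).
Qed.

End clarke.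

(** * Averaged Jacobians *)

(** Iterated midpoints give a countable substitute for the convex hull: closed under midpoints,
    which is all the convexity that the projection argument uses, and fitted to the bisection of
    segments. *)
Inductive bintree (I : Type) := Leaf of I | Node of bintree I & bintree I.

Fixpoint bintree_encode I (t : bintree I) : GenTree.tree I := match t with
  | Leaf i => GenTree.Leaf i
  | Node l r => GenTree.Node 0 [:: bintree_encode l; bintree_encode r] end.

Fixpoint bintree_decode I (g : GenTree.tree I) : option (bintree I) := match g with
  | GenTree.Leaf i => Some (Leaf i)
  | GenTree.Node _ [:: l; r] => match bintree_decode l, bintree_decode r with
    | Some l', Some r' => Some (Node l' r') | _, _ => None end
  | _ => None end.

Lemma bintree_encodeK I : pcancel (@bintree_encode I) (@bintree_decode I).
Proof. by elim => [//|l IHl r IHr] /=; rewrite IHl IHr. Qed.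

HB.instance Definition _ (I : countType) :=
  Countable.copy (bintree I) (pcan_type (@bintree_encodeK I)).

Section midpoint_family.
Context {R : realType}.
Variables (d n : nat) (disp : measure_display) (S : measurableType disp).
Variables (P : probability S R) (phi : S -> 'rV[R]_d).
Hypothesis av : averaging P phi.
Local Notation mollJ := (mollJ P phi).
Local Notation moll := (moll P phi).

(* An index [(j, rho)] stands for the averaged Jacobian at scale [1 / (j + 1)] around the
   rational translate by [rho] of the base point. *)
Definition node_index : countType := (nat * 'rV[rat]_d)%type.

Definition valid (m : nat) (i : node_index) :=
  (m <= i.1)%N && (`|map_mx ratr i.2 : 'rV[R]_d| <= m.+1%:R^-1).

(** Redirecting invalid indices lets one index type serve all levels. Since an index valid at a
    finer level is valid at a coarser one, the families decrease with [m]. *)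
Definition normalize m (i : node_index) : node_index := if valid m i then i else (m, 0).

Lemma normalize_valid m i : valid m (normalize m i).
Proof.
rewrite /normalize; case: ifPn => // _; rewrite /valid leqnn/= map_mx0 normr0.
by rewrite invr_ge0.
Qed.

Lemma normalize_id m i : valid m i -> normalize m i = i.
Proof. by rewrite /normalize => ->. Qed.

Lemma valid_le m k i : (m <= k)%N -> valid k i -> valid m i.
Proof.
move=> mk /andP[ki ik]; rewrite /valid (leq_trans mk ki)/= (le_trans ik)//.
by rewrite lef_pV2 ?posrE// ler_nat.
Qed.

Fixpoint fam (f : 'rV[R]_d -> 'rV[R]_n) y m (t : bintree node_index) : 'M[R]_(d, n) :=
  match t with
  | Leaf i => let i' := normalize m i in mollJ f i'.1.+1%:R^-1 (y + map_mx ratr i'.2)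
  | Node l r => 2^-1 *: (fam f y m l + fam f y m r) end.

Fixpoint tree_normalize m (t : bintree node_index) := match t with
  | Leaf i => Leaf (normalize m i)
  | Node l r => Node (tree_normalize m l) (tree_normalize m r) end.

Lemma fam_nested f y m k t : (m <= k)%N -> fam f y k t = fam f y m (tree_normalize k t).
Proof.
move=> mk; elim: t => [i|l IHl r IHr] /=; last by rewrite IHl IHr.
by rewrite (@normalize_id m)//; exact: valid_le mk (normalize_valid _ _).
Qed.

Variable f : 'rV[R]_d -> 'rV[R]_n.
Hypothesis lf : lip_bounded f.

Lemma mollJ_support Q q r y : 0 < r -> r <= 1 ->
  (forall z A, `|z - y| <= r -> frechet f z A -> mdot Q A <= q) -> mdot Q (mollJ f r y) <= q.
Proof.
move=> r0 r1; have [K _ HK] := mollifier av lf (normr_ge0 y).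
by have [_ _ _ _ H] := HK r r0 r1; exact: H.
Qed.

(** The rational translate and the averaging radius contribute at most [1 / (m + 1)] each to the
    radius, and midpoints preserve a linear inequality. *)
Lemma fam_support y m t Q q :
  (forall z A, `|z - y| <= 2 * m.+1%:R^-1 -> frechet f z A -> mdot Q A <= q) ->
  mdot Q (fam f y m t) <= q.
Proof.
move=> HQ; elim: t => [i|l IHl r IHr] /=; last first.
  by rewrite mdotZr mdotDr; move: IHl IHr; lra.
have /andP[im iy] := normalize_valid m i.
apply: mollJ_support => [||z A zr fA]; rewrite ?invr_gt0 ?invf_le1 ?ler1n//.
apply: (HQ z A) => //.
have -> : z - y = (z - (y + map_mx ratr (normalize m i).2)) + map_mx ratr (normalize m i).2.
  by rewrite opprD addrA subrK.
rewrite (le_trans (ler_normD _ _))// mulr_natl mulr2n lerD// (le_trans zr)//.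
by rewrite lef_pV2 ?posrE// ler_nat.
Qed.

Lemma mdot_delta i j (A : 'M[R]_(d, n)) : mdot (delta_mx i j) A = A i j.
Proof.
rewrite /mdot (bigD1 i)//= (bigD1 j)//= !mxE !eqxx mul1r !big1 ?addr0//.
  by move=> i' ii'; rewrite big1// => j' _; rewrite mxE (negbTE ii') mul0r.
by move=> j' jj'; rewrite mxE (negbTE jj') andbF mul0r.
Qed.

Lemma fam_bound y m t b : 0 <= b ->
  (forall z A, `|z - y| <= 2 * m.+1%:R^-1 -> frechet f z A -> `|A| <= b) -> `|fam f y m t| <= b.
Proof.
move=> b0 Hb; apply: mx_norm_le => // i j; rewrite ler_norml; apply/andP; split.
  have : mdot (- 1 *: delta_mx i j) (fam f y m t) <= b.
    apply: fam_support => z A zy fA; rewrite mdotZl mdot_delta mulN1r.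
    have := le_trans (mx_norm_entry _ i j) (Hb z A zy fA).
    by rewrite ler_norml => /andP[]; rewrite lerNl.
  by rewrite mdotZl mdot_delta mulN1r lerNl.
rewrite -mdot_delta; apply: fam_support => z A zy fA; rewrite mdot_delta.
by rewrite (le_trans (ler_norm _))// (le_trans (mx_norm_entry _ i j))// (Hb z).
Qed.

(** At a fine scale [f] is replaced by its mollification, whose Taylor remainder is quadratic in the
    increment. Bisecting the segment makes the remainder negligible, and the derivatives at the
    pieces combine into a tree of midpoints. *)
Lemma fam_mean_value y m v w e : 0 < e ->
  `|v - y| <= (2 * m.+1%:R)^-1 -> `|v + w - y| <= (2 * m.+1%:R)^-1 ->
  exists t, `|f (v + w) - f v - w *m fam f y m t| <= e * `|w|.
Proof.
move=> e0; set rho := (2 * m.+1%:R)^-1 => vy wy.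
have rho0 : 0 < rho by rewrite invr_gt0 mulr_gt0.
have rho1 : rho <= 2^-1.
  by rewrite /rho lef_pV2 ?posrE ?mulr_gt0// ler_peMr// ler1n.
have [->|w0] := eqVneq w 0.
  by exists (Leaf (m, 0)); rewrite addr0 subrr mul0mx subr0 !normr0 mulr0.
have nw0 : 0 < `|w| by rewrite normr_gt0.
have c0 : 0 <= `|y| + 1 by rewrite addr_ge0.
have [K K0 HK] := mollifier av lf c0.
have K10 : 0 < K + 1 by rewrite ltr_wpDl.
have yc v' : `|v' - y| <= 1 -> `|v'| <= `|y| + 1.
  move=> h; rewrite -(subrK y v') addrC (le_trans (ler_normD _ _))// lerD2l//.
(* Four errors share [e * |w|]: the mollification at either endpoint, the rational approximation of
   base points, and the quadratic Taylor term. *)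
pose e3 := e / 4; have e30 : 0 < e3 by rewrite divr_gt0.
have h1 : 0 < e3 * `|w| / (K + 1) by rewrite divr_gt0// mulr_gt0.
have [j0 Hj0] := inv_nat_lt h1; pose j := maxn j0 m.
pose r : R := j.+1%:R^-1; have r0 : 0 < r by rewrite invr_gt0.
have r1 : r <= 1 by rewrite invf_le1// ler1n.
have Kr : K * r <= e3 * `|w|.
  have : r < e3 * `|w| / (K + 1).
    by rewrite (le_lt_trans _ Hj0)// lef_pV2 ?posrE// ler_nat ltnS leq_maxl.
  rewrite ltr_pdivlMr// => /ltW; apply: le_trans.
  by rewrite mulrC ler_wpM2l ?(ltW r0)// lerDl.
have [Hd _ HL HT _] := HK r r0 r1.
(* The first bound keeps the rational translate within [2 * rho = 1 / (m + 1)] of [y], so that the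
   leaf is valid; the second keeps the change of the averaged Jacobian, after multiplication by [d],
   below [e3]. *)
pose eta := Num.min rho (e3 * r / ((d%:R + 1) * (K + 1))).
have dK0 : 0 < (d%:R + 1) * (K + 1) by rewrite mulr_gt0// ltr_wpDl.
have eta0 : 0 < eta by rewrite lt_min rho0 divr_gt0// mulr_gt0.
have etaK : d%:R * (K * (eta / r)) <= e3.
  have : eta <= e3 * r / ((d%:R + 1) * (K + 1)) by rewrite /eta ge_min lexx orbT.
  rewrite ler_pdivlMr// => H; rewrite mulrA mulrA ler_pdivrMr//.
  rewrite (le_trans _ H)// mulrC ler_wpM2l ?(ltW eta0)//.
  by rewrite ler_pM ?lerDl.
have leaf v' : `|v' - y| <= rho -> exists t, `|fam f y m t - mollJ f r v'| <= K * (eta / r).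
  move=> v'y; have [q Hq] := mx_rat_approx (v' - y) eta0.
  have val : valid m (j, q).
    rewrite /valid leq_maxr/= -[map_mx _ _](subrK (v' - y)) (le_trans (ler_normD _ _))//.
    have : `|map_mx ratr q - (v' - y)| <= rho.
      by rewrite distrC (le_trans (ltW Hq))// /eta ge_min lexx.
    move=> /lerD/(_ v'y)/le_trans; apply.
    by rewrite /rho invfM; move: (m.+1%:R^-1) => x; lra.
  exists (Leaf (j, q)); rewrite /= normalize_id//= -/r.
  have qv : y + map_mx ratr q - v' = - (v' - y - map_mx ratr q).
    by apply/rowP => l; rewrite !mxE; ring.
  have qn : `|y + map_mx ratr q - v'| <= eta by rewrite qv normrN ltW.
  rewrite (le_trans (HL _ _ _ _))//.
  - apply: yc; rewrite addrAC subrr add0r; move/andP: val => [_ /= /le_trans]; apply.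
    by rewrite invf_le1// ler1n.
  - by apply: yc; rewrite (le_trans v'y)// (le_trans rho1)// invf_le1// ler1n.
  - by rewrite ler_wpM2l// ler_wpM2r// invr_ge0 ltW.
(* Each bisection halves the quadratic term, whereas the leaf error is proportional to the length
   and does not accumulate. The two halves enter the product with weight one half, hence the
   [Node]. *)
have step k : forall v' w', `|v' - y| <= rho -> `|v' + w' - y| <= rho ->
    exists t, `|moll f r (v' + w') - moll f r v' - w' *m fam f y m t| <=
      K / r * `|w'| ^+ 2 / 2 ^+ k + e3 * `|w'|.
  elim: k => [|k IH] v' w' hv hw.
    have [t Ht] := leaf _ hv; exists t.
    have -> : moll f r (v' + w') - moll f r v' - w' *m fam f y m t =
        (moll f r (v' + w') - moll f r v' - w' *m mollJ f r v') - w' *m (fam f y m t - mollJ f r v').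
      by rewrite mulmxBr opprB addrA subrK.
    rewrite (le_trans (ler_normB _ _))// lerD//.
      rewrite expr0 divr1 -mulrA (mulrC r^-1) HT//.
        by apply: yc; rewrite (le_trans hv)// (le_trans rho1)// invf_le1// ler1n.
      have -> : w' = (v' + w' - y) - (v' - y) by apply/rowP => l; rewrite !mxE; ring.
      rewrite (le_trans (ler_normB _ _))// (le_trans (lerD hw hv))//.
      by move: rho1; lra.
    rewrite (le_trans (mx_norm_mulmx _ _))// mulrAC ler_wpM2r//.
    by rewrite (le_trans _ etaK)// ler_wpM2l.
  have hm : `|v' + 2^-1 *: w' - y| <= rho.
    have -> : v' + 2^-1 *: w' - y = 2^-1 *: (v' - y) + 2^-1 *: (v' + w' - y).
      by apply/rowP => l; rewrite !mxE; lra.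
    rewrite (le_trans (ler_normD _ _))// !normrZ ger0_norm ?invr_ge0//.
    by move: hv hw; lra.
  have hw2 : v' + 2^-1 *: w' + 2^-1 *: w' = v' + w' by apply/rowP => l; rewrite !mxE; lra.
  have hwy : `|v' + 2^-1 *: w' + 2^-1 *: w' - y| <= rho by rewrite hw2.
  have [t1 H1] := IH _ _ hv hm; have [t2 H2] := IH _ _ hm hwy.
  exists (Node t1 t2); rewrite /= -scalemxAr scalemxAl mulmxDr.
  move: H1 H2; rewrite hw2 normrZ ger0_norm ?invr_ge0// => H1 H2.
  set X1 := (X in `|X| <= _) in H1; set X2 := (X in `|X| <= _) in H2.
  have -> : moll f r (v' + w') - moll f r v' -
      ((2^-1 *: w') *m fam f y m t1 + (2^-1 *: w') *m fam f y m t2) = X1 + X2.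
    by rewrite /X1 /X2; apply/rowP => l; rewrite !mxE; ring.
  rewrite (le_trans (ler_normD _ _))// (le_trans (lerD H1 H2))//.
  rewrite (exprS 2 k); have : 2 ^+ k != 0 :> R by rewrite expf_neq0.
  move: (2 ^+ k) (K / r) `|w'| => a b x a0.
  by rewrite le_eqVlt; apply/orP; left; apply/eqP; field.
have h3 : 0 < e3 / (K / r * `|w| + 1).
  by rewrite divr_gt0// ltr_wpDl// mulr_ge0// divr_ge0// ltW.
have [k Hk] := inv_nat_lt h3.
have Kk : K / r * `|w| ^+ 2 / 2 ^+ k <= e3 * `|w|.
  have b0 : 0 < K / r * `|w| + 1 by rewrite ltr_wpDl// mulr_ge0// divr_ge0// ltW.
  rewrite expr2 mulrA mulrAC ler_wpM2r// ler_pdivrMr ?exprn_gt0//.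
  move: Hk; rewrite ltr_pdivlMr// => Hk.
  have k1 : k.+1%:R <= 2 ^+ k :> R by rewrite -natrX ler_nat ltn_expl.
  have : (K / r * `|w| + 1) <= e3 * k.+1%:R.
    by rewrite -ler_pdivrMr// mulrC ltW.
  move=> H; rewrite (@le_trans _ _ (K / r * `|w| + 1)) ?lerDl// (le_trans H)//.
  by rewrite ler_pM2l.
have [t Ht] := step k v w vy wy; exists t.
set Y := moll f r (v + w) - moll f r v - w *m fam f y m t.
have -> : f (v + w) - f v - w *m fam f y m t =
    - (moll f r (v + w) - f (v + w)) + (moll f r v - f v) + Y.
  by rewrite /Y; apply/rowP => l; rewrite !mxE; ring.
have yv : `|v| <= `|y| + 1.
  by apply: yc; rewrite (le_trans vy)// (le_trans rho1)// invf_le1// ler1n.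
have yvw : `|v + w| <= `|y| + 1.
  by apply: yc; rewrite (le_trans wy)// (le_trans rho1)// invf_le1// ler1n.
rewrite (le_trans (ler_normD _ _))// (le_trans (lerD (ler_normD _ _) (lexx _)))// normrN.
have := Hd _ yv; have := Hd _ yvw; move: Kr Kk Ht.
rewrite -/Y /e3; move: (K * r) `|Y| `|w| (K / r * _ / _) => x1 x2 x3 x4; lra.
Qed.

(** Segments are bisected until their length is at most [1 / 2], where the family of level 0 applies
    with error 1. That error is the summand 1 of the constant, [d * b] bounds the matrix product,
    and level 0 sees derivatives up to distance 2, hence [c + 2]. *)
Lemma jacobian_bound_lipschitz c b : 0 <= b ->
  (forall z A, `|z| <= c + 2 -> frechet f z A -> `|A| <= b) ->
  forall v u, `|v| <= c -> `|u| <= c -> `|f u - f v| <= (d%:R * b + 1) * `|u - v|.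
Proof.
move=> b0 Hb v u vc uc; rewrite -{1}(subrK v u) [u - v + v]addrC.
have : `|v + (u - v)| <= c by rewrite addrC subrK.
move: (u - v) => w wc.
have [k Hk] : exists k, `|w| <= 2 ^+ k / 2.
  exists (Num.bound (2 * `|w|)); rewrite ler_pdivlMr// mulrC.
  have := archi_boundP (mulr_ge0 (ler0n R 2) (normr_ge0 w)) => /ltW/le_trans; apply.
  by rewrite -natrX ler_nat ltnW// ltn_expl.
elim: k v w vc wc Hk {u uc} => [|k IH] v w vc wc wk.
  have [t Ht] : exists t, `|f (v + w) - f v - w *m fam f v 0 t| <= 1 * `|w|.
    apply: fam_mean_value => //; first by rewrite subrr normr0 invr_ge0.
    by rewrite addrAC subrr add0r (le_trans wk)// mulr1 expr0 mul1r.
  have Hf : `|fam f v 0 t| <= b.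
    apply: fam_bound => // z A zv fA; apply: Hb fA.
    rewrite -(subrK v z) addrC (le_trans (ler_normD _ _))// lerD//.
    by rewrite (le_trans zv)// invr1 mulr1.
  rewrite -(subrK (w *m fam f v 0 t) (f (v + w) - f v)).
  rewrite (le_trans (ler_normD _ _))// mulrDl addrC lerD//.
  by rewrite (le_trans (mx_norm_mulmx _ _))// mulrAC ler_wpM2r// ler_wpM2l.
have hw2 : v + 2^-1 *: w + 2^-1 *: w = v + w by apply/rowP => l; rewrite !mxE; lra.
have hm : `|v + 2^-1 *: w| <= c.
  have -> : v + 2^-1 *: w = 2^-1 *: v + 2^-1 *: (v + w) by apply/rowP => l; rewrite !mxE; lra.
  rewrite (le_trans (ler_normD _ _))// !normrZ ger0_norm ?invr_ge0//.
  by move: vc wc; lra.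
have wk2 : `|2^-1 *: w| <= 2 ^+ k / 2.
  by rewrite normrZ ger0_norm ?invr_ge0//; move: wk; rewrite exprS; lra.
have H1 := IH _ _ vc hm wk2.
have wc2 : `|v + 2^-1 *: w + 2^-1 *: w| <= c by rewrite hw2.
have := IH _ _ hm wc2 wk2; rewrite hw2 => H2.
rewrite -(subrK (f (v + 2^-1 *: w)) (f (v + w))) -addrA (le_trans (ler_normD _ _))//.
rewrite (le_trans (lerD H2 H1))// normrZ ger0_norm ?invr_ge0// -mulrDl.
by move: (d%:R * b + 1) `|w| => x z; lra.
Qed.

(** An inequality valid for the derivatives in a small ball holds for all members of a fine level
    and passes to the limit [M], so [clarke_jac_support] applies. *)
Lemma fam_clarke y M :
  (forall m e, 0 < e -> exists t, `|fam f y m t - M| < e) -> clarke_jac f y M.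
Proof.
move=> HM; apply: (clarke_jac_support lf) => Q q e e0 HQ.
have e20 : 0 < e / 2 by rewrite divr_gt0.
have [m me] := inv_nat_lt e20.
have Hf t : mdot Q (fam f y m t) <= q.
  apply: fam_support => z A zy; apply: HQ; rewrite (le_trans zy)//.
  by move: me; move: (_^-1) => x; lra.
have Ht (k : nat) : exists t, `|fam f y m t - M| < k.+1%:R^-1.
  by apply: HM; rewrite invr_gt0.
have [s Hs] := choice Ht.
have sM : (fun k => fam f y m (s k)) @ \oo --> M.
  apply/cvgrPdist_lt => e' e'0; have [N Ne] := inv_nat_lt e'0.
  exists N => // k /= Nk; rewrite distrC (lt_trans (Hs k))// (le_lt_trans _ Ne)//.
  by rewrite lef_pV2 ?posrE// ler_nat.
by apply: (cvgr_to_le (mdot_cvg (Q := Q) sM)); apply: nearW => k; exact: Hf.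
Qed.

Lemma fam_bounded y : exists2 b, 0 <= b & forall m t, `|fam f y m t| <= b.
Proof.
have [L fL] := lf (`|y| + 3).
exists `|L| => // m t; apply: fam_bound => // z A zy fA.
apply: (@frechet_bound _ _ _ f (`|y| + 3) `|L| z A) => //.
  by move=> x x' xc xc'; rewrite (le_trans (fL _ _ xc xc'))// ler_wpM2r// ler_norm.
rewrite -(subrK y z) addrC (le_lt_trans (ler_normD _ _))// ltrD2l.
rewrite (le_lt_trans zy)// (@le_lt_trans _ _ (2 * 1))//.
  by rewrite ler_wpM2l// invf_le1// ler1n.
by rewrite mulr1 ltr_nat.
Qed.

(* Compactness: a cluster point of bad members would lie in every closure. *)
Lemma fam_excess y e : 0 < e -> exists m, forall t k, exists tau,
  msq (fam f y k tau - fam f y m t) <= e.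
Proof.
move=> e0; apply: contrapT => nH.
have Hm m : exists t, exists k, forall tau, e < msq (fam f y k tau - fam f y m t).
  apply: contrapT => nt; apply: nH; exists m => t k; apply: contrapT => ntau; apply: nt.
  exists t, k => tau; rewrite ltNge; apply/negP => le; apply: ntau.
  by exists tau.
have [s Hs] := choice Hm.
have [b b0 Hb] := fam_bounded y.
have [A clA] := bounded_cluster_point (fun m => Hb m (s m)).
pose D : R := (d * n)%:R + 1; have D0 : 0 < D by rewrite ltr_wpDl.
(* Members at distance [2 * e'] have squared Euclidean distance at most
   [D * (2 * e') ^ 2 <= 4 * D * e' <= e], where [e' <= 1] is used. *)
pose e' := Num.min 1 (e / (4 * D)).
have e'0 : 0 < e' by rewrite lt_min ltr01 divr_gt0// mulr_gt0.
have [m _ mA] := clA e' 0%N e'0.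
have [k Hk] := Hs m.
have [l kl lA] := clA e' k e'0.
have := Hk (tree_normalize l (s l)); rewrite -fam_nested// ltNge; apply/negP/negPn.
have dist : `|fam f y l (s l) - fam f y m (s m)| <= 2 * e'.
  rewrite -(subrK A (fam f y l (s l))) -addrA (le_trans (ler_normD _ _))//.
  by rewrite mulr_natl mulr2n lerD ?(ltW lA)// distrC ltW.
rewrite (le_trans (msq_le_norm _))//.
have d2 : `|fam f y l (s l) - fam f y m (s m)| ^+ 2 <= 4 * e'.
  rewrite (@le_trans _ _ ((2 * e') ^+ 2))//.
    by apply: lerXn2r; rewrite ?nnegrE ?mulr_ge0 ?(ltW e'0).
  rewrite exprMn; have -> : 2 ^+ 2 = 4 :> R by ring.
  by rewrite ler_pM2l// expr2 ler_piMr ?(ltW e'0)// /e' ge_min lexx.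
rewrite (@le_trans _ _ (D * (4 * e')))//.
  by rewrite ler_pM ?sqr_ge0// lerDl.
have : e' <= e / (4 * D) by rewrite /e' ge_min lexx orbT.
rewrite ler_pdivlMr ?mulr_gt0// => H; rewrite (le_trans _ H)//.
by rewrite mulrA mulrC (mulrC D).
Qed.

End midpoint_family.

(** * Measurable selection *)

Section measurable_selection.
Context {R : realType}.

Lemma prod_sets_preimage dT (T : measurableType dT) dU (U : measurableType dU) k
    (g : U -> T) (w : U -> 'rV[R]_k) X :
  measurable_fun setT g -> borel_mfun w -> prod_sets X ->
  measurable ((fun t => (g t, w t)) @^-1` X).
Proof.
move=> mg mw; move: X; apply: smallest_sub => [|_ [A [B [mA [BB ->]]]]].
  split => [|X mX|F mF].
  - by rewrite /= preimage_set0.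
  - by rewrite /= setTD preimage_setC; exact: measurableC.
  - by rewrite /= preimage_bigcup; exact: bigcup_measurable.
have mB : measurable (w @^-1` B).
  move: B BB; apply: smallest_sub => [|O oO]; last exact: mw.
  split => [|X mX|F mF].
  - by rewrite /= preimage_set0.
  - by rewrite /= setTD preimage_setC; exact: measurableC.
  - by rewrite /= preimage_bigcup; exact: bigcup_measurable.
have := mg measurableT A mA; rewrite setTI => mgA.
rewrite (_ : _ @^-1` _ = (g @^-1` A) `&` (w @^-1` B)); first exact: measurableI.
by apply/seteqP; split => t.
Qed.

(* The selected index is the first admissible one in the enumeration of [I]. *)
Lemma measurable_first dT (T : measurableType dT) (I : countType) (V : topologicalType)
    (Q : I -> set T) (F : I -> T -> V) :
  (forall i, measurable (Q i)) -> (forall i, borel_mfun (F i)) -> (forall x, exists i, Q i x) ->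
  exists h, borel_mfun h /\ forall x, exists i, Q i x /\ h x = F i x.
Proof.
move=> mQ mF Qex.
pose E i := Q i `&` \bigcap_(j in [set j | (pickle j < pickle i)%N]) ~` Q j.
have mE i : measurable (E i).
  apply: measurableI => //.
  rewrite (_ : \bigcap_(j in _) _ =
      \bigcap_j (if (pickle j < pickle i)%N then ~` Q j else setT)).
    apply: countable_bigcap_measurable => j; case: ifP => // _.
    exact: measurableC.
  apply/seteqP; split => x Hx j; first by move=> _; case: ifP => // ji; exact: Hx.
  by move=> /= ji; have := Hx j Logic.I; rewrite ji.
have Eex x : exists i, E i x.
  have : exists k : nat, `[< exists i, pickle i = k /\ Q i x >].
    by have [i Qi] := Qex x; exists (pickle i); apply/asboolP; exists i.
  move=> exk; case: (ex_minnP exk) => k /asboolP[i [ik Qi]] kmin.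
  exists i; split => // j /= ji Qj.
  have : (k <= pickle j)%N by apply: kmin; apply/asboolP; exists j.
  by rewrite leqNgt -ik ji.
have Eu x i j : E i x -> E j x -> i = j.
  move=> [Qi Hi] [Qj Hj]; apply: (@pcan_inj _ _ _ _ pickleK).
  by case: (ltngtP (pickle i) (pickle j)) => // ij; [case: (Hj i ij)|case: (Hi j ij)].
have [s Hs] := choice Eex.
exists (fun x => F (s x) x); split => [ O oO|x]; last by exists (s x); split => //; have [] := Hs x.
rewrite (_ : _ @^-1` _ = \bigcup_i (E i `&` F i @^-1` O)).
  by apply: countable_bigcupT_measurable => // i; apply: measurableI => //; exact: mF.
apply/seteqP; split => [x /= Ox|x [i _ [/= Ei Ox]]]; first by exists (s x).
by rewrite /= (Eu _ _ _ (Hs x) Ei).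
Qed.

Lemma borel_lim dT (T : measurableType dT) m n (u : nat -> T -> 'M[R]_(m, n)) M :
  (forall k, borel_mfun (u k)) -> (forall x, (fun k => u k x) @ \oo --> M x) -> borel_mfun M.
Proof.
move=> mu uM; apply: entry_borel_mfun => i j.
apply: (@measurable_fun_cvg _ _ _ _ (fun k x => u k x i j)) => [k|x _].
  exact: borel_entry_measurable.
exact: (cvg_comp _ (fun M : 'M[R]_(m, n) => M i j) (uM x) (@coord_continuous _ _ _ _ _ _)).
Qed.

Lemma borel_sub dT (T : measurableType dT) m n (f g : T -> 'M[R]_(m, n)) :
  borel_mfun f -> borel_mfun g -> borel_mfun (fun x => f x - g x).
Proof.
move=> mf mg; apply: entry_borel_mfun => i j.
under eq_fun do rewrite mx_subE.
by apply: measurable_funB; exact: borel_entry_measurable.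
Qed.

Lemma borel_mulmx dT (T : measurableType dT) m n k (f : T -> 'M[R]_(m, n)) (g : T -> 'M[R]_(n, k)) :
  borel_mfun f -> borel_mfun g -> borel_mfun (fun x => f x *m g x).
Proof.
move=> mf mg; apply: entry_borel_mfun => i j.
under eq_fun do rewrite mxE.
apply: measurable_sum => l; apply: measurable_funM; exact: borel_entry_measurable.
Qed.

Lemma borel_midpoint dT (T : measurableType dT) m n (f g : T -> 'M[R]_(m, n)) :
  borel_mfun f -> borel_mfun g -> borel_mfun (fun x => 2^-1 *: (f x + g x)).
Proof.
move=> mf mg; apply: entry_borel_mfun => i j.
rewrite (_ : (fun x => _) = (fun x => 2^-1 * (f x i j + g x i j))).
  by apply: measurable_funM => //; apply: measurable_funD => //; exact: borel_entry_measurable.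
by apply/funext => x; rewrite !mxE.
Qed.

Lemma msq_measurable dT (T : measurableType dT) m n (f : T -> 'M[R]_(m, n)) :
  borel_mfun f -> measurable_fun setT (fun x => msq (f x)).
Proof.
move=> mf; apply: measurable_sum => i; apply: measurable_sum => j.
by apply: measurable_funM; exact: borel_entry_measurable.
Qed.

Lemma norm_mx_measurable dT (T : measurableType dT) m n (f : T -> 'M[R]_(m, n)) :
  borel_mfun f -> measurable_fun setT (fun x => `|f x|).
Proof.
move=> mf; apply: borel_measurable; apply: (@borel_comp _ _ _ _ f (fun A => `|A|)) => //.
exact: norm_continuous.
Qed.

Lemma measurable_le dT (T : measurableType dT) (f g : T -> R) :
  measurable_fun setT f -> measurable_fun setT g -> measurable [set x | f x <= g x].
Proof.
move=> mf mg; have := measurable_fun_ler mf mg => /(_ measurableT [set true]).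
by rewrite setTI => H; exact: H.
Qed.

Variables (dT : measure_display) (T : measurableType dT) (d n : nat).
Variables (disp : measure_display) (S : measurableType disp).
Variables (P : probability S R) (phi : S -> 'rV[R]_d).
Hypothesis av : averaging P phi.
Variable H : T -> 'rV[R]_d -> 'rV[R]_n.
Hypothesis mH : forall O, open O ->
  prod_sets ((fun xz : T * 'rV[R]_d => H xz.1 xz.2) @^-1` O).
Hypothesis lH : forall x, lip_bounded (H x).

Lemma superposition_borel dU (U : measurableType dU) (g : U -> T) (w : U -> 'rV[R]_d) :
  measurable_fun setT g -> borel_mfun w -> borel_mfun (fun t => H (g t) (w t)).
Proof. by move=> mg mw O oO; exact: (prod_sets_preimage mg mw (mH oO)). Qed.

Lemma moll_param_measurable r (y : T -> 'rV[R]_d) j : borel_mfun y ->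
  measurable_fun setT (fun x => moll P phi (H x) r (y x) 0 j).
Proof.
move=> my; have [mphi _ _ _] := av.
pose G (xs : T * S) : R := H xs.1 (y xs.1 + r *: phi xs.2) 0 j.
have mG : measurable_fun setT G.
  apply: borel_entry_measurable; apply: superposition_borel; first exact: measurable_fst.
  apply: entry_borel_mfun => i l.
  rewrite (_ : (fun _ => _) = (fun xs : T * S => y xs.1 i l + r * phi xs.2 i l)).
    apply: measurable_funD; last apply: measurable_funM => //.
      by apply: (measurableT_comp (borel_entry_measurable i l my)); exact: measurable_fst.
    by apply: (measurableT_comp (borel_entry_measurable i l mphi)); exact: measurable_snd.
  by apply/funext => xs; rewrite !mxE.
have mGE : measurable_fun setT (EFin \o G) by exact/measurable_EFinP.
pose I x := (\int[P]_s (EFin \o G) (x, s))%E.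
have mI : measurable_fun setT I.
  have -> : I = (fun x => fubini_F P ((EFin \o G)^\+%E) x - fubini_F P ((EFin \o G)^\-%E) x)%E.
    by apply/funext => x; rewrite /I [LHS]integralE (funepos_comp (EFin \o G) (pair x)) (funeneg_comp (EFin \o G) (pair x)).
  apply: emeasurable_funB; apply: measurable_fun_fubini_tonelli_F => //.
    exact: measurable_funepos.
  exact: measurable_funeneg.
have -> : (fun x => moll P phi (H x) r (y x) 0 j) = fine \o I.
  by apply/funext => x; rewrite mxE.
by apply: measurableT_comp => //; exact: fine_measurable.
Qed.

Lemma mollJ_borel r (y : T -> 'rV[R]_d) : 0 < r -> r <= 1 -> borel_mfun y ->
  borel_mfun (fun x => mollJ P phi (H x) r (y x)).
Proof.
move=> r0 r1 my; apply: entry_borel_mfun => i j.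
apply: (@measurable_fun_cvg _ _ _ _ (fun k x => quot (moll P phi (H x) r) (delta_mx 0 i) k (y x) 0 j)).
  move=> k; rewrite (_ : (fun x => _) = (fun x => k.+1%:R *
      (moll P phi (H x) r (y x + k.+1%:R^-1 *: delta_mx 0 i) 0 j - moll P phi (H x) r (y x) 0 j))).
    apply: measurable_funM => //; apply: measurable_funB; apply: moll_param_measurable => //.
    apply: entry_borel_mfun => i' j'.
    rewrite (_ : (fun x => _) = (fun x => y x i' j' + (k.+1%:R^-1 *: (delta_mx 0 i : 'rV[R]_d)) i' j')).
      by apply: measurable_funD => //; exact: borel_entry_measurable.
    by apply/funext => x; rewrite mxE.
  by apply/funext => x; rewrite /quot mxE mx_subE.
move=> x _; have [K _ HK] := mollifier av (lH x) (normr_ge0 (y x)).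
have [_ HJ _ _ _] := HK r r0 r1; exact: (HJ (y x) i j (lexx _)).
Qed.

Variable ubar : T -> 'rV[R]_d.
Hypothesis mubar : borel_mfun ubar.
Local Notation fam m t x := (fam P phi (H x) (ubar x) m t).

Lemma fam_borel m t : borel_mfun (fun x => fam m t x).
Proof.
elim: t => [i|l IHl r IHr] /=; last exact: borel_midpoint.
apply: mollJ_borel; rewrite ?invr_gt0 ?invf_le1 ?ler1n//.
apply: entry_borel_mfun => i' j'.
under eq_fun do rewrite mxE.
by apply: measurable_funD => //; exact: borel_entry_measurable.
Qed.

(** [M x] is the limit of members that nearly minimize the distance to [G x] in the families of
    rising level. Nestedness and closure under midpoints make them converge, [fam_clarke] places the
    limit, and picking first admissible indices keeps everything measurable. *)
Lemma clarke_selection (G : T -> 'M[R]_(d, n)) : borel_mfun G ->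
  exists M, borel_mfun M /\ forall x, clarke_jac (H x) (ubar x) (M x) /\
    forall b, (forall k, exists tau, msq (fam k tau x - G x) <= b) -> msq (M x - G x) <= b.
Proof.
move=> mG.
pose Q m t := [set x | forall tau, msq (fam m t x - G x) <= msq (fam m tau x - G x) + m.+1%:R^-1].
have mQ m t : measurable (Q m t).
  rewrite (_ : Q m t = \bigcap_tau
      [set x | msq (fam m t x - G x) <= msq (fam m tau x - G x) + m.+1%:R^-1]).
    apply: countable_bigcap_measurable => tau; apply: measurable_le.
      by apply: msq_measurable; apply: borel_sub => //; exact: fam_borel.
    apply: measurable_funD => //.
    by apply: msq_measurable; apply: borel_sub => //; exact: fam_borel.
  by apply/seteqP; split => x Hx tau; [move=> _|]; exact: Hx.
have Qex m x : exists t, Q m t x.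
  pose E := range (fun t => fam m t x).
  have E0 : E !=set0 by exists (fam m (Leaf (m, 0)) x), (Leaf (m, 0)).
  have m0 : 0 < m.+1%:R^-1 :> R by rewrite invr_gt0.
  have [_ [t _ <-] Ht] := near_minimizer (G x) E0 m0.
  by exists t => tau; apply: Ht; exists tau.
have HA m : exists A, borel_mfun A /\ forall x, exists t, Q m t x /\ A x = fam m t x.
  by apply: measurable_first => // t; exact: fam_borel.
have [A {}HA] := choice HA.
have nested x i j tau : (i <= j)%N -> exists t, fam j tau x = fam i t x.
  by move=> ij; exists (tree_normalize (R := R) j tau); exact: fam_nested.
have Abound x : exists M : 'M[R]_(d, n), (fun m => A m x) @ \oo --> M.
  have [b b0 Hb] := fam_bounded av (lH x) (ubar x).
  apply: (@near_minimizers_cvg _ _ _ (fun m => range (fun t => fam m t x)) (fun m => A m x) (G x)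
    ((d * n)%:R * (b + `|G x|) ^+ 2)).
  - by move=> i j ij _ [tau _ <-]; have [t ->] := nested x i j tau ij; exists t.
  - by move=> i _ _ [t1 _ <-] [t2 _ <-]; exists (Node t1 t2).
  - by move=> i; have [_ /(_ x)[t [_ ->]]] := HA i; exists t.
  - by move=> i _ [tau _ <-]; have [_ /(_ x)[t [+ ->]]] := HA i; apply.
  - move=> i; have [_ /(_ x)[t [_ ->]]] := HA i.
    rewrite (le_trans (msq_le_norm _))// ler_wpM2l//.
    apply: lerXn2r; rewrite ?nnegrE ?addr_ge0//.
    by rewrite (le_trans (ler_normB _ _))// lerD2r.
have [M HM] := choice Abound; exists M; split.
  by apply: (borel_lim _ HM) => m; have [] := HA m.
move=> x; split.
  apply: (fam_clarke av (lH x)) => m e e0.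
  have /cvgrPdist_lt/(_ e e0)[N _ HN] := HM x.
  have [_ /(_ x)[t [_ At]]] := HA (maxn N m).
  have [t' Ht'] := nested x m (maxn N m) t (leq_maxr _ _).
  by exists t'; rewrite -Ht' -At distrC; apply: HN; exact: leq_maxl.
move=> b Hb; have H1 := msq_cvg (G := G x) (HM x).
have H2 : (fun m : nat => b + 1 * m.+1%:R^-1) @ \oo --> b + 0.
  exact: (cvgD (cvg_cst _) (inv_nat_cvg0 1)).
rewrite addr0 in H2; apply: (ler_cvg_to H1 H2); apply: nearW => m.
have [_ /(_ x)[t [Qt ->]]] := HA m; have [tau Htau] := Hb m.
by rewrite (le_trans (Qt tau))// mul1r lerD2r.
Qed.

(* Letting [k] grow: the members of level [m] are within squared distance [e] of the Clarke
   Jacobian. *)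
Definition level_set e m := [set x | forall t k, exists tau, msq (fam k tau x - fam m t x) <= e].

Lemma level_set_measurable e m : measurable (level_set e m).
Proof.
rewrite (_ : level_set e m = \bigcap_t \bigcap_(k : nat) \bigcup_tau
    [set x | msq (fam k tau x - fam m t x) <= e]).
  apply: countable_bigcap_measurable => t; apply: countable_bigcap_measurable => k.
  apply: countable_bigcupT_measurable => // tau; apply: measurable_le => //.
  by apply: msq_measurable; apply: borel_sub; exact: fam_borel.
apply/seteqP; split => x Hx.
  by move=> t _ k _; have [tau Ht] := Hx t k; exists tau.
by move=> t k; have [tau _ Ht] := Hx t Logic.I k Logic.I; exists tau.
Qed.

Lemma level_set_nondecreasing e m k : (m <= k)%N -> level_set e m `<=` level_set e k.
Proof.
move=> mk x Hx t l; have [tau Ht] := Hx (tree_normalize (R := R) k t) l; exists tau.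
by rewrite (fam_nested _ _ _ _ _ mk).
Qed.

Lemma level_set_cover e x : 0 < e -> exists m, level_set e m x.
Proof. exact: (fam_excess av (lH x)). Qed.

(** The member [G] fitted to the increment need not be a Clarke matrix at [ubar x]. On the level set
    its projection [M] is within [e] of it, which adds [d * e] to the error [e] of the mean value
    estimate. *)
Lemma mean_value_selection (u v : T -> 'rV[R]_d) e m : borel_mfun u -> borel_mfun v -> 0 < e ->
  exists M, [/\ borel_mfun M, forall x, clarke_jac (H x) (ubar x) (M x) &
    forall x, level_set (e ^+ 2) m x -> `|u x - ubar x| <= (2 * m.+1%:R)^-1 ->
      `|v x - ubar x| <= (2 * m.+1%:R)^-1 ->
      `|H x (u x) - H x (v x) - (u x - v x) *m M x| <= (1 + d%:R) * e * `|u x - v x|].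
Proof.
move=> mu mv e0; set rho := (2 * m.+1%:R)^-1.
pose near := [set x | `|u x - ubar x| <= rho] `&` [set x | `|v x - ubar x| <= rho].
pose est t := [set x | `|H x (u x) - H x (v x) - (u x - v x) *m fam m t x| <= e * `|u x - v x|].
have mnear : measurable near.
  by apply: measurableI; apply: measurable_le => //; apply: norm_mx_measurable; exact: borel_sub.
have mest t : measurable (est t).
  apply: measurable_le.
    apply: norm_mx_measurable; apply: borel_sub.
      by apply: borel_sub; apply: (@superposition_borel _ T id) => //; exact: measurable_id.
    by apply: borel_mulmx; [exact: borel_sub|exact: fam_borel].
  by apply: measurable_funM => //; apply: norm_mx_measurable; exact: borel_sub.
(* Off [near] every index is declared admissible, so that an admissible one exists at every
   point. *)
have [G [mG HG]] : exists G, borel_mfun G /\ forall x, exists t, (~` near `|` est t) x /\ G x = fam m t x.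
  apply: measurable_first.
  - by move=> t; apply: measurableU => //; exact: measurableC.
  - by move=> t; exact: fam_borel.
  - move=> x; have [[ux vx]|nx] := pselect (near x); last by exists (Leaf (m, 0)); left.
    have vw : v x + (u x - v x) = u x by rewrite addrC subrK.
    have ux' : `|v x + (u x - v x) - ubar x| <= rho by rewrite vw.
    have [t Ht] := fam_mean_value av (lH x) e0 vx ux'.
    by exists t; right; move: Ht; rewrite vw.
have [M [mM HM]] := clarke_selection mG.
exists M; split => // [x|x lx ux vx]; first by have [] := HM x.
have [_ Hb] := HM x; have [t [[[]//|tx] Gx]] := HG x.
have MG : msq (M x - G x) <= e ^+ 2.
  by apply: Hb => k; rewrite Gx; exact: lx.
have {}MG : `|M x - G x| <= e.
  rewrite -(@ler_pXn2r _ 2)// ?nnegrE//; last exact: ltW.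
  exact: le_trans (norm_msq _) MG.
have -> : H x (u x) - H x (v x) - (u x - v x) *m M x =
    (H x (u x) - H x (v x) - (u x - v x) *m fam m t x) - (u x - v x) *m (M x - G x).
  by rewrite mulmxBr -Gx opprB addrA subrK.
rewrite (le_trans (ler_normB _ _))// mulrDl mul1r mulrDl lerD//.
rewrite (le_trans (mx_norm_mulmx _ _))// mulrAC ler_wpM2r// ler_wpM2l//.
Qed.

End measurable_selection.

(** * Integral estimates *)

Section growth.
Context {R : realType}.

Lemma powR_le (r x y : R) : 0 <= r -> 0 <= x -> x <= y -> x `^ r <= y `^ r.
Proof.
move=> r0 x0 xy; apply: ge0_ler_powR => //; rewrite nnegrE//.
exact: le_trans xy.
Qed.

Lemma powR_add_le (p s t : R) : 0 <= p -> 0 <= s -> 0 <= t ->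
  (s + t) `^ p <= 2 `^ p * (s `^ p + t `^ p).
Proof.
move=> p0 s0 t0; wlog st : s t s0 t0 / s <= t.
  by move=> H; have [/H|/ltW/H] := leP s t; [apply|rewrite addrC [X in _ * X]addrC; apply].
rewrite (@le_trans _ _ ((2 * t) `^ p))//.
  by apply: powR_le; rewrite ?addr_ge0// mulr_natl mulr2n lerD2r.
by rewrite powRM// ler_wpM2l ?powR_ge0// lerDr powR_ge0.
Qed.

Lemma powR_add3_le (p r s t : R) : 0 <= p -> 0 <= r -> 0 <= s -> 0 <= t ->
  (r + s + t) `^ p <= 4 `^ p * (r `^ p + s `^ p + t `^ p).
Proof.
move=> p0 r0 s0 t0; rewrite (le_trans (powR_add_le _ _ _))// ?addr_ge0//.
have -> : 4 = 2 * 2 :> R by ring.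
rewrite powRM// -mulrA ler_wpM2l ?powR_ge0// mulrDr lerD ?powR_add_le//.
rewrite ler_peMl ?powR_ge0// -[leLHS](@powRr0 _ 2) ler_powR//.
by rewrite ler1n.
Qed.

Variables (d n : nat) (disp : measure_display) (S : measurableType disp).
Variables (P : probability S R) (phi : S -> 'rV[R]_d).
Hypothesis av : averaging P phi.

(** The growth condition bounds matrices, and [jacobian_bound_lipschitz] converts it into a bound on
    increments; this accounts for [c + 2] and the first two summands of [K], the last one being for
    the product with [M]. Additive constants are absorbed since [(c + 2) ^ th >= 1]. *)
Lemma remainder_growth (CH th : R) : 0 <= CH -> 0 <= th ->
  exists2 K, 0 <= K & forall f : 'rV[R]_d -> 'rV[R]_n, lip_bounded f ->
  (forall z M, clarke_jac f z M -> vnorm M <= CH * (1 + vnorm z `^ th)) ->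
  forall c u v y M, 0 <= c -> `|u| <= c -> `|v| <= c -> `|y| <= c -> clarke_jac f y M ->
  `|f u - f v - (u - v) *m M| <= K * (c + 2) `^ th * `|u - v|.
Proof.
move=> CH0 th0; pose D : R := (1 * d)%:R; pose B := CH * (1 + D `^ th).
have B0 : 0 <= B by rewrite mulr_ge0// addr_ge0// powR_ge0.
exists (d%:R * B + 1 + d%:R * B) => [|f lf fC c u v y M c0 uc vc yc fM].
  by rewrite !addr_ge0// mulr_ge0.
have c1 : 1 <= (c + 2) `^ th.
  rewrite -[leLHS](@powRr0 _ (c + 2)) ler_powR//.
  by move: c0; lra.
have zb z A : `|z| <= c + 2 -> clarke_jac f z A -> `|A| <= B * (c + 2) `^ th.
  move=> zc fA; rewrite (le_trans (mx_norm_vnorm _))// (le_trans (fC _ _ fA))//.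
  rewrite -mulrA ler_wpM2l// mulrDl mul1r lerD// -powRM ?addr_ge0//.
  apply: powR_le; rewrite ?vnorm_ge0// (le_trans (vnorm_mx_norm _))//.
  exact: ler_wpM2l.
have Bc0 : 0 <= B * (c + 2) `^ th by rewrite mulr_ge0// powR_ge0.
have Hu := jacobian_bound_lipschitz av lf Bc0
  (fun z A zc fA => zb z A zc (frechet_clarke fA)) vc uc.
rewrite (le_trans (ler_normB _ _))//; set t := (c + 2) `^ th in c1 zb Hu *.
have -> : (d%:R * B + 1 + d%:R * B) * t * `|u - v| =
    (d%:R * (B * t) + t) * `|u - v| + d%:R * (B * t) * `|u - v| by ring.
apply: lerD; first by rewrite (le_trans Hu)// ler_wpM2r// lerD2l.
rewrite (le_trans (mx_norm_mulmx _ _))// mulrAC ler_wpM2r// ler_wpM2l//.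
by apply: zb fM; rewrite (le_trans yc)// lerDl.
Qed.

End growth.

Section integral_norms.
Context {R : realType} {dT : measure_display} {T : measurableType dT}.
Variable mu : {measure set T -> \bar R}.
Local Open Scope ereal_scope.

Lemma integral_powR_ge0 (g : T -> R) r : 0 <= \int[mu]_x (g x `^ r)%:E.
Proof. by apply: integral_ge0 => x _; rewrite lee_fin powR_ge0. Qed.

Lemma LnormE (g : T -> R) r : (forall x, (0 <= g x)%R) ->
  Lnorm mu r%:E (EFin \o g) = (\int[mu]_x (g x `^ r)%:E) `^ r^-1.
Proof.
move=> g0; rewrite unlock; apply: (congr1 (poweR^~ _)); apply: eq_integral => x _.
by rewrite /= ger0_norm.
Qed.

Lemma LpnormE m k (w : T -> 'M[R]_(m, k)) r :
  Lpnorm mu r w = (\int[mu]_x (vnorm (w x) `^ r)%:E) `^ r^-1.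
Proof. by rewrite /Lpnorm LnormE// => x; exact: vnorm_ge0. Qed.

Lemma Lpnorm_integral m k (w : T -> 'M[R]_(m, k)) r : (r != 0)%R ->
  \int[mu]_x (vnorm (w x) `^ r)%:E = Lpnorm mu r w `^ r.
Proof. by move=> r0; rewrite LpnormE -poweRrM mulVf// poweRe1// integral_powR_ge0. Qed.

Lemma measurable_powR_comp (g : T -> R) r : measurable_fun setT g ->
  measurable_fun setT (fun x => (g x `^ r)%R).
Proof. by move=> mg; apply: (measurableT_comp (measurable_powR _) mg). Qed.

(** Hoelder's inequality for [f ^ q] and [g ^ q] with the conjugate exponents [s / q] and [p / q],
    followed by a root of order [q]. *)
Lemma hoelder_powR (f g : T -> R) (q p s : R) :
  measurable_fun setT f -> measurable_fun setT g ->
  (forall x, (0 <= f x)%R) -> (forall x, (0 <= g x)%R) ->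
  (0 < q)%R -> (0 < p)%R -> (0 < s)%R -> (s^-1 + p^-1 = q^-1)%R ->
  (\int[mu]_x ((f x * g x) `^ q)%:E) `^ q^-1 <=
  (\int[mu]_x (f x `^ s)%:E) `^ s^-1 * (\int[mu]_x (g x `^ p)%:E) `^ p^-1.
Proof.
move=> mf mg f0 g0 q0 p0 s0 spq.
pose F x := (f x `^ q)%R; pose G x := (g x `^ q)%R.
have pq : ((s / q)^-1 + (p / q)^-1 = 1)%R.
  by rewrite !invfM !invrK -mulrDl spq mulVf// gt_eqF.
have qK r : (q / r / q = r^-1)%R by rewrite mulrAC mulfV ?gt_eqF// mul1r.
have := hoelder mu (measurable_powR_comp q mf) (measurable_powR_comp q mg)
  (divr_gt0 s0 q0) (divr_gt0 p0 q0) pq.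
have E1 (h : T -> R) r : (0 < r)%R -> (forall x, 0 <= h x)%R ->
    Lnorm mu (r / q)%:E (EFin \o (fun x => (h x `^ q)%R)) = (\int[mu]_x (h x `^ r)%:E) `^ (q / r).
  move=> r0 h0; rewrite LnormE => [|x]; last exact: powR_ge0.
  rewrite invfM invrK (mulrC r^-1%R); apply: (congr1 (poweR^~ _)); apply: eq_integral => x _.
  by rewrite -powRrM mulrCA mulfV ?mulr1// gt_eqF.
rewrite !E1// => H.
have -> : \int[mu]_x ((f x * g x) `^ q)%:E = Lnorm mu 1 (EFin \o (F \* G)%R).
  rewrite Lnorm1; apply: eq_integral => x _.
  by rewrite /= ger0_norm ?mulr_ge0 ?powR_ge0// /F /G powRM.
have qi : (0 <= q^-1)%R by rewrite invr_ge0 ltW.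
have AB0 : 0 <= (\int[mu]_x (f x `^ s)%:E) `^ (q / s) * (\int[mu]_x (g x `^ p)%:E) `^ (q / p).
  by rewrite mule_ge0// poweR_ge0.
apply: (le_trans (gt0_ler_poweR qi _ _ H)); rewrite ?in_itv/= ?leey ?andbT ?Lnorm_ge0//.
by rewrite poweRM ?poweR_ge0// -!poweRrM !qK.
Qed.

Lemma integral_tail_small (h : T -> R) (B : nat -> set T) e :
  (forall x, (0 <= h x)%R) -> mu.-integrable setT (EFin \o h) ->
  (forall m, measurable (B m)) -> (forall x, exists m0, forall m, (m0 <= m)%N -> ~ B m x) ->
  (0 < e)%R -> exists m, \int[mu]_x (h x * \1_(B m) x)%:E <= e%:E.
Proof.
move=> h0 hi mB Bx e0; have mh := measurable_int _ hi.
have mhB m : measurable_fun setT (fun x => (h x * \1_(B m) x)%:E).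
  apply/measurable_EFinP; apply: measurable_funM; first exact/measurable_EFinP.
  exact: measurable_indic.
have cv : {ae mu, forall x, setT x -> (fun m => (h x * \1_(B m) x)%:E) @ \oo --> (cst 0 x : \bar R)}.
  apply: aeW => x _; have [m0 Hm0] := Bx x.
  apply: cvg_near_cst; exists m0 => // m /= m0m; apply/eqP.
  by rewrite indicE memNset ?mulr0//; exact: Hm0.
have dom : {ae mu, forall x m, setT x -> `|(h x * \1_(B m) x)%:E| <= (EFin \o h) x}.
  apply: aeW => x m _; rewrite lee_fin normrM ger0_norm// ler_piMr//.
  by rewrite indicE ger0_norm// lern1 leq_b1.
have [_ _] := @dominated_convergence _ _ _ mu setT measurableT
  (fun m x => (h x * \1_(B m) x)%:E) (cst 0) (EFin \o h) mhB (measurable_cst _) cv hi dom.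
rewrite integral0 => /fine_cvgP[[N1 _ H1] /cvgrPdist_lt/(_ e e0)[N2 _ H2]].
exists (maxn N1 N2).
have fin := H1 (maxn N1 N2) (leq_maxl _ _).
have := H2 (maxn N1 N2) (leq_maxr _ _); rewrite /= sub0r normrN => /ltW He.
by rewrite -[leLHS]fineK// lee_fin (le_trans (ler_norm _)).
Qed.

End integral_norms.

Section nemytskii.
Context {R : realType}.

Lemma vnorm_measurable dT (T : measurableType dT) m k (w : T -> 'M[R]_(m, k)) :
  borel_mfun w -> measurable_fun setT (fun x => vnorm (w x)).
Proof.
move=> mw; have mS : measurable_fun setT (fun x => \sum_i \sum_j w x i j ^+ 2).
  apply: measurable_sum => i; apply: measurable_sum => j.
  by apply: measurable_funX; exact: borel_entry_measurable.
apply: (measurableT_comp _ mS); apply: continuous_measurable_fun.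
exact: sqrt_continuous.
Qed.

Lemma integral_lincomb dT (T : measurableType dT) (mu : {measure set T -> \bar R})
    (g1 g2 g3 : T -> R) c0 c1 c2 :
  measurable_fun setT g1 -> measurable_fun setT g2 -> measurable_fun setT g3 ->
  (forall x, 0 <= g1 x) -> (forall x, 0 <= g2 x) -> (forall x, 0 <= g3 x) ->
  0 <= c0 -> 0 <= c1 -> 0 <= c2 ->
  (\int[mu]_x (c0 + c1 * g1 x + c2 * (g2 x + g3 x))%:E =
   c0%:E * mu setT + c1%:E * \int[mu]_x (g1 x)%:E +
   c2%:E * (\int[mu]_x (g2 x)%:E + \int[mu]_x (g3 x)%:E))%E.
Proof.
move=> m1 m2 m3 p1 p2 p3 p4 p5 p6.
have me (g : T -> R) : measurable_fun setT g -> measurable_fun setT (fun x => (g x)%:E).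
  by move=> ?; exact/measurable_EFinP.
have D23 : (\int[mu]_x (g2 x + g3 x)%:E = \int[mu]_x (g2 x)%:E + \int[mu]_x (g3 x)%:E)%E.
  under eq_integral do rewrite EFinD.
  by rewrite ge0_integralD//; [move=> x _; rewrite lee_fin|exact: me|
    move=> x _; rewrite lee_fin|exact: me].
have m12 : measurable_fun setT (fun x => c1 * g1 x) by exact: measurable_funM.
have m23 : measurable_fun setT (fun x => g2 x + g3 x) by exact: measurable_funD.
have m4 : measurable_fun setT (fun x => c2 * (g2 x + g3 x)) by exact: measurable_funM.
have m5 : measurable_fun setT (fun x => c0 + c1 * g1 x) by exact: measurable_funD.
under eq_integral do rewrite EFinD.
rewrite ge0_integralD//; [|by move=> x _; rewrite lee_fin addr_ge0// mulr_ge0|exact: me|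
  by move=> x _; rewrite lee_fin mulr_ge0// addr_ge0|exact: me].
under eq_integral do rewrite EFinD.
rewrite ge0_integralD//; [|by move=> x _; rewrite lee_fin mulr_ge0|exact: me].
rewrite (integral_cst mu measurableT).
under eq_integral do rewrite EFinM.
rewrite ge0_integralZl//; [|exact: me|by move=> x _; rewrite lee_fin].
under [X in (_ + X)%E]eq_integral do rewrite EFinM.
rewrite ge0_integralZl//; [|exact: me|by move=> x _; rewrite lee_fin addr_ge0].
by rewrite D23.
Qed.

Lemma Lpnorm_sub_lty dT (T : measurableType dT) (mu : {measure set T -> \bar R}) d (p : R)
    (u v : T -> 'rV[R]_d) : 0 < p -> in_Lp mu p u -> in_Lp mu p v ->
  (Lpnorm mu p (fun x => (u x - v x)%R) < +oo)%E.
Proof.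
move=> p0 [mu_ up] [mv vp].
have p00 : p != 0 by rewrite gt_eqF.
rewrite LpnormE; apply: poweR_lty.
pose D : R := (1 * d)%:R; pose C := D `^ p * 2 `^ p.
have C0 : 0 <= C by rewrite mulr_ge0 ?powR_ge0.
have m1 : measurable_fun setT (fun x => vnorm (u x) `^ p).
  by apply: measurable_powR_comp; exact: vnorm_measurable.
have m2 : measurable_fun setT (fun x => vnorm (v x) `^ p).
  by apply: measurable_powR_comp; exact: vnorm_measurable.
have m3 : measurable_fun setT (fun x => vnorm (u x - v x) `^ p).
  by apply: measurable_powR_comp; apply: vnorm_measurable; exact: borel_sub.
have m12 := measurable_funD m1 m2.
have pp w (x : T) : 0 <= (w x : R) `^ p by exact: powR_ge0.
have m0 : measurable_fun setT (fun _ : T => 0 : R) by exact: measurable_cst.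
have := integral_lincomb mu m0 m1 m2 (fun=> lexx 0)
  (pp (vnorm \o u)) (pp (vnorm \o v)) (lexx 0) (lexx 0) C0.
move=> E; apply: (@le_lt_trans _ _ (\int[mu]_x (0 + 0 * 0 + C * (vnorm (u x) `^ p + vnorm (v x) `^ p))%:E)%E).
  apply: ge0_le_integral => //.
  - by move=> x _; rewrite lee_fin powR_ge0.
  - exact/measurable_EFinP.
  - apply/measurable_EFinP; apply: measurable_funD => //; apply: measurable_funM => //.
  - move=> x _; rewrite lee_fin mul0r !add0r.
    rewrite (@le_trans _ _ ((D * (vnorm (u x) + vnorm (v x))) `^ p))//.
      apply: powR_le; rewrite ?vnorm_ge0 ?(ltW p0)// (le_trans (vnorm_mx_norm _))//.
      by rewrite ler_wpM2l// (le_trans (ler_normB _ _))// lerD// mx_norm_vnorm.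
    rewrite powRM ?addr_ge0 ?vnorm_ge0// /C -mulrA ler_wpM2l ?powR_ge0//.
    by apply: powR_add_le; rewrite ?vnorm_ge0 ?(ltW p0).
rewrite E !mul0e !add0e; apply: lte_mul_pinfty => //.
by rewrite !Lpnorm_integral// lte_add_pinfty// poweR_lty.
Qed.

End nemytskii.

(** * Pointwise bound on the remainder quotient *)

Section pointwise_bound.
Context {R : realType}.
Variables (p q : R).
Hypotheses (q1 : 1 < q) (qp : q < p).

(** The Hoelder exponent [s] with [1/s + 1/p = 1/q]. A quantity growing like the power [p/q - 1]
    has, raised to the power [s], growth of order exactly [p]. *)
Definition hexp : R := p * q / (p - q).

Lemma hexp_gt0 : 0 < hexp.
Proof.
have q0 : 0 < q by exact: lt_trans q1.
by rewrite /hexp divr_gt0 ?subr_gt0// mulr_gt0// (lt_trans q0).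
Qed.

Lemma hexp_conj : hexp^-1 + p^-1 = q^-1.
Proof.
have q0 : 0 < q by exact: lt_trans q1.
have p0 : 0 < p by exact: lt_trans qp.
rewrite /hexp; field.
by rewrite subr_eq0 !gt_eqF.
Qed.

Lemma hexp_mul : (p / q - 1) * hexp = p.
Proof.
have q0 : 0 < q by exact: lt_trans q1.
rewrite /hexp; field.
by rewrite subr_eq0 !gt_eqF.
Qed.

(* [s], [al], [be] stand for [|ubar| + 2], [|u - ubar|] and [|v - ubar|], and [a] for the
   remainder quotient: outside the good set [near] the growth bound on [a] is absorbed
   either by the tail of [s ^ p] or, once [s ^ p <= L], by [al ^ p + be ^ p >= rho ^ p]. *)
Lemma quotient_bound (K K3 s al be a g rho L : R) (near inside : bool) : K3 = K `^ hexp * 4 `^ p ->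
  0 <= K -> 0 <= s -> 0 <= al -> 0 <= be -> 0 <= a -> 0 <= g -> 0 < rho -> 0 <= L ->
  (inside -> s `^ p <= L) -> (~~ near -> rho <= al \/ rho <= be) ->
  (inside -> near -> a <= g) -> a <= K * (s + al + be) `^ (p / q - 1) ->
  a `^ hexp <= g `^ hexp + K3 * (s `^ p * (~~ inside)%:R) +
    K3 * (1 + L / rho `^ p) * (al `^ p + be `^ p).
Proof.
move=> K3E K0 s0 al0 be0 a0 g0 rho0 L0 sL far good aK.
have q0 : 0 < q by exact: lt_trans q1.
have p0 : 0 < p by exact: lt_trans qp.
have K30 : 0 <= K3 by rewrite K3E mulr_ge0 ?powR_ge0.
have h0 := ltW hexp_gt0; have p0' := ltW p0.
have sp0 : 0 <= s `^ p by exact: powR_ge0.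
have ap0 : 0 <= al `^ p by exact: powR_ge0.
have bp0 : 0 <= be `^ p by exact: powR_ge0.
have gp0 : 0 <= g `^ hexp by exact: powR_ge0.
have rp0 : 0 < rho `^ p by exact: powR_gt0.
have Lr0 : 0 <= L / rho `^ p by rewrite divr_ge0// ltW.
have ab0 : 0 <= al `^ p + be `^ p by exact: addr_ge0.
have aK3 : a `^ hexp <= K3 * (s `^ p + (al `^ p + be `^ p)).
  rewrite (@le_trans _ _ ((K * (s + al + be) `^ (p / q - 1)) `^ hexp))//.
    exact: powR_le.
  rewrite powRM ?powR_ge0// -powRrM hexp_mul K3E -mulrA ler_wpM2l ?powR_ge0//.
  by rewrite addrA powR_add3_le.
have K3ab : 0 <= K3 * (al `^ p + be `^ p) by exact: mulr_ge0.
have K3Lab : 0 <= K3 * (L / rho `^ p) * (al `^ p + be `^ p) by exact: mulr_ge0 (mulr_ge0 K30 Lr0) ab0.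
rewrite (mulrDr K3 1) mulr1 mulrDl.
move: sL good; case: inside => [/(_ isT) sL /(_ isT)|_ _] /=; last first.
  rewrite mulr1; move: aK3; rewrite mulrDr.
  by move: (K3 * _) (K3 * _) (K3 * _ * _) (a `^ _) (g `^ _) K3ab K3Lab gp0 => *; lra.
rewrite !mulr0 addr0; move: far; case: near => [_ /(_ isT) ag|/(_ isT) far _].
  rewrite (le_trans (powR_le h0 a0 ag))// lerDl.
  by rewrite addr_ge0.
rewrite (le_trans aK3)// mulrDr addrC (@le_trans _ _ (K3 * (al `^ p + be `^ p) +
    K3 * (L / rho `^ p) * (al `^ p + be `^ p)))//; last by rewrite lerDr.
rewrite lerD2l -mulrA ler_wpM2l// (le_trans sL)//.
rewrite -mulrA ler_peMr// -ler_pdivrMl ?invr_gt0// invrK mulr1.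
by case: far => far; [rewrite (le_trans (powR_le p0' (ltW rho0) far))// lerDl|
  rewrite (le_trans (powR_le p0' (ltW rho0) far))// lerDr].
Qed.

End pointwise_bound.

(** * Choice of the constants and conclusion *)

Theorem mainTheorem9 (R : realType) (dT : measure_display)
  (T : measurableType dT) (mu : {finite_measure set T -> \bar R})
  (d n : nat) (H : T -> 'rV[R]_d -> 'rV[R]_n) (p q : R) :
  measure_is_complete mu ->
  1 < q -> q < p ->
  N1 H -> N2 H p q ->
  forall eps : R, 0 < eps ->
  forall ubar : T -> 'rV[R]_d, in_Lp mu p ubar ->
  exists delta : R, 0 < delta /\
    forall u v : T -> 'rV[R]_d,
      in_Lp mu p u -> (Lpnorm mu p (fun x => (u x - ubar x)%R) <= delta%:E)%E ->
      in_Lp mu p v -> (Lpnorm mu p (fun x => (v x - ubar x)%R) <= delta%:E)%E ->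
      (0 < Lpnorm mu p (fun x => (u x - v x)%R))%E ->
      exists M : T -> 'M[R]_(d, n),
        nem_clarke mu H ubar M /\
        (Lpnorm mu q (fun x => (H x (u x) - H x (v x) - (u x - v x) *m M x)%R)
          < eps%:E * Lpnorm mu p (fun x => (u x - v x)%R))%E.
Proof.
move=> _ q1 qp [mH locH] [_ [_ [CH [CH0 HN2]]]] eps eps0 ubar [mubar ubarp].
have q0 : 0 < q by exact: lt_trans q1.
have p0 : 0 < p by exact: lt_trans qp.
have p00 : p != 0 by rewrite gt_eqF.
have th0 : 0 <= p / q - 1 by rewrite subr_ge0 ler_pdivlMr// mul1r ltW.
have lH x : lip_bounded (H x) by exact: locally_lipschitz_bounded (locally_lipschitz_vnorm (locH x)).
have [disp [S [P [phi av]]]] := averaging_exists (R := R) d.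
have [K K0 HK] := remainder_growth n av (ltW CH0) th0.
pose s := hexp p q; have s0 : 0 < s by exact: hexp_gt0.
have s00 : s != 0 by rewrite gt_eqF.
pose Nn : R := (1 * n)%:R.
pose K2 := Nn * K; have K20 : 0 <= K2 by rewrite mulr_ge0.
pose K3 := K2 `^ s * 4 `^ p; have K30 : 0 <= K3 by rewrite mulr_ge0 ?powR_ge0.
pose M0 := fine (mu setT); have M0E : (mu : {measure set T -> \bar R}) setT = M0%:E by rewrite fineK// fin_num_measure.
have M00 : 0 <= M0 by rewrite fine_ge0.
(* One [tau] for each part of the integral of [a ^ s]: the constant [g ^ s], the tail of [h], and
   the distances to [ubar]. Aiming at [eps / 2] leaves room for the strict inequality. *)
pose tau := (eps / 2) `^ s / 3; have tau0 : 0 < tau by rewrite divr_gt0// powR_gt0// divr_gt0.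
have tauE : (eps / 2) `^ s = tau + tau + tau by rewrite /tau; move: (_ `^ _) => X; field.
pose t := (tau / (M0 + 1)) `^ s^-1.
have tM0 : 0 < tau / (M0 + 1) by rewrite divr_gt0// ltr_wpDl.
have t0 : 0 < t by exact: powR_gt0.
have tE : t `^ s = tau / (M0 + 1) by rewrite /t -powRrM mulVf// powRr1// ltW.
have Nd1 : 0 < Nn * (1 + d%:R) + 1 by rewrite ltr_wpDl// mulr_ge0// addr_ge0.
pose e := t / (Nn * (1 + d%:R) + 1); have e0 : 0 < e by exact: divr_gt0.
pose g := Nn * ((1 + d%:R) * e).
have d1 : 0 <= 1 + d%:R :> R by rewrite addr_ge0.
have g0 : 0 <= g by exact: mulr_ge0 (ler0n _ _) (mulr_ge0 d1 (ltW e0)).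
have gt_ : g <= t.
  rewrite /g /e mulrA mulrCA ler_piMr ?(ltW t0)// ler_pdivrMr// mul1r.
  by rewrite lerDl.
pose h x := (vnorm (ubar x) + 2) `^ p.
have h0 x : 0 <= h x by exact: powR_ge0.
have mub : measurable_fun setT (fun x => vnorm (ubar x)) by exact: vnorm_measurable.
have mh : measurable_fun setT h.
  by apply: measurable_powR_comp; apply: measurable_funD.
have m0 : measurable_fun setT (fun _ : T => 0 : R) by exact: measurable_cst.
have mubp : measurable_fun setT (fun x => vnorm (ubar x) `^ p) by exact: measurable_powR_comp.
have hi : mu.-integrable setT (EFin \o h).
  apply/integrableP; split; first exact/measurable_EFinP.
  have C0 : 0 <= 2 `^ p * 2 `^ p :> R by rewrite mulr_ge0 ?powR_ge0.
  have := integral_lincomb mu mubp m0 m0 (fun x => powR_ge0 (vnorm (ubar x)) p)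
    (fun=> lexx 0) (fun=> lexx 0) C0 (powR_ge0 2 p) (lexx 0).
  rewrite mul0e adde0 => E.
  apply: (@le_lt_trans _ _ (\int[mu]_x (2 `^ p * 2 `^ p + 2 `^ p * vnorm (ubar x) `^ p + 0 * (0 + 0))%:E)%E).
    apply: ge0_le_integral => //.
    - by apply/measurable_EFinP; apply: measurableT_comp.
    - apply/measurable_EFinP; apply: measurable_funD => //; apply: measurable_funD => //.
      by apply: measurable_funM.
    - move=> x _; rewrite lee_fin ger0_norm// mul0r addr0 -mulrDr addrC.
      by apply: powR_add_le; rewrite ?vnorm_ge0 ?(ltW p0).
  rewrite E M0E Lpnorm_integral// lte_add_pinfty// ?ltry//.
  by apply: lte_mul_pinfty; rewrite ?lee_fin ?powR_ge0// poweR_lty.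
pose inside m := level_set P phi H ubar (e ^+ 2) m `&` [set x | h x <= m%:R].
have minside m : measurable (inside m).
  apply: measurableI; first exact: level_set_measurable.
  by apply: measurable_le => //; exact: measurable_cst.
have tK : 0 < tau / (K3 + 1) by rewrite divr_gt0// ltr_wpDl.
(* The sets [inside m] exhaust the space, so the integral of [h] outside one of them is small. This
   fixes the level, hence the radius [rho], and [m] itself bounds [h] inside. *)
have [m Hm] : exists m, (\int[mu]_x (h x * \1_(~` inside m) x)%:E <= (tau / (K3 + 1))%:E)%E.
  apply: integral_tail_small => // [m|x]; first exact: measurableC.
  have e20 : 0 < e ^+ 2 by exact: exprn_gt0.
  have [k Hk] := level_set_cover av lH ubar x e20.
  exists (maxn k (Num.bound (h x))) => m; rewrite geq_max => /andP[km bm]; apply; split.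
    exact: level_set_nondecreasing km _ Hk.
  rewrite /= (le_trans (ltW (archi_boundP (h0 x))))//.
  by rewrite ler_nat.
pose rho : R := (2 * m.+1%:R)^-1; have rho0 : 0 < rho by rewrite invr_gt0 mulr_gt0.
pose K4 := K3 * (1 + m%:R / rho `^ p).
have K40 : 0 <= K4 by rewrite mulr_ge0// addr_ge0// divr_ge0// powR_ge0.
have tK4 : 0 < tau / (2 * (K4 + 1)) by rewrite divr_gt0// mulr_gt0// ltr_wpDl.
(* Makes [2 * K4 * delta ^ p <= tau]. The factor [m / rho ^ p] in [K4] is a Chebyshev-type price for
   the points where [u] or [v] is farther than [rho] from [ubar]. *)
pose delta := (tau / (2 * (K4 + 1))) `^ p^-1.
have delta0 : 0 < delta by exact: powR_gt0.
have deltaE : delta `^ p = tau / (2 * (K4 + 1)) by rewrite /delta -powRrM mulVf// powRr1// ltW.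
exists delta; split => // u v [mu_ up] ud [mv vp] vd wpos.
have [M [mM cM HM]] := mean_value_selection av mH lH mubar m mu_ mv e0.
exists M; split; first by split => //; apply: aeW.
pose Rm x := H x (u x) - H x (v x) - (u x - v x) *m M x.
pose w x := u x - v x.
have vw0 x : vnorm (w x) = 0 -> w x = 0.
  move=> E; apply/eqP; rewrite -normr_eq0 eq_le normr_ge0 andbT -E.
  exact: mx_norm_vnorm.
(* The power [-1] makes measurability immediate and takes the value 0 where [u] and [v] agree; the
   remainder [Rm] vanishes there too. *)
pose a x := vnorm (Rm x) * vnorm (w x) `^ (-1).
have a0 x : 0 <= a x by rewrite mulr_ge0 ?powR_ge0// vnorm_ge0.
have RaE x : vnorm (Rm x) = a x * vnorm (w x).
  rewrite /a powR_inv1 ?vnorm_ge0//.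
  have [E|nE] := eqVneq (vnorm (w x)) 0; last by rewrite divfK.
  have uv : u x = v x by apply/eqP; rewrite -subr_eq0; apply/eqP; exact: vw0.
  rewrite E mulr0; apply/eqP; rewrite eq_le vnorm_ge0 andbT.
  rewrite (le_trans (vnorm_mx_norm _))// /Rm uv !subrr mul0mx subr0 normr0.
  by rewrite mulr0.
have aC x C : 0 <= C -> `|Rm x| <= C * `|w x| -> a x <= Nn * C.
  move=> C0 RC; have NC : 0 <= Nn * C by rewrite mulr_ge0.
  rewrite /a powR_inv1 ?vnorm_ge0//.
  have [->|nE] := eqVneq (vnorm (w x)) 0; first by rewrite invr0 mulr0.
  rewrite ler_pdivrMr; last by rewrite lt_neqAle eq_sym nE vnorm_ge0.
  rewrite (le_trans (vnorm_mx_norm _))// -mulrA ler_wpM2l//.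
  by rewrite (le_trans RC)// ler_wpM2l// mx_norm_vnorm.
pose al x := vnorm (u x - ubar x); pose be x := vnorm (v x - ubar x).
have bound x : a x `^ s <= g `^ s + K3 * (h x * \1_(~` inside m) x) + K4 * (al x `^ p + be x `^ p).
  have -> : \1_(~` inside m) x = (~~ (x \in inside m))%:R :> R by rewrite indicE in_setC.
  apply: (@quotient_bound R p q q1 qp K2 K3 (vnorm (ubar x) + 2) (al x) (be x) (a x) g rho m%:R
    ((`|u x - ubar x| <= rho) && (`|v x - ubar x| <= rho)) (x \in inside m)) => //.
  - by rewrite addr_ge0// vnorm_ge0.
  - exact: vnorm_ge0.
  - exact: vnorm_ge0.
  - by rewrite inE => -[].
  - rewrite negb_and -!ltNge => /orP[/ltW H1|/ltW H1]; [left|right].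
      exact: le_trans H1 (mx_norm_vnorm _).
    exact: le_trans H1 (mx_norm_vnorm _).
  - rewrite inE => -[lx _] /andP[ux vx]; apply: aC; last exact: HM.
    by rewrite mulr_ge0 ?addr_ge0// ltW.
  - pose c := `|ubar x| + `|u x - ubar x| + `|v x - ubar x|.
    have c0 : 0 <= c by rewrite !addr_ge0.
    have uc : `|u x| <= c.
      rewrite -(subrK (ubar x) (u x)) (le_trans (ler_normD _ _))//.
      by rewrite addrC /c lerDl.
    have vc : `|v x| <= c.
      rewrite -(subrK (ubar x) (v x)) (le_trans (ler_normD _ _))// /c addrC lerD2r.
      by rewrite lerDl.
    have yc : `|ubar x| <= c by rewrite /c -addrA lerDl addr_ge0.
    have := HK (H x) (lH x) (fun z A => (HN2 x z).2 A) c (u x) (v x) (ubar x) (M x) c0 uc vc yc (cM x).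
    move=> /(aC x _ (mulr_ge0 K0 (powR_ge0 _ _)))/le_trans; apply.
    rewrite mulrA ler_wpM2l//; apply: powR_le => //; first by rewrite addr_ge0.
    rewrite /c addrAC (addrAC _ _ 2) !lerD// ?mx_norm_vnorm//.
have mw : borel_mfun w by exact: borel_sub.
have mR : borel_mfun Rm.
  apply: borel_sub; last exact: borel_mulmx.
  by apply: borel_sub; apply: (@superposition_borel R _ T d n H mH _ T id) => //; exact: measurable_id.
have ma : measurable_fun setT a.
  apply: measurable_funM; first exact: vnorm_measurable.
  by apply: measurable_powR_comp; exact: vnorm_measurable.
have mal : measurable_fun setT (fun x => al x `^ p).
  by apply: measurable_powR_comp; apply: vnorm_measurable; exact: borel_sub.
have mbe : measurable_fun setT (fun x => be x `^ p).
  by apply: measurable_powR_comp; apply: vnorm_measurable; exact: borel_sub.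
have mab := measurable_funD mal mbe.
have mhi : measurable_fun setT (fun x => h x * \1_(~` inside m) x).
  by apply: measurable_funM => //; apply: measurable_indic; exact: measurableC.
have hi0 x : 0 <= h x * \1_(~` inside m) x by rewrite mulr_ge0// indicE.
have E := integral_lincomb mu mhi mal mbe hi0 (fun x => powR_ge0 (al x) p)
  (fun x => powR_ge0 (be x) p) (powR_ge0 g s) K30 K40.
have small w' : (Lpnorm mu p w' <= delta%:E)%E ->
    (\int[mu]_x (vnorm (w' x : 'rV[R]_d) `^ p)%:E <= (delta `^ p)%:E)%E.
  move=> w'd; rewrite Lpnorm_integral// -poweR_EFin.
  by apply: (gt0_ler_poweR (ltW p0)) w'd; rewrite in_itv/= leey andbT ?Lnorm_ge0// lee_fin ltW.
have Ia : (\int[mu]_x (a x `^ s)%:E <= ((eps / 2) `^ s)%:E)%E.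
  apply: (@le_trans _ _ (\int[mu]_x (g `^ s + K3 * (h x * \1_(~` inside m) x) +
      K4 * (al x `^ p + be x `^ p))%:E)%E).
    apply: ge0_le_integral => //.
    - by move=> x _; rewrite lee_fin powR_ge0.
    - by apply/measurable_EFinP; exact: measurable_powR_comp.
    - apply/measurable_EFinP; apply: measurable_funD; last first.
        by apply: measurable_funM.
      by apply: measurable_funD => //; exact: measurable_funM.
    - by move=> x _; rewrite lee_fin.
  rewrite E M0E.
  apply: (@le_trans _ _ ((g `^ s)%:E * M0%:E + K3%:E * (tau / (K3 + 1))%:E +
      K4%:E * ((delta `^ p)%:E + (delta `^ p)%:E))%E).
    apply: leeD; first apply: leeD => //.
      by apply: lee_wpmul2l => //; rewrite lee_fin.
    by apply: lee_wpmul2l; [rewrite lee_fin|apply: leeD; exact: small].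
  suff : g `^ s * M0 + K3 * (tau / (K3 + 1)) + K4 * (delta `^ p + delta `^ p) <= (eps / 2) `^ s.
    by rewrite -lee_fin.
  rewrite tauE.
  apply: lerD; first apply: lerD.
  - rewrite (@le_trans _ _ (t `^ s * (M0 + 1)))//; last by rewrite tE divfK// gt_eqF// ltr_wpDl.
    by rewrite ler_pM ?powR_ge0// ?lerDl// powR_le// ltW.
  - by rewrite mulrCA ler_piMr ?(ltW tau0)// ler_pdivrMr ?ltr_wpDl// mul1r lerDl.
  - rewrite deltaE; have K41 : 0 < K4 + 1 by rewrite ltr_wpDl.
    have -> : K4 * (tau / (2 * (K4 + 1)) + tau / (2 * (K4 + 1))) = tau * (K4 / (K4 + 1)).
      by field; rewrite gt_eqF.
    by rewrite ler_piMr ?(ltW tau0)// ler_pdivrMr// mul1r lerDl.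
have wlty : (Lpnorm mu p w < +oo)%E by exact: Lpnorm_sub_lty.
have vw x : 0 <= vnorm (w x) by exact: vnorm_ge0.
have Hq : (Lpnorm mu q Rm <= (eps / 2)%:E * Lpnorm mu p w)%E.
  rewrite !LpnormE; under eq_integral do rewrite RaE.
  apply: le_trans (hoelder_powR mu ma (vnorm_measurable mw) a0 vw q0 p0 s0 (hexp_conj q1 qp)) _.
  apply: lee_wpmul2r; first exact: poweR_ge0.
  have -> : (eps / 2)%:E = (((eps / 2) `^ s)%:E `^ s^-1)%E.
    by rewrite poweR_EFin -powRrM mulfV// powRr1// divr_ge0// ltW.
  apply: (gt0_ler_poweR _ _ _ Ia); first by rewrite invr_ge0 ltW.
    by rewrite in_itv/= leey andbT integral_powR_ge0.
  by rewrite in_itv/= leey andbT lee_fin powR_ge0.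
(* The norm of [u - v] is positive and finite, so the bound with [eps / 2] is strictly below the one
   with [eps]. *)
have e2 : eps / 2 < eps by rewrite ltr_pdivrMr// ltr_pMr// ltr1n.
have wfin : Lpnorm mu p w \is a fin_num by rewrite ge0_fin_numE// Lnorm_ge0.
apply: (le_lt_trans Hq).
rewrite lte_pmul2r//.
Qed.
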